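(* Let $n,m\ge 1$, $\beta>0$, $\varepsilon>0$, $c>2+2\varepsilon$, and let $\theta_1,\dots,\theta_m\in\mathbb{S}^1=\mathbb{R}/2\pi\mathbb{Z}$ be fixed points (frozen tokens) that are well-separated: $|\theta_i-\theta_j|>c\beta^{-1/2}$ for all $i\ne j$. Let $a_1,\dots,a_m\ge 1$ be real weights. Let $\mu_0$ be an absolutely continuous probability measure on $(\mathbb{S}^1)^n$ and let $(\varphi_1(0),\dots,\varphi_n(0))\sim\mu_0$. Let $\varphi(t)=(\varphi_1(t),\dots,\varphi_n(t))$ solve, for $k=1,\dots,n$, \[ \dot{\varphi}_k = \frac{1}{Z_k} \Big( \sum_{j = 1}^k e^{\beta (\cos(\varphi_k - \varphi_j)-1)} \sin(\varphi_j - \varphi_k) + \sum_{j=1}^m a_j e^{\beta (\cos(\varphi_k - \theta_j)-1)} \sin(\theta_j - \varphi_k) \Big), \] \[ Z_k = \sum_{j=1}^k e^{\beta (\cos(\varphi_k - \varphi_j)-1)} + \sum_{j=1}^m a_j e^{\beta (\cos(\varphi_k - \theta_j)-1)}. \] Define $N=n+\sum_{j=1}^m a_j$, $h(x)=e^{\beta(\cos x-1)}\sin x$ and $g=h'$. Suppose that \[ N\,h\big((c-1-2\varepsilon)\beta^{-1/2}\big)<h(\varepsilon\beta^{-1/2}) \qquad\text{and}\qquad -N\,g\big((c-2\varepsilon)\beta^{-1/2}\big)<g(\varepsilon\beta^{-1/2}). \] Then with probability one $\varphi(t)$ converges, as $t\to\infty$, to an asymptotically stable critical point $\varphi^*\in(\mathbb{S}^1)^n$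 of the dynamics satisfying \[ \forall k\in\{1,\dots,n\}\ \exists j\in\{1,\dots,m\}:\quad |\varphi_k^*-\theta_j|<\varepsilon\beta^{-1/2}. \]
   Context: Points of $\mathbb{S}^1$ are identified with angles modulo $2\pi$; $|\varphi-\theta|$ denotes the angular (geodesic) distance on the circle. ''Absolutely continuous'' is with respect to Lebesgue measure on $(\mathbb{S}^1)^n$. A critical point is an equilibrium (zero of the vector field) of the ODE system; the only randomness is in the initial condition. *)

(* Defs.v *)
From HB Require Import structures.
From mathcomp Require Import all_boot all_order all_algebra.
From mathcomp Require Import generic_quotient ring.
From mathcomp Require Import all_classical all_reals all_analysis.

Set Implicit Arguments.
Unset Strict Implicit.
Unset Printing Implicit Defensive.

Import Order.TTheory GRing.Theory Num.Theory.
Import numFieldNormedType.Exports.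

Local Open Scope classical_set_scope.
Local Open Scope ring_scope.
Local Open Scope quotient_scope.

Section angle_equiv.
Context (R : realType).

Definition angle_eq (x y : R) : bool :=
  `[< exists k : int, x - y = k%:~R * (2 * pi) >].

Lemma angle_eq_refl : reflexive angle_eq.
Proof. by move=> x; apply/asboolP; exists 0; rewrite subrr mul0r. Qed.

Lemma angle_eq_sym : symmetric angle_eq.
Proof.
suff sym x y : angle_eq x y -> angle_eq y x.
  by move=> x y; apply/idP/idP; exact: sym.
move=> /asboolP[k xyk]; apply/asboolP; exists (- k).
by rewrite -opprB xyk mulrNz mulNr.
Qed.

Lemma angle_eq_trans : transitive angle_eq.
Proof.
move=> y x z /asboolP[k xyk] /asboolP[l yzl]; apply/asboolP; exists (k + l).
by rewrite mulrzDr mulrDl -xyk -yzl addrA subrK.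
Qed.

Canonical angle_equiv :=
  EquivRel angle_eq angle_eq_refl angle_eq_sym angle_eq_trans.

End angle_equiv.

Definition circle (R : realType) : Type := {eq_quot @angle_equiv R}.

HB.instance Definition _ (R : realType) := Choice.on (circle R).
HB.instance Definition _ (R : realType) := EqQuotient.on (circle R).
HB.instance Definition _ (R : realType) :=
  isPointed.Build (circle R) (\pi_(circle R) 0).

Definition to_circle (R : realType) (x : R) : circle R := \pi_(circle R) x.

Lemma to_circleP (R : realType) (x y : R) :
  to_circle x = to_circle y <-> exists k : int, x - y = k%:~R * (2 * pi).
Proof.
split=> [/eqmodP/asboolP//|xy]; exact/eqmodP/asboolP.
Qed.

(* The Borel sigma-algebra of the quotient R/2piZ: a set of classes is
   measurable iff the set of its representatives is. *)
Definition circle_measurable (R : realType) : set (set (circle R)) :=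
  [set A | measurable (@to_circle R @^-1` A)].

Section circle_measurable.
Context (R : realType).

Lemma circle_measurable0 : @circle_measurable R set0.
Proof. by rewrite /circle_measurable/= preimage_set0. Qed.

Lemma circle_measurableC (A : set (circle R)) :
  circle_measurable A -> circle_measurable (~` A).
Proof.
by rewrite /circle_measurable/= preimage_setC => mA; exact: measurableC.
Qed.

Lemma circle_measurable_bigcup (F : (set (circle R))^nat) :
  (forall i, circle_measurable (F i)) -> circle_measurable (\bigcup_i F i).
Proof.
by rewrite /circle_measurable/= preimage_bigcup => mF;
  exact: bigcup_measurable.
Qed.

End circle_measurable.

HB.instance Definition _ (R : realType) :=
  @isMeasurable.Build default_measure_display (circle R)
    (@circle_measurable R) (@circle_measurable0 R) (@circle_measurableC R)
    (@circle_measurable_bigcup R).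

Section circle.
Context (R : realType).
Local Notation circle := (circle R).

(* The quotient metric, i.e. the geodesic distance on the circle. *)
Definition circle_dist (p q : circle) : R :=
  inf [set r | exists x y, [/\ to_circle x = p, to_circle y = q & r = `|x - y|]].

(* A representative of the class p - q; it is only ever passed to
   2pi-periodic functions. *)
Definition circle_sub (p q : circle) : R := repr p - repr q.

(* Lebesgue measure on the n-fold product of circles as the iterated
   integral (Tonelli) of arc length over the fundamental domain [0, 2pi[. *)
Fixpoint torus_lebesgue (n : nat) : set (n.-tuple circle) -> \bar R :=
  match n with
  | 0 => fun A => \d_([tuple] : 0.-tuple circle) A
  | n'.+1 => fun A =>
      (\int[lebesgue_measure]_(x in `[0%R, (2 * pi)%R[)
        torus_lebesgue [set p : n'.-tuple circle |
                        A [tuple of to_circle x :: p]])%E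
  end.

End circle.

Lemma circle_sub_to_circle (R : realType) (x y : R) :
  exists k : int, circle_sub (to_circle x) (to_circle y) = x - y + k%:~R * (2 * pi).
Proof.
have H (z : R) : exists k : int, repr (to_circle z) - z = k%:~R * (2 * pi).
  by apply/to_circleP; exact: reprK.
have [[k Hk] [l Hl]] := (H x, H y); exists (k - l).
by rewrite mulrzBr mulrBl -Hk -Hl /circle_sub; ring.
Qed.

Lemma torus_lebesgue0 (R : realType) n :
  torus_lebesgue (set0 : set (n.-tuple (circle R))) = 0%E.
Proof.
elim: n => [|n IH] /=; first by rewrite diracE in_set0.
under eq_integral do rewrite (_ : [set _ | _] = set0)//.
by rewrite IH integral0.
Qed.

Lemma torus_lebesgue_box (R : realType) n (A : 'I_n -> set (circle R)) :
  (forall i, measurable (A i)) ->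
  torus_lebesgue [set p : n.-tuple (circle R) | forall i, A i (tnth p i)] =
  (\prod_(i < n) lebesgue_measure
     (`[0%R, (2 * pi)%R[ `&` @to_circle R @^-1` A i))%E.
Proof.
elim: n A => [|n IH] A mA.
  by rewrite big_ord0 /= diracE mem_set//; case.
rewrite big_ord_recl /= -(IH (fun i => A (lift ord0 i)))//.
rewrite muleC.
set c := (X in _ = (X * _)%E).
have c0 : (0 <= c)%E.
  rewrite /c (IH (fun i => A (lift ord0 i)))//; apply: prode_ge0 => i _; exact: measure_ge0.
transitivity (\int[lebesgue_measure]_(x in `[0%R, (2 * pi)%R[)
    (c * (\1_(@to_circle R @^-1` A ord0) x)%:E))%E.
  apply: eq_integral => x _.
  rewrite indicE; have [|] := boolP (x \in _); rewrite ?inE => xA /=.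
    rewrite mule1 /c; congr (torus_lebesgue _).
    apply/seteqP; split => p /= H i.
      by have := H (lift ord0 i); rewrite tnthS.
    case: (unliftP ord0 i) => [j ->|->]; first by rewrite tnthS; exact: H.
    by rewrite tnth0.
  rewrite mule0 (_ : [set _ | _] = set0) ?torus_lebesgue0//.
  apply/seteqP; split => p //= /(_ ord0); rewrite tnth0 => H.
  by move: xA; rewrite notin_setE; apply.
have mA0 : measurable (@to_circle R @^-1` A ord0) by exact: (mA ord0).
rewrite ge0_integralZl//; last first.
  by apply/measurable_realfun.measurable_EFinP; exact: measurable_realfun.measurable_indic.
by rewrite integral_indic// setIC.
Qed.

Section dynamical_system.
Context (R : realType) (n : nat).
Implicit Types (V : n.-tuple (circle R) -> 'I_n -> R)
  (phi : R -> n.-tuple (circle R)) (p : n.-tuple (circle R)).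

(* phi : [0, +oo[ -> (S^1)^n solves phi' = V(phi): the derivative of a
   circle-valued curve is that of a continuous lift to R. Values of phi at
   negative times are irrelevant. *)
Definition solves V phi : Prop :=
  exists x : 'I_n -> R -> R, forall k,
    [/\ forall t : R, 0 <= t -> to_circle (x k t) = tnth (phi t) k,
        {within `[0, +oo[, continuous (x k)} &
        forall t : R, 0 < t -> is_derive t 1 (x k) (V (phi t) k)].

Definition converges_to phi p : Prop :=
  forall k, circle_dist (tnth (phi t) k) (tnth p k) @[t --> +oo] --> (0 : R).

Definition critical V p : Prop := forall k, V p k = 0.

Definition lyapunov_stable V p : Prop :=
  forall e : R, 0 < e -> exists2 d : R, 0 < d &
    forall phi, solves V phi ->
      (forall k, circle_dist (tnth (phi 0) k) (tnth p k) < d) ->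
      forall t : R, 0 <= t -> forall k, circle_dist (tnth (phi t) k) (tnth p k) < e.

Definition locally_attractive V p : Prop :=
  exists2 d : R, 0 < d &
    forall phi, solves V phi ->
      (forall k, circle_dist (tnth (phi 0) k) (tnth p k) < d) ->
      converges_to phi p.

Definition asymptotically_stable V p : Prop :=
  lyapunov_stable V p /\ locally_attractive V p.

End dynamical_system.

Section causal_attention.
Context (R : realType).

Definition kernel_h (beta x : R) : R := expR (beta * (cos x - 1)) * sin x.

Definition kernel_g (beta : R) : R -> R := derive1 (kernel_h beta).

Context (n m : nat) (beta : R) (a : 'I_m -> R) (theta : 'I_m -> circle R).

Definition attention_Z (p : n.-tuple (circle R)) (k : 'I_n) : R :=
  \sum_(j < n | (j <= k)%N)
    expR (beta * (cos (circle_sub (tnth p k) (tnth p j)) - 1)) +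
  \sum_(j < m)
    a j * expR (beta * (cos (circle_sub (tnth p k) (theta j)) - 1)).

Definition attention_field (p : n.-tuple (circle R)) (k : 'I_n) : R :=
  (attention_Z p k)^-1 *
  (\sum_(j < n | (j <= k)%N)
     expR (beta * (cos (circle_sub (tnth p k) (tnth p j)) - 1)) *
     sin (circle_sub (tnth p j) (tnth p k)) +
   \sum_(j < m)
     a j * expR (beta * (cos (circle_sub (tnth p k) (theta j)) - 1)) *
     sin (circle_sub (theta j) (tnth p k))).

End causal_attention.

(* Main.v *)
(* Write h for the kernel and tau for the point where it peaks. By causality token
   k is driven by the tokens before it, so convergence is proved one token at a
   time: when the earlier tokens converge to points close to frozen tokens, token
   k obeys a scalar asymptotically autonomous equation. Its limiting force has
   only simple zeros, which forces convergence to one of them.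

   Let s = beta^(-1/2) and d0 = min(eps s, tau / 2). If every source is within d0
   of a frozen token, the force vanishes only at points within d0 of a frozen token,
   where it is restoring, and at points at distance more than tau from all sources,
   where every kernel slope is negative and hence the equilibrium is repelling.
   Halving tau matters: tokens of one cluster then see each other in the region of
   positive slope, which the bound eps s alone would not give.

   Almost no initial condition leads to a repelling zero. Around such a zero
   the k-th component of the field is strictly expanding in the k-th coordinate, so
   two trajectories that stay there and have the same first k - 1 initial
   coordinates coincide. Thus the initial conditions trapped in a given small box
   after a given time form a graph over the first k - 1 coordinates; this set is
   closed, as limits of solutions are solutions, so it is a Lebesgue null set, and
   countably many such sets cover all bad initial conditions. *)

(* The hypotheses compare far pulls and slopes with [h] and [g] at [eps s], whereas the force is
   studied from distance [d0] on, which may be the smaller [tau / 2]. The loss is at most a factor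
   3/2, as [2 h(tau) <= 3 h(tau / 2)]. It is recovered in one of two ways: either the far sources
   are farther by one [s] than the hypothesis on [h] assumes, which gains a factor 2/3, or a second
   source of the same cluster joins the center. These kernel inequalities must hold for every
   [beta], whence the trigonometric part. If [pi <= c s], there is only one frozen token and no far
   source.

   The normalisation varies with token k, but its variation multiplies the force and is negligible
   near a zero, so the slope of the force alone decides stability.

   Solutions are given, not constructed, and only for nonnegative times. In place of a flow there is
   a two-sided Gronwall estimate, which carries a coincidence at a late time back to time 0.
   Trajectories are lifted to the line; boxes of radius at most 1 determine the lift. Closedness of
   the trapped sets serves to make them measurable. *)
Require Import Defs.
From mathcomp Require Import all_boot all_order all_algebra.
From mathcomp Require Import ring lra.
From mathcomp Require Import all_classical all_reals all_analysis.
From mathcomp Require Import measurable_realfun.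

Import Order.TTheory GRing.Theory Num.Theory.
Import numFieldNormedType.Exports.

Local Open Scope classical_set_scope.
Local Open Scope ring_scope.

(** * Calculus on the line *)

Section calculus.
Context {R : realType}.
Implicit Types (f df : R -> R) (x y a b : R).

Lemma mvt f df a b : (forall x, is_derive x 1 f (df x)) -> a < b ->
  exists2 c, a < c < b & f b - f a = df c * (b - a).
Proof.
move=> fdf ab; have fc : {within `[a, b], continuous f}.
  by apply: derivable_within_continuous => x _; exact: ex_derive.
have [c cab fab] := @MVT _ f df a b ab (fun x _ => fdf x) fc.
by exists c => //; move: cab; rewrite in_itv.
Qed.

Lemma nondecreasing_of_deriv f df a b : (forall x, is_derive x 1 f (df x)) ->
  (forall x, a < x < b -> 0 <= df x) ->
  forall x y, a <= x -> x <= y -> y <= b -> f x <= f y.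
Proof.
move=> fdf df0 x y ax; rewrite le_eqVlt => /predU1P[->//|xy] yb.
have [c cxy fxy] := mvt f df x y fdf xy.
rewrite -subr_ge0 fxy mulr_ge0 ?subr_ge0 ?(ltW xy)// df0//; lra.
Qed.

Lemma lipschitz_of_deriv f df M : (forall x, is_derive x 1 f (df x)) ->
  (forall x, `|df x| <= M) -> forall x y, `|f x - f y| <= M * `|x - y|.
Proof.
move=> fdf dfM x y; wlog xy : x y / y < x => [H|].
  have [/H//|xy|->] := ltgtP y x; last by rewrite !subrr normr0 mulr0.
  by rewrite distrC (distrC x); exact: H.
have [c _ ->] := mvt f df y x fdf xy.
by rewrite normrM ler_wpM2r.
Qed.

Lemma mulr_cos_le_sin x : 0 <= x -> x <= pi -> x * cos x <= sin x.
Proof.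
move=> x0 xpi; rewrite -subr_ge0.
pose f z : R := sin z - z * cos z.
have fd (z : R) : is_derive z (1 : R) f (z * sin z).
  by rewrite /f; apply: is_derive_eq; rewrite /GRing.scale/=; ring.
have : f 0 <= f x.
  apply: (nondecreasing_of_deriv f _ 0 pi fd) => // z /andP[z0 zpi].
  by rewrite mulr_ge0 ?(ltW z0)// ltW// sin_gt0_pi// z0.
by rewrite /f sin0 mul0r subrr.
Qed.

Lemma cos_half x : cos x = 2 * cos (x / 2) ^+ 2 - 1.
Proof. by rewrite [in LHS](splitr x) cosD; have := cos2Dsin2 (x / 2); lra. Qed.

Lemma sin_half x : sin x = 2 * sin (x / 2) * cos (x / 2).
Proof. by rewrite [in LHS](splitr x) sinD; ring. Qed.

(** With [A = x / 2] this follows from [A * cos A <= sin A] and [2 * cos A ^+ 2 - 1 <= cos A ^+ 4].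
    It is what bounds the turning point by [s] uniformly in [beta]. *)
Lemma sqr_cos_le_sin2 x : 0 <= x -> x <= pi -> x ^+ 2 * cos x <= sin x ^+ 2.
Proof.
move=> x0 xpi; rewrite cos_half sin_half.
have xh : 0 <= x / 2 by lra.
have := mulr_cos_le_sin _ xh (_ : x / 2 <= pi).
move=> /(_ ltac:(have := @pi_gt0 R; lra)).
set A := x / 2; have -> : x = 2 * A by rewrite /A; lra.
have c0 : 0 <= cos A by rewrite cos_ge0_pihalf// /A; apply/andP; split; have := @pi_gt0 R; lra.
set c := cos A in c0 *; set s := sin A => Ac.
have A2 : (A * c) ^+ 2 <= s ^+ 2 by rewrite lerXn2r// nnegrE; [rewrite mulr_ge0|rewrite (le_trans _ Ac)// mulr_ge0].
have : (A * c) ^+ 2 * c ^+ 2 <= s ^+ 2 * c ^+ 2 by rewrite ler_wpM2r// sqr_ge0.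
have : 0 <= A ^+ 2 * (c ^+ 2 - 1) ^+ 2 by rewrite mulr_ge0 ?sqr_ge0.
by lra.
Qed.

End calculus.

(** * The interaction kernel *)

Section kernel.
Context {R : realType} (beta : R).
Implicit Types x y : R.

Definition kernel_e x : R := expR (beta * (cos x - 1)).

Lemma is_derive_kernel_e x : is_derive x (1 : R) kernel_e (- beta * sin x * kernel_e x).
Proof.
have H : is_derive x (1 : R) (fun x => beta * (cos x - 1)) (- beta * sin x).
  by apply: is_derive_eq; rewrite /GRing.scale/=; ring.
have -> : kernel_e = expR \o (fun x => beta * (cos x - 1)) by [].
apply: is_derive_eq (@is_derive1_comp R expR _ x _ _ (is_derive_expR _) H) _.
by rewrite mulrC.
Qed.

Lemma is_derive_kernel_h x : is_derive x (1 : R) (kernel_h beta)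
  (kernel_e x * (cos x - beta * sin x ^+ 2)).
Proof.
have H := is_derive_kernel_e x.
rewrite (_ : kernel_h beta = kernel_e * sin); last by apply/funext.
by apply: is_derive_eq; rewrite /GRing.scale/=; ring.
Qed.

Lemma kernel_gE x : kernel_g beta x = kernel_e x * (cos x - beta * sin x ^+ 2).
Proof.
by rewrite /kernel_g derive1E; apply: derive_val; exact: is_derive_kernel_h.
Qed.

Lemma kernel_g_deriv x : is_derive x (1 : R) (kernel_h beta) (kernel_g beta x).
Proof. by rewrite kernel_gE; exact: is_derive_kernel_h. Qed.

Lemma is_derive_kernel_g x : is_derive x (1 : R) (kernel_g beta)
  (kernel_e x * sin x * (beta ^+ 2 * sin x ^+ 2 - 3 * beta * cos x - 1)).
Proof.
have H := is_derive_kernel_e x.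
rewrite (_ : kernel_g beta = kernel_e * (cos - (cst beta * (sin ^+ 2))))%R; last first.
  by apply/funext => y; rewrite kernel_gE.
apply: is_derive_eq; rewrite /GRing.scale/= expr1 !fctE; ring.
Qed.

Lemma kernel_e_gt0 x : 0 < kernel_e x.
Proof. exact: expR_gt0. Qed.

Lemma kernel_h_odd x : kernel_h beta (- x) = - kernel_h beta x.
Proof. by rewrite /kernel_h cosN sinN mulrN. Qed.

Lemma kernel_g_even x : kernel_g beta (- x) = kernel_g beta x.
Proof. by rewrite !kernel_gE /kernel_e cosN sinN sqrrN. Qed.

End kernel.

(* The inflection point of the potential: [kernel_g beta tau = 0]. *)
Definition turning_point (R : realType) (beta tau : R) :=
  [/\ 0 < tau, tau < pi / 2 & beta * sin tau ^+ 2 = cos tau].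

Lemma turning_point_exists (R : realType) (beta : R) : 0 < beta ->
  exists tau, turning_point R beta tau.
Proof.
move=> b0; have pi0 := @pi_gt0 R.
pose f (x : R) := beta * sin x ^+ 2 - cos x.
have f0 : f 0 = -1 by rewrite /f sin0 cos0; lra.
have fp : f (pi / 2) = beta by rewrite /f sin_pihalf cos_pihalf; lra.
have fc : {within `[0, pi / 2], continuous f}.
  by apply: derivable_within_continuous => x _; rewrite /f; exact: ex_derive.
have le0p : 0 <= pi / 2 :> R by lra.
have v0 : Num.min (f 0) (f (pi / 2)) <= 0 <= Num.max (f 0) (f (pi / 2)).
  by rewrite f0 fp ge_min le_max; apply/andP; split; apply/orP; [left|right]; lra.
have [x] := @IVT R f 0 (pi / 2) 0 le0p fc v0.
rewrite in_itv /= => /andP[x0 xp] fx; exists x; split.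
- rewrite lt_neqAle x0 andbT; apply/eqP => x0'; move: fx; rewrite -x0' f0; lra.
- rewrite lt_neqAle xp andbT; apply/eqP => x0'; move: fx; rewrite x0' fp; lra.
- by move: fx; rewrite /f; lra.
Qed.

(** * Signs, monotonicity and ratios of the kernel around its peak *)

Section shape.
Context {R : realType} (beta tau : R).
Implicit Types x y d s : R.
Local Notation h := (kernel_h beta).
Local Notation g := (kernel_g beta).
Local Notation tp := (turning_point R beta tau).

Lemma cos_lt_0pi x y : 0 <= x -> x < y -> y <= pi -> cos y < cos x.
Proof. by move=> x0 xy ypi; rewrite ltr_cos// in_itv /=; lra. Qed.

Lemma turning_point_lt_pi : tp -> [/\ 0 < tau, tau < pi / 2, tau < pi & 0 < (pi : R)].
Proof. by move=> [t0 tpi _]; split => //; lra. Qed.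

Lemma cos_turning_gt0 : tp -> 0 < cos tau.
Proof. by move=> [t0 tpi _]; apply: cos_gt0_pihalf; lra. Qed.

Lemma sin_turning_gt0 : tp -> 0 < sin tau.
Proof. by move=> [t0 tpi _]; apply: sin_gt0_pi; lra. Qed.

(** The equation [beta * sin tau ^+ 2 = cos tau] turns [tau ^+ 2 * cos tau <= sin tau ^+ 2] into
    [beta * tau ^+ 2 <= 1]. *)
Lemma turning_point_le s : 0 < beta -> tp -> 0 < s -> beta * s ^+ 2 = 1 -> tau <= s.
Proof.
move=> b0 T s0 bs; have st := sin_turning_gt0 T; have [t0 tpi bt] := T.
have := sqr_cos_le_sin2 _ (ltW t0) (_ : tau <= pi).
move=> /(_ ltac:(lra)); rewrite -bt => H.
have sin2 : 0 < sin tau ^+ 2 by rewrite exprn_gt0.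
have tb1 : tau ^+ 2 * beta <= 1 by rewrite -(@ler_pM2r _ (sin tau ^+ 2))// mul1r -mulrA.
have : tau ^+ 2 <= s ^+ 2 by rewrite -(ler_pM2l b0) bs mulrC.
by rewrite ler_pXn2r// nnegrE ltW.
Qed.

(** The left side is a quadratic polynomial in [cos x] with root [cos tau]. The other factor is
    positive, so [g x] has the sign of [cos x - cos tau] on the whole circle. *)
Lemma kernel_g_factor x : tp -> cos x - beta * sin x ^+ 2 =
  (cos x - cos tau) * (1 + beta * (cos x + cos tau)).
Proof. by move=> [_ _]; rewrite !sin2cos2; lra. Qed.

Lemma kernel_g_factor_gt0 x : 0 < beta -> tp -> 0 < 1 + beta * (cos x + cos tau).
Proof.
move=> b0 T; have ct := cos_turning_gt0 T; have [_ _] := T; rewrite sin2cos2 => bt.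
have b1c : beta * (1 - cos tau) < 1.
  have : beta * (1 - cos tau) * (1 + cos tau) < 1 * (1 + cos tau) by lra.
  by rewrite ltr_pM2r//; lra.
have := cos_geN1 x; rewrite -(ler_pM2l b0); lra.
Qed.

Lemma kernel_g_gt0 x : 0 < beta -> tp -> `|x| < tau -> 0 < g x.
Proof.
move=> b0 T xt; have [t0 _ tpi _] := turning_point_lt_pi T.
rewrite kernel_gE mulr_gt0 ?kernel_e_gt0// kernel_g_factor// mulr_gt0 ?kernel_g_factor_gt0//.
by rewrite subr_gt0 -(cos_norm x) cos_lt_0pi//; lra.
Qed.

Lemma kernel_g_ge0 x : 0 < beta -> tp -> `|x| <= tau -> 0 <= g x.
Proof.
move=> b0 T; rewrite le_eqVlt => /predU1P[xt|/(kernel_g_gt0 _ b0 T)/ltW//].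
by rewrite kernel_gE kernel_g_factor// -(cos_norm x) xt subrr mul0r mulr0.
Qed.

Lemma kernel_g_lt0 x : 0 < beta -> tp -> tau < `|x| -> `|x| <= pi -> g x < 0.
Proof.
move=> b0 T xt xpi; have [t0 _ tpi _] := turning_point_lt_pi T.
rewrite kernel_gE -oppr_gt0 -mulrN mulr_gt0 ?kernel_e_gt0//.
rewrite kernel_g_factor// -mulNr mulr_gt0 ?kernel_g_factor_gt0//.
by rewrite oppr_gt0 subr_lt0 -(cos_norm x) cos_lt_0pi//; lra.
Qed.

Lemma kernel_h_increasing x y : 0 < beta -> tp ->
  0 <= x -> x <= y -> y <= tau -> h x <= h y.
Proof.
move=> b0 T x0 xy yt.
apply: (nondecreasing_of_deriv _ _ 0 tau (kernel_g_deriv beta)) => //.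
by move=> z /andP[z0 zt]; apply: kernel_g_ge0 => //; rewrite gtr0_norm ?ltW.
Qed.

Lemma kernel_h_decreasing x y : 0 < beta -> tp ->
  tau <= x -> x <= y -> y <= pi -> h y <= h x.
Proof.
move=> b0 T tx xy ypi; have [t0 _ _ _] := turning_point_lt_pi T; rewrite -lerN2.
have H z : is_derive z (1 : R) (fun z => - h z) (- g z).
  by have := kernel_g_deriv beta z => H; apply: is_derive_eq.
apply: (nondecreasing_of_deriv _ _ tau pi H) => //.
move=> z /andP[z0 zt]; have z1 : 0 < z by lra.
by rewrite oppr_ge0 ltW// kernel_g_lt0// gtr0_norm//; lra.
Qed.

Lemma kernel_h_ge0 x : 0 <= x -> x <= pi -> 0 <= h x.
Proof. by move=> x0 xpi; rewrite mulr_ge0 ?expR_ge0// sin_ge0_pi// x0. Qed.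

Lemma kernel_h_gt0 x : 0 < x -> x < pi -> 0 < h x.
Proof. by move=> x0 xpi; rewrite mulr_gt0 ?expR_gt0// sin_gt0_pi// x0. Qed.

(** Where [g] is nonnegative, [beta * sin z ^+ 2 <= cos z], and the bracket in the derivative of [g]
    is at most [- 2 * beta * cos z - 1]. *)
Lemma kernel_g_decreasing x y : 0 < beta -> tp ->
  0 <= x -> x <= y -> y <= tau -> g y <= g x.
Proof.
move=> b0 T x0 xy yt; have [t0 _ tpi _] := turning_point_lt_pi T.
have ct := cos_turning_gt0 T; rewrite -lerN2.
have H z : is_derive z (1 : R) (fun z => - g z)
    (- (kernel_e beta z * sin z * (beta ^+ 2 * sin z ^+ 2 - 3 * beta * cos z - 1))).
  by have := is_derive_kernel_g beta z => H; apply: is_derive_eq.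
apply: (nondecreasing_of_deriv _ _ 0 tau H) => //.
move=> z /andP[z0 zt]; rewrite oppr_ge0 mulr_ge0_le0//.
  by rewrite mulr_ge0 ?ltW ?kernel_e_gt0// sin_gt0_pi//; lra.
have cz : cos tau < cos z by rewrite cos_lt_0pi//; lra.
have : 0 <= g z by rewrite kernel_g_ge0// gtr0_norm// ltW.
rewrite kernel_gE pmulr_rge0 ?kernel_e_gt0// subr_ge0 -(ler_pM2l b0).
have : 0 < beta * cos z by rewrite mulr_gt0//; lra.
by rewrite expr2; lra.
Qed.

(** This is the price of [d0 = tau / 2]. The equation of [tau] expresses [beta] through
    [C = cos (tau / 2)], and [1 + x <= expR x] then leaves a polynomial inequality in [C]. *)
Lemma kernel_h_half : 0 < beta -> tp -> 2 * h tau <= 3 * h (tau / 2).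
Proof.
move=> b0 T; have ct0 := cos_turning_gt0 T; have [t0 tpi bt] := T.
rewrite /kernel_h [sin tau]sin_half.
set A := tau / 2; set C := cos A; set S := sin A.
have S0 : 0 < S by apply: sin_gt0_pi; rewrite /A; lra.
have C0 : 0 < C by apply: cos_gt0_pihalf; rewrite /A; lra.
have C1 : C < 1 by rewrite -(@cos0 R) cos_lt_0pi//; rewrite /A; lra.
have ct : cos tau = 2 * C ^+ 2 - 1 by rewrite cos_half.
have bC : beta * (4 * C ^+ 2 * (1 - C ^+ 2)) = 2 * C ^+ 2 - 1.
  rewrite -ct -bt sin_half -/A -/C -/S -(sin2cos2 A) -/S; ring.
rewrite ct; set X := beta * (C - 1); set Y := beta * _.
have -> : X = Y + beta * (1 + C - 2 * C ^+ 2) by rewrite /X /Y; ring.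
rewrite expRD; set x := beta * (1 + C - 2 * C ^+ 2).
suff : 4 * C <= 3 * expR x.
  move=> H; have : 0 <= (3 * expR x - 4 * C) * (expR Y * S).
    by rewrite !mulr_ge0 ?expR_ge0 ?subr_ge0// ltW.
  lra.
suff : 4 * C <= 3 * (1 + x) by have := expR_ge1Dx x; lra.
have xC : x * (4 * C ^+ 2 * (1 + C)) = (2 * C ^+ 2 - 1) * (1 + 2 * C).
  apply: (mulIf (_ : 1 - C != 0)); first by rewrite subr_eq0 gt_eqF.
  rewrite -bC /x; ring.
have c2 : 1 < 2 * C ^+ 2 by lra.
have P0 : 0 < 4 * C ^+ 2 * (1 + C) by rewrite !mulr_gt0 ?exprn_gt0//; lra.
rewrite -(ler_pM2r P0).
have -> : 3 * (1 + x) * (4 * C ^+ 2 * (1 + C)) =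
  3 * (4 * C ^+ 2 * (1 + C)) + 3 * (x * (4 * C ^+ 2 * (1 + C))) by ring.
rewrite xC; nra.
Qed.

(** Combined with [kernel_h_half] it gives [h tau <= h (tau / 2) + h (3 * (tau / 2))]: the pulls of
    a center and of a token of its cluster can replace the peak value. *)
Lemma kernel_h_half3 : 0 < beta -> tp -> h (tau / 2) <= 2 * h (3 * (tau / 2)).
Proof.
move=> b0 T; have ct0 := cos_turning_gt0 T; have [t0 tpi bt] := T.
set A := tau / 2; set C := cos A; set S := sin A.
have S0 : 0 < S by apply: sin_gt0_pi; rewrite /A; lra.
have C0 : 0 < C by apply: cos_gt0_pihalf; rewrite /A; lra.
have C1 : C < 1 by rewrite -(@cos0 R) cos_lt_0pi//; rewrite /A; lra.
have ct : cos tau = 2 * C ^+ 2 - 1 by rewrite cos_half.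
have bC : beta * (4 * C ^+ 2 * (1 - C ^+ 2)) = 2 * C ^+ 2 - 1.
  rewrite -ct -bt sin_half -/A -/C -/S -(sin2cos2 A) -/S; ring.
have S2 : S ^+ 2 = 1 - C ^+ 2 by exact: sin2cos2.
have A3 : 3 * A = tau + A by rewrite /A; lra.
have sA3 : sin (3 * A) = S * (4 * C ^+ 2 - 1).
  by rewrite A3 sinD sin_half ct -/A -/C -/S; ring.
have cA3 : cos (3 * A) = 4 * C ^+ 3 - 3 * C.
  rewrite A3 cosD sin_half ct -/A -/C -/S.
  have -> : 2 * S * C * S = 2 * C * S ^+ 2 by ring.
  rewrite S2; ring.
rewrite /kernel_h sA3 cA3 -/C -/S.
set X := beta * (C - 1).
have -> : beta * (4 * C ^+ 3 - 3 * C - 1) = X - beta * (4 * C * (1 - C ^+ 2)).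
  by rewrite /X; ring.
set x := beta * (4 * C * (1 - C ^+ 2)).
have xC : x * C = 2 * C ^+ 2 - 1 by rewrite -bC /x; ring.
rewrite expRD.
suff : 1 <= 2 * (expR (- x) * (4 * C ^+ 2 - 1)).
  move=> H; have : 0 <= (2 * (expR (- x) * (4 * C ^+ 2 - 1)) - 1) * (expR X * S).
    by rewrite !mulr_ge0 ?expR_ge0 ?subr_ge0// ltW.
  lra.
have c2 : 1 < 2 * C ^+ 2 by lra.
have x1 : x <= 1 by rewrite -(ler_pM2r C0) xC; nra.
(* The plain bound [1 - x] would be too weak, since [x = 2 * C - 1 / C] tends to 1 as [C] does. *)
have ex : (1 - x / 2) ^+ 2 <= expR (- x).
  have -> : expR (- x) = expR (- x / 2) ^+ 2 by rewrite -expRM_natl; congr expR; lra.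
  rewrite lerXn2r// ?nnegrE ?expR_ge0//; first lra.
  by have := expR_ge1Dx (- x / 2); lra.
suff : 1 <= 2 * ((1 - x / 2) ^+ 2 * (4 * C ^+ 2 - 1)).
  move/le_trans; apply; rewrite ler_pM2l// ler_wpM2r//; lra.
rewrite -(@ler_pM2r _ (C ^+ 2)) ?exprn_gt0//.
have -> : 2 * ((1 - x / 2) ^+ 2 * (4 * C ^+ 2 - 1)) * C ^+ 2 =
  2 * (4 * C ^+ 2 - 1) * (C - (x * C) / 2) ^+ 2 by field.
rewrite xC.
have : 1 / 2 * (1 / 2) <= (C - (2 * C ^+ 2 - 1) / 2) ^+ 2 by rewrite expr2 ler_pM//; nra.
have c3 : 0 <= 4 * C ^+ 2 - 1 by lra.
by move/(ler_wpM2l c3); lra.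
Qed.

End shape.

(** * Taylor bounds and the quartic inequality behind the convexity of the tail *)

Section taylor.
Context {R : realType}.
Implicit Types x y z : R.

Lemma ge0_of_deriv (f df : R -> R) : (forall x, is_derive x 1 f (df x)) ->
  f 0 = 0 -> (forall x, 0 <= x -> 0 <= df x) -> forall x, 0 <= x -> 0 <= f x.
Proof.
move=> fdf f0 df0 x x0; rewrite -f0.
by apply: (nondecreasing_of_deriv _ _ 0 x fdf) => // z /andP[z0 _]; rewrite df0 ?ltW.
Qed.

Lemma sin_le_id x : 0 <= x -> sin x <= x.
Proof.
move=> x0; rewrite -subr_ge0; have fd : forall z : R, is_derive z (1 : R) (fun x => x - sin x) ((fun x => 1 - cos x) z).
  by move=> z; apply: is_derive_eq; rewrite /GRing.scale/=; lra.
apply: (ge0_of_deriv _ _ fd _ _ _ x0).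
- by rewrite sin0 subr0.
- by move=> z _; rewrite subr_ge0 cos_le1.
Qed.

Lemma cos_ge_taylor2 x : 0 <= x -> 1 - x ^+ 2 / 2 <= cos x.
Proof.
move=> x0; rewrite -subr_ge0.
have fd : forall z : R, is_derive z (1 : R) (fun x => cos x - (1 - x ^+ 2 / 2)) ((fun x => x - sin x) z).
  by move=> z; apply: is_derive_eq; rewrite /GRing.scale/=; lra.
apply: (ge0_of_deriv _ _ fd _ _ _ x0).
- by rewrite cos0 expr0n /=; lra.
- by move=> z z0; rewrite subr_ge0 sin_le_id.
Qed.

Lemma sin_ge_taylor3 x : 0 <= x -> x - x ^+ 3 / 6 <= sin x.
Proof.
move=> x0; rewrite -subr_ge0.
have fd : forall z : R, is_derive z (1 : R) (fun x => sin x - (x - x ^+ 3 / 6)) ((fun x => cos x - (1 - x ^+ 2 / 2)) z).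
  by move=> z; apply: is_derive_eq; rewrite /GRing.scale/=; lra.
apply: (ge0_of_deriv _ _ fd _ _ _ x0).
- by rewrite sin0 expr0n /=; lra.
- by move=> z z0; rewrite subr_ge0 cos_ge_taylor2.
Qed.

Lemma cos_le_taylor4 x : 0 <= x -> cos x <= 1 - x ^+ 2 / 2 + x ^+ 4 / 24.
Proof.
move=> x0; rewrite -subr_ge0.
have fd : forall z : R, is_derive z (1 : R) (fun x => 1 - x ^+ 2 / 2 + x ^+ 4 / 24 - cos x) ((fun x => sin x - (x - x ^+ 3 / 6)) z).
  by move=> z; apply: is_derive_eq; rewrite /GRing.scale/=; lra.
apply: (ge0_of_deriv _ _ fd _ _ _ x0).
- by rewrite cos0 !expr0n /=; lra.
- by move=> z z0; rewrite subr_ge0 sin_ge_taylor3.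
Qed.

(** The half-angle form of [sin_cos_quartic]. As a function of [u = cos x ^+ 2] the right side has
    minimum [3 / 4] at [u = 3 / 4], which settles [x ^+ 2 <= 3 / 4]. Beyond that, the fourth-order
    bound on the cosine is convex in [x ^+ 2] and is replaced by rounded chords on two intervals. *)
Lemma sqr_le_cos_quartic x : 0 <= x -> x <= pi / 2 ->
  x ^+ 2 <= 4 * cos x ^+ 4 - 6 * cos x ^+ 2 + 3.
Proof.
move=> x0 xpi; have c0 : 0 <= cos x by apply: cos_ge0_pihalf; lra.
have e4 z : z ^+ 4 = (z ^+ 2) ^+ 2 :> R by rewrite -exprM.
have := cos_le_taylor4 _ x0; rewrite !e4.
set Q := x ^+ 2; set c := cos x in c0 *; move=> ck.
have Q0 : 0 <= Q by rewrite sqr_ge0.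
have xp2 : x < 2 by have := @pihalf_lt2 R; lra.
have Q4 : Q < 4 by rewrite /Q expr2; nra.
set u := c ^+ 2; have u0 : 0 <= u by rewrite sqr_ge0.
have [Q1|Q1] := leP Q (3 / 4).
  by have := sqr_ge0 (2 * u - 3 / 2); lra.
have [Q2|Q2] := leP Q 1.
  have c65 : c <= 65 / 100.
    have : 0 <= (Q - 3 / 4) * (1 - Q) by rewrite mulr_ge0//; lra.
    lra.
  have : u <= 43 / 100 by rewrite /u expr2; nra.
  nra.
(* Since [0 <= cos x], the fourth-order bound puts [Q] below the smaller root of
   [1 - Q / 2 + Q ^+ 2 / 24], about 2.536. *)
have Q254 : Q <= 254 / 100 by nra.
have cQ : c <= 9 / 10 - 35 / 100 * Q.
  have : 0 <= (Q - 1) * (254 / 100 - Q) by rewrite mulr_ge0//; lra.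
  lra.
have : u <= (9 / 10 - 35 / 100 * Q) ^+ 2 by rewrite /u lerXn2r// nnegrE; lra.
nra.
Qed.

(** For [beta * x ^+ 2 = 4] this is, up to the factor [x ^+ 4], the sign condition on the derivative
    of [g]; larger [beta * x ^+ 2] reduce to this case. *)
Lemma sin_cos_quartic x : 0 <= x -> x <= pi ->
  0 <= 16 * sin x ^+ 2 - 12 * x ^+ 2 * cos x - x ^+ 4.
Proof.
move=> x0 xpi; rewrite cos_half sin_half.
have A0 : 0 <= x / 2 by lra.
have Api : x / 2 <= pi / 2 by lra.
have := mulr_cos_le_sin _ A0 (_ : x / 2 <= pi); move=> /(_ ltac:(have := @pi_gt0 R; lra)).
have c0 : 0 <= cos (x / 2) by apply: cos_ge0_pihalf; have := @pi_gt0 R; lra.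
have := sqr_le_cos_quartic _ A0 Api.
set A := x / 2 in A0 Api c0 *; have -> : x = 2 * A by rewrite /A; lra.
set c := cos A in c0 *; set s := sin A => H Ac.
have A2 : (A * c) ^+ 2 <= s ^+ 2.
  by rewrite lerXn2r// nnegrE; [rewrite mulr_ge0|rewrite (le_trans _ Ac)// mulr_ge0].
have H1 : (A * c) ^+ 2 * c ^+ 2 <= s ^+ 2 * c ^+ 2 by rewrite ler_wpM2r// sqr_ge0.
have H2 : A ^+ 2 * A ^+ 2 <= A ^+ 2 * (4 * c ^+ 4 - 6 * c ^+ 2 + 3) by rewrite ler_wpM2l// sqr_ge0.
lra.
Qed.

End taylor.

(** * The kernel at distances beyond [2 * s] *)

Section tail.
Context {R : realType} (beta s : R).
Implicit Types x y : R.
Local Notation h := (kernel_h beta).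
Local Notation g := (kernel_g beta).

Lemma kernel_g_increasing x y : 0 < beta -> 0 < s -> beta * s ^+ 2 = 1 ->
  2 * s <= x -> x <= y -> y <= pi -> g x <= g y.
Proof.
move=> b0 s0 bs sx xy ypi.
apply: (nondecreasing_of_deriv _ _ (2 * s) pi (is_derive_kernel_g beta)) => //.
move=> z /andP[sz zpi]; have z0 : 0 < z by lra.
rewrite mulr_ge0// ?mulr_ge0 ?sin_ge0_pi ?(ltW (kernel_e_gt0 _ _)) ?(ltW z0) ?(ltW zpi)//.
have z4 : 4 <= beta * z ^+ 2.
  have <- : beta * (2 * s) ^+ 2 = 4 by lra.
  by rewrite ler_pM2l// lerXn2r ?nnegrE; lra.
have := sin_cos_quartic _ (ltW z0) (ltW zpi).
have S0 := sqr_ge0 (sin z).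
set S := sin z ^+ 2 in S0 *; set C := cos z.
have z40 : 0 < z ^+ 4 by rewrite exprn_gt0.
rewrite -(pmulr_rge0 _ z40).
have -> : z ^+ 4 * (beta ^+ 2 * S - 3 * beta * C - 1) =
  (beta * z ^+ 2) ^+ 2 * S - 3 * (beta * z ^+ 2) * z ^+ 2 * C - z ^+ 4 by ring.
set k := beta * z ^+ 2 in z4 *;
have X4 : 0 <= z ^+ 4 by exact: ltW.
move=> H.
have H1 : 0 <= k / 4 * (16 * S - 12 * z ^+ 2 * C - z ^+ 4) by rewrite mulr_ge0//; lra.
have H2 : 0 <= k * (k - 4) * S by rewrite mulr_ge0// mulr_ge0; lra.
have H3 : 0 <= (k - 4) * z ^+ 4 by rewrite mulr_ge0//; lra.
lra.
Qed.

(** A shift by [s] in the tail gains what [kernel_h_half] loses. Around the midpoint [w = y - s / 2]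
    the quotient of the two values is [expR E] times a quotient of sines; the sign of [cos w]
    decides which lower bound of the exponential is used. *)
Lemma kernel_h_shift y : 0 < beta -> 0 < s -> beta * s ^+ 2 = 1 ->
  2 * s < y -> y < pi -> 3 * h y <= 2 * h (y - s).
Proof.
move=> b0 s0 bs sy ypi.
pose sg := s / 2; pose w := y - sg.
have -> : y = w + sg by rewrite /w; lra.
have -> : w + sg - s = w - sg by rewrite /sg; lra.
have sg0 : 0 < sg by rewrite /sg; lra.
have wpi : w + sg < pi by rewrite /w /sg; lra.
have sw : 3 * sg < w by rewrite /w /sg; lra.
have bsg : 4 * beta * sg ^+ 2 = 1 by rewrite /sg; lra.
clearbody sg w; clear y sy ypi bs s0.
rewrite /kernel_h; set X := beta * (cos (w - sg) - 1).
have -> : beta * (cos (w + sg) - 1) = X - 2 * beta * (sin w * sin sg).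
  by rewrite /X cosD cosB; ring.
rewrite expRD expRN.
set E := 2 * beta * (sin w * sin sg).
have E0 : 0 < expR E by exact: expR_gt0.
suff : 3 * sin (w + sg) <= 2 * expR E * sin (w - sg).
  move=> H; rewrite -(ler_pM2r E0).
  have -> : 3 * (expR X / expR E * sin (w + sg)) * expR E = expR X * (3 * sin (w + sg)).
    by field; rewrite gt_eqF.
  have -> : 2 * (expR X * sin (w - sg)) * expR E = expR X * (2 * expR E * sin (w - sg)) by ring.
  by rewrite ler_pM2l ?expR_gt0.
have sgpi : sg < pi / 4 by lra.
have w0 : 0 < sin w by apply: sin_gt0_pi; lra.
have s'0 : 0 < sin sg by apply: sin_gt0_pi; lra.
have c0 : 0 < cos sg by apply: cos_gt0_pihalf; lra.
have sB0 : 0 < sin (w - sg) by apply: sin_gt0_pi; lra.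
have cs : sin sg < cos sg.
  have -> : sin sg = cos (pi / 2 - sg) by rewrite cosB cos_pihalf sin_pihalf; ring.
  by apply: cos_lt_0pi; lra.
(* The relation [4 * beta * sg ^+ 2 = 1] eliminates [beta]; this lower bound is all that is kept of
   [E]. *)
have EE : sin w * cos sg <= 2 * sin sg * E.
  have H : sg ^+ 2 * cos sg <= sin sg ^+ 2 by apply: sqr_cos_le_sin2; lra.
  have H' : cos sg <= 4 * beta * sin sg ^+ 2.
    have := ler_wpM2l (_ : 0 <= 4 * beta) H; rewrite mulrA bsg mul1r; apply; lra.
  have := ler_wpM2l (ltW w0) H'; rewrite /E; lra.
move: sB0; rewrite (sinD w sg) (sinB w sg); clearbody E; set S := sin w in w0 EE *; set K := cos w.
set c := cos sg in c0 cs EE *; set p := sin sg in s'0 cs EE *.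
have SK : K ^+ 2 + S ^+ 2 = 1 by exact: cos2Dsin2.
have cp : c ^+ 2 + p ^+ 2 = 1 by exact: cos2Dsin2.
move=> sB0; have E1 : 0 < E.
  by rewrite -(pmulr_rgt0 _ (_ : 0 < 2 * p)); [apply: lt_le_trans EE; rewrite mulr_gt0|lra].
have [K0|K0] := leP K 0.
  suff : 3 * (S * c + K * p) <= 2 * (1 + E) * (S * c - K * p).
    move/le_trans; apply; apply: ler_wpM2r; first exact: ltW.
    by rewrite ler_pM2l// expR_ge1Dx.
  have H1 : S * c * (S * c - K * p) <= 2 * p * E * (S * c - K * p) by rewrite ler_pM2r.
  have SK1 : 1 <= S - K by nra.
  have H2 : S * p <= S * c by rewrite ler_pM2l// ltW.
  have H3 : p <= S * c - K * p.
    by have := ler_wpM2l (ltW s'0) SK1; lra.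
  have Sc0 : 0 < S * c by rewrite mulr_gt0.
  have H4 : S * c * p <= S * c * (S * c - K * p) by rewrite ler_pM2l.
  have H5 : 0 <= - K * p by rewrite mulr_ge0 ?(ltW s'0)//; lra.
  rewrite -(ler_pM2r s'0); have := mulr_ge0 H5 (ltW s'0); lra.
(* The tangent of the exponential through the origin, with [(3 / 2) ^+ 2] in place of [e]. *)
have ex : 9 / 4 * E <= expR E.
  have -> : expR E = expR (1 / 2) ^+ 2 * expR (E - 1).
    by rewrite -expRM_natl -expRD; congr expR; lra.
  apply: ler_pM => //; [exact: ltW| |by have := expR_ge1Dx (E - 1); lra].
  have := expR_ge1Dx (1 / 2 : R) => e2.
  have -> : 9 / 4 = (3 / 2) ^+ 2 :> R by lra.
  by rewrite lerXn2r// ?nnegrE ?expR_ge0//; lra.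
(* The condition [3 * sg < w] in algebraic form: [0 <= sin (w - 3 * sg)], expanded. *)
have w3 : K * (3 * c ^+ 2 * p - p ^+ 3) <= S * (c ^+ 3 - 3 * c * p ^+ 2).
  have : 0 <= sin (w - (sg + sg + sg)) by apply: sin_ge0_pi; lra.
  rewrite sinB !(sinD _ sg) !(cosD _ sg) !(sinD _ sg) -/S -/K -/c -/p; lra.
have a0 : 0 < S * c by rewrite mulr_gt0.
have b0' : 0 < K * p by rewrite mulr_gt0.
set a := S * c in sB0 EE a0 *; set b := K * p in sB0 b0' *.
have D0 : 0 < a - b by [].
have pE : p ^+ 2 * (c ^+ 2) = a ^+ 2 * p ^+ 2 + b ^+ 2 * c ^+ 2.
  by rewrite /a /b -[LHS]mul1r -SK; ring.
have w3' : p ^+ 2 * (3 * a - b) <= c ^+ 2 * (a - 3 * b).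
  by rewrite /a /b; lra.
suff : 4 * p * (a + b) <= 3 * a * (a - b).
  move=> H; have H1 : 9 / 4 * a * (a - b) <= 9 / 4 * (2 * p * E) * (a - b).
    by rewrite ler_pM2r// ler_pM2l.
  have H2 : 2 * (9 / 4 * E) * (a - b) <= 2 * expR E * (a - b) by rewrite ler_pM2r// ler_pM2l.
  apply: le_trans H2; rewrite -(ler_pM2r s'0); lra.
have H : 0 <= 9 * (3 * a - b) * a ^+ 2 - 16 * (a + b) ^+ 2 * (a - b).
  have H1 : 0 <= a * (11 * (a - 25 / 22 * b) ^+ 2 + 79 / 44 * b ^+ 2).
    by rewrite mulr_ge0 ?(ltW a0)// addr_ge0// mulr_ge0 ?sqr_ge0.
  have H2 : 0 < b ^+ 3 by rewrite exprn_gt0.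
  lra.
have ab0 : 0 < a + b by rewrite addr_gt0.
have ab3 : 0 < 3 * a - b by lra.
have c20 : 0 < c ^+ 2 by rewrite exprn_gt0.
have L0 : 0 <= 4 * p * (a + b) by rewrite ltW// !mulr_gt0.
have R0 : 0 <= 3 * a * (a - b) by rewrite ltW// !mulr_gt0.
rewrite -(@ler_pXn2r _ 2)// -(ler_pM2r ab3) -(ler_pM2r c20).
have H1 := ler_wpM2l (_ : 0 <= 16 * (a + b) ^+ 2 * a ^+ 2) w3'.
have {}H1 := H1 (mulr_ge0 (mulr_ge0 (ler0n _ _) (sqr_ge0 _)) (sqr_ge0 _)).
have H2 := mulr_ge0 H (mulr_ge0 (sqr_ge0 (a - b)) (ltW c20)).
have H3 : 16 * (a + b) ^+ 2 * (3 * a - b) * (p ^+ 2 * c ^+ 2) =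
  16 * (a + b) ^+ 2 * (3 * a - b) * (a ^+ 2 * p ^+ 2 + b ^+ 2 * c ^+ 2) by rewrite pE.
clearbody a b p c; clear - H1 H2 H3; lra.
Qed.

End tail.

(** * Pulls of a cluster *)

Record gap_conditions {R : realType} (beta s eps c N tau : R) : Prop :=
  GapConditions {
    gap_beta : 0 < beta;
    gap_s : 0 < s;
    gap_bs : beta * s ^+ 2 = 1;
    gap_eps : 0 < eps;
    gap_c : 2 + 2 * eps < c;
    gap_N : 0 <= N;
    gap_h : N * kernel_h beta ((c - 1 - 2 * eps) * s) < kernel_h beta (eps * s);
    gap_g : - N * kernel_g beta ((c - 2 * eps) * s) < kernel_g beta (eps * s);
    gap_tau : turning_point R beta tau }.

Section pulls.
Context {R : realType} (beta s eps c N tau : R).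
Implicit Types d u delta : R.
Local Notation h := (kernel_h beta).
Local Notation g := (kernel_g beta).
Local Notation gap := (gap_conditions beta s eps c N tau).

(* Half the turning point at most, so that two tokens of one cluster always
   lie in the region where [kernel_g] is positive. *)
Definition cluster_radius : R := Num.min (eps * s) (tau / 2).
Local Notation d0 := cluster_radius.

Lemma cluster_radius_bounds : gap ->
  [/\ 0 < d0, d0 <= eps * s & d0 <= tau / 2].
Proof.
case=> ? s0 _ e0 _ _ _ _ [t0 _ _]; split.
- by rewrite lt_min mulr_gt0//=; lra.
- by rewrite ge_min lexx.
- by rewrite ge_min lexx orbT.
Qed.

Lemma gap_arith : gap -> [/\ 0 < eps * s, 2 * s + 2 * (eps * s) < c * s, tau <= s,
  0 < tau & 2 * tau < (pi : R)].
Proof.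
case=> b0 s0 bs e0 hc _ _ _ T; split; first exact: mulr_gt0.
- by have := hc; rewrite -(ltr_pM2r s0); lra.
- exact: (turning_point_le _ _ _ b0 T s0 bs).
- by case: T.
- by case: T; lra.
Qed.

Lemma kernel_h_norm u : `|u| <= pi -> `|h u| = h `|u|.
Proof.
move=> upi; have [u0|u0] := leP 0 u.
  by rewrite (ger0_norm u0) in upi *; rewrite ger0_norm// kernel_h_ge0.
rewrite (ltr0_norm u0) in upi *; rewrite -[in LHS](opprK u) kernel_h_odd normrN.
by rewrite ger0_norm// kernel_h_ge0//; lra.
Qed.

Lemma kernel_g_norm u : g `|u| = g u.
Proof. by case: (ger0P u) => // _; rewrite kernel_g_even. Qed.

(** Were [tau <= eps * s], then [g (eps * s) <= 0], while [(c - 2 * eps) * s] lies beyond the peak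
    and makes the left side of [gap_g] nonnegative. The bound [c * s < pi] keeps both points where
    the sign of [g] is known. *)
Lemma gap_eps_lt_tau : gap -> c * s < pi -> eps * s < tau.
Proof.
move=> G; have [es0 cs ts t0 tpi] := gap_arith G; case: G => b0 s0 _ _ _ N0 _ Hg T cpi.
rewrite ltNge; apply/negP => tes.
have g1 : g (eps * s) <= 0.
  move: tes; rewrite le_eqVlt => /predU1P[<-|tes].
    by rewrite kernel_gE (kernel_g_factor _ _ _ T) subrr mul0r mulr0.
  rewrite ltW// (kernel_g_lt0 _ _ _ b0 T)// gtr0_norm//; lra.
have g2 : g ((c - 2 * eps) * s) < 0.
  have y0 : 0 < (c - 2 * eps) * s by lra.
  rewrite (kernel_g_lt0 _ _ _ b0 T)// gtr0_norm//; lra.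
have : 0 <= N * - g ((c - 2 * eps) * s) by rewrite mulr_ge0// oppr_ge0 ltW.
lra.
Qed.

Lemma pull_by_center d : gap -> d0 <= d -> d <= tau ->
  exists H, [/\ 0 <= H, N * H < h d &
    forall u, c * s < pi -> c * s - d - d0 <= `|u| -> `|u| <= pi -> `|h u| <= H].
Proof.
move=> G d0d dt; have [es0 cs ts t0 tpi] := gap_arith G.
have [r0 r1 r2] := cluster_radius_bounds G.
have hd0 : 0 < h d by apply: kernel_h_gt0; lra.
(* Distances on the circle are at most [pi], so for [pi <= c * s] there is a single cluster and
   [H = 0] will do. *)
have [cpi|cpi] := ltP (c * s) pi; last first.
  by exists 0; split; rewrite ?mulr0// => u; lra.
have et := gap_eps_lt_tau G cpi; case: G => b0 s0 bs _ _ N0 Hh _ T.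
have [esd|desd] := leP (eps * s) d.
  exists (h ((c - 1 - 2 * eps) * s)); split.
  - by apply: kernel_h_ge0; lra.
  - by apply: (lt_le_trans Hh); apply: (kernel_h_increasing _ _ _ _ b0 T); lra.
  - move=> u _ ul upi; rewrite kernel_h_norm//.
    by apply: (kernel_h_decreasing _ _ _ _ b0 T) => //; lra.
have d0E : d0 = tau / 2.
  by move: d0d; rewrite /cluster_radius minEle; case: ifP => //; lra.
exists (h ((c - 2 * eps) * s)); split.
- by apply: kernel_h_ge0; lra.
- have H1 : 3 * h ((c - 2 * eps) * s) <= 2 * h ((c - 1 - 2 * eps) * s).
    have -> : (c - 1 - 2 * eps) * s = (c - 2 * eps) * s - s by ring.
    by apply: kernel_h_shift => //; lra.
  have H2 := ler_wpM2l N0 H1.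
  have H3 : h (eps * s) <= h tau by apply: (kernel_h_increasing _ _ _ _ b0 T); lra.
  have H4 := kernel_h_half _ _ b0 T.
  have H5 : h (tau / 2) <= h d by apply: (kernel_h_increasing _ _ _ _ b0 T); lra.
  lra.
- move=> u _ ul upi; rewrite kernel_h_norm//.
  by apply: (kernel_h_decreasing _ _ _ _ b0 T) => //; lra.
Qed.

(** Here [d] lies between [tau] and [3 * (tau / 2)], and [d - delta] between [tau / 2] and [tau], so
    the two pulls add up to at least [h tau]. As [d < tau + d0], far sources are at distance at
    least [c * s - tau - 2 * d0]; this explains the constant [c - 1 - 2 * eps]. *)
Lemma pull_by_center_and_token d delta : gap ->
  tau < d -> d - delta <= tau -> `|delta| < d0 ->
  exists H, [/\ 0 <= H, N * H < h d + h (d - delta) &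
    forall u, c * s < pi -> c * s - d - d0 <= `|u| -> `|u| <= pi -> `|h u| <= H].
Proof.
move=> G td dt; rewrite ltr_norml => /andP[_ dl].
have [es0 cs ts t0 tpi] := gap_arith G.
have [r0 r1 r2] := cluster_radius_bounds G.
have hd0 : 0 < h d by apply: kernel_h_gt0; lra.
have hd1 : 0 < h (d - delta) by apply: kernel_h_gt0; lra.
have [cpi|cpi] := ltP (c * s) pi; last first.
  by exists 0; split; rewrite ?mulr0 ?addr_gt0// => u; lra.
have et := gap_eps_lt_tau G cpi; case: G => b0 s0 bs _ _ N0 Hh _ T.
exists (h ((c - 1 - 2 * eps) * s)); split.
- by apply: kernel_h_ge0; lra.
- apply: (lt_le_trans Hh); have [es|es] := leP (eps * s) (tau / 2).
    have : h (eps * s) <= h (d - delta) by apply: (kernel_h_increasing _ _ _ _ b0 T); lra.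
    lra.
  have H3 : h (eps * s) <= h tau by apply: (kernel_h_increasing _ _ _ _ b0 T); lra.
  have H4 := kernel_h_half _ _ b0 T.
  have H5 : h (tau / 2) <= h (d - delta) by apply: (kernel_h_increasing _ _ _ _ b0 T); lra.
  have H6 := kernel_h_half3 _ _ b0 T.
  have H7 : h (3 * (tau / 2)) <= h d by apply: (kernel_h_decreasing _ _ _ _ b0 T); lra.
  lra.
- move=> u _ ul upi; rewrite kernel_h_norm//.
  apply: (kernel_h_decreasing _ _ _ _ b0 T) => //; first lra.
  have [es|es] := leP (eps * s) (tau / 2); lra.
Qed.

(** Since [g] increases beyond [2 * s], the worst far source sits at distance [(c - 2 * eps) * s];
    since it decreases up to [tau], the slope of the center is at least [g (eps * s)]. *)
Lemma slope_by_center d : gap -> `|d| < d0 ->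
  exists H, [/\ 0 <= H, N * H < g d &
    forall u, c * s < pi -> c * s - `|d| - d0 <= `|u| -> `|u| <= pi -> - H <= g u].
Proof.
move=> G dd; have [es0 cs ts t0 tpi] := gap_arith G.
have [r0 r1 r2] := cluster_radius_bounds G.
have [cpi|cpi] := ltP (c * s) pi; last first.
  have gd0 : 0 < g d by apply: (kernel_g_gt0 _ _ _ (gap_beta _ _ _ _ _ _ G) (gap_tau _ _ _ _ _ _ G)); lra.
  by exists 0; split; rewrite ?mulr0// => u; lra.
have et := gap_eps_lt_tau G cpi; case: G => b0 s0 bs _ _ N0 _ Hg T.
have y0 : 0 < (c - 2 * eps) * s by lra.
have g2 : g ((c - 2 * eps) * s) < 0.
  by rewrite (kernel_g_lt0 _ _ _ b0 T)// gtr0_norm//; lra.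
exists (- g ((c - 2 * eps) * s)); split.
- by rewrite oppr_ge0 ltW.
- have : g (eps * s) <= g `|d| by apply: (kernel_g_decreasing _ _ _ _ b0 T) => //; lra.
  by rewrite kernel_g_norm; lra.
- move=> u _ ul upi; rewrite opprK -(kernel_g_norm u).
  apply: (kernel_g_increasing _ s) => //; lra.
Qed.

End pulls.

(** * Forces of finitely many clustered sources *)

Section periodicity.
Context {R : realType}.
Implicit Types (x z : R) (k : int).

Definition period2pi (q : R -> R) := forall x k, q (x + k%:~R * (2 * pi)) = q x.

Lemma period2pi_of_nat (q : R -> R) :
  (forall x (n : nat), q (x + n%:R * (2 * pi)) = q x) -> period2pi q.
Proof.
move=> H x [n|n]; first exact: H.
by rewrite -[in RHS](subrK (n.+1%:R * (2 * pi)) x) H NegzE mulrNz mulNr.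
Qed.

Lemma cos_2pi : period2pi (@cos R).
Proof.
by apply: period2pi_of_nat => x n; rewrite -(periodicn (@cosD2pi R) n x) !mulr_natl.
Qed.

Lemma sin_2pi : period2pi (@sin R).
Proof.
by apply: period2pi_of_nat => x n; rewrite -(periodicn (@sinD2pi R) n x) !mulr_natl.
Qed.

Lemma kernel_e_2pi beta : period2pi (kernel_e beta).
Proof. by move=> x k; rewrite /kernel_e cos_2pi. Qed.

Lemma kernel_h_2pi beta : period2pi (kernel_h beta).
Proof. by move=> x k; rewrite /kernel_h cos_2pi sin_2pi. Qed.

Lemma kernel_g_2pi beta : period2pi (kernel_g beta).
Proof. by move=> x k; rewrite !kernel_gE /kernel_e cos_2pi sin_2pi. Qed.

Lemma angle_reduce z : exists k, `|z + k%:~R * (2 * pi)| <= pi.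
Proof.
have pi0 := @pi_gt0 R; pose t := (z + pi) / (2 * pi).
exists (- Num.floor t).
have /andP[t1 t2] := Num.Theory.real_floor_itv (num_real t).
have tE : t * (2 * pi) = z + pi by rewrite /t divfK// gt_eqF//; lra.
rewrite intrD /= in t2.
have p2 : 0 < 2 * pi :> R by lra.
move: t1 t2; rewrite -(ler_pM2r p2) -(ltr_pM2r p2) tE => t1 t2.
by rewrite mulrNz mulNr ler_norml; apply/andP; split; lra.
Qed.

End periodicity.

Definition source_sum {R : realType} (q : R -> R) {I : finType} (w y : I -> R) (x : R) : R :=
  \sum_i w i * q (x - y i).

Section weighted_sums.
Context {R : realType} {I : finType}.
Implicit Types (w q : I -> R) (N H P : R).

(** Adding [H] to each [q j] makes all terms nonnegative at a total cost of at most [N * H], and the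
    term of [i] alone exceeds this cost. *)
Lemma weighted_sum_gt w q N H P (i : I) :
  (forall i, w i = 0 \/ 1 <= w i) -> \sum_i w i <= N -> 0 <= H -> 1 <= w i ->
  N * H < P -> P <= q i -> (forall j, w j != 0 -> - H <= q j) -> 0 < \sum_j w j * q j.
Proof.
move=> w0 wN H0 wi NP Pq qH.
have E : \sum_j w j * q j = \sum_j w j * (q j + H) - (\sum_j w j) * H.
  by rewrite mulr_suml -sumrB; apply: eq_bigr => j _; ring.
have H1 : w i * (q i + H) <= \sum_j w j * (q j + H).
  rewrite (bigD1 i)//= lerDl sumr_ge0// => j _.
  have [->|wj] := eqVneq (w j) 0; first by rewrite mul0r.
  case: (w0 j) => [/eqP|]; first by rewrite (negbTE wj).
  by move=> wj1; rewrite mulr_ge0//; have := qH j wj; lra.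
have H2 : (\sum_j w j) * H <= N * H by rewrite ler_wpM2r.
have qi : 0 <= q i + H.
  by have := qH i; case: eqP => [wi0|_ /(_ isT)]; lra.
have H3 : 0 <= (w i - 1) * (q i + H) by rewrite mulr_ge0//; lra.
by rewrite E; lra.
Qed.

Lemma weighted_sum_gt2 w q N H P (i i' : I) :
  (forall i, w i = 0 \/ 1 <= w i) -> \sum_i w i <= N -> 0 <= H ->
  1 <= w i -> 1 <= w i' -> i != i' ->
  N * H < P -> P <= q i + q i' -> (forall j, w j != 0 -> - H <= q j) ->
  0 < \sum_j w j * q j.
Proof.
move=> w0 wN H0 wi wi' ii' NP Pq qH.
have E : \sum_j w j * q j = \sum_j w j * (q j + H) - (\sum_j w j) * H.
  by rewrite mulr_suml -sumrB; apply: eq_bigr => j _; ring.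
have H1 : w i * (q i + H) + w i' * (q i' + H) <= \sum_j w j * (q j + H).
  rewrite (bigD1 i)//= lerD2l (bigD1 i') 1?eq_sym//= lerDl sumr_ge0// => j _.
  have [->|wj] := eqVneq (w j) 0; first by rewrite mul0r.
  case: (w0 j) => [/eqP|]; first by rewrite (negbTE wj).
  by move=> wj1; rewrite mulr_ge0//; have := qH j wj; lra.
have H2 : (\sum_j w j) * H <= N * H by rewrite ler_wpM2r.
have qi : 0 <= q i + H.
  by have := qH i; case: eqP => [wi0|_ /(_ isT)]; lra.
have qi' : 0 <= q i' + H.
  by have := qH i'; case: eqP => [wi0|_ /(_ isT)]; lra.
have H3 : 0 <= (w i - 1) * (q i + H) by rewrite mulr_ge0//; lra.
have H4 : 0 <= (w i' - 1) * (q i' + H) by rewrite mulr_ge0//; lra.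
by rewrite E; lra.
Qed.

Lemma source_sum_2pi (q : R -> R) w y : period2pi q -> period2pi (source_sum q w y).
Proof.
move=> qp x k; apply: eq_bigr => i _; congr (_ * _).
by rewrite -(qp (x - y i) k); congr q; ring.
Qed.

End weighted_sums.

(** Source [i] sits at [theta (cl i) + delta i]. Positions are on the line, so the separation ranges
    over all multiples of [2 * pi]. Weight 0 marks sources that do not act. *)
Record source_config {R : realType} (I : finType) (m : nat) (N d0 cs : R)
  (w : I -> R) (cl : I -> 'I_m) (theta : 'I_m -> R) (delta : I -> R) : Prop :=
  SourceConfig {
    cfg_w : forall i, w i = 0 \/ 1 <= w i;
    cfg_N : \sum_i w i <= N;
    cfg_center : forall j, exists i, [/\ cl i = j, delta i = 0 & 1 <= w i];
    cfg_delta : forall i, `|delta i| < d0;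
    cfg_sep : forall i j, i != j -> forall k : int,
      cs < `|theta i - theta j + k%:~R * (2 * pi)| }.

(** * Zeros of the force exerted by clustered sources *)

Section static.
Context {R : realType} (beta s eps c N tau : R) (I : finType) (m : nat).
Implicit Types (w delta : I -> R) (cl : I -> 'I_m) (theta : 'I_m -> R) (x d : R).
Local Notation h := (kernel_h beta).
Local Notation g := (kernel_g beta).
Local Notation gap := (gap_conditions beta s eps c N tau).
Local Notation d0 := (cluster_radius s eps tau).
Local Notation cfg := (source_config I m N d0 (c * s)).
Local Notation pos theta cl delta := (fun i => theta (cl i) + delta i).
Local Notation F w cl theta delta := (source_sum h w (pos theta cl delta)).
Local Notation G w cl theta delta := (source_sum g w (pos theta cl delta)).

Lemma config_opp w cl theta delta : cfg w cl theta delta ->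
  cfg w cl (fun j => - theta j) (fun i => - delta i).
Proof.
case=> w0 wN ce de se; split => //.
- by move=> j; have [i [<- di wi]] := ce j; exists i; rewrite di oppr0.
- by move=> i; rewrite normrN.
- move=> i j ij k; have := se i j ij (- k).
  by rewrite -[X in _ < X -> _]normrN mulrNz; congr (_ < `|_|); ring.
Qed.

(** [u] is the difference reduced modulo [2 * pi]. The existence of a second cluster forces
    [c * s < pi], because the reduced difference of two frozen tokens is at most [pi]. *)
Lemma far_source w cl theta delta j d i : cfg w cl theta delta -> cl i != j ->
  exists u, [/\ h (theta j + d - (theta (cl i) + delta i)) = h u,
    g (theta j + d - (theta (cl i) + delta i)) = g u, c * s < pi,
    `|u| <= pi & c * s - `|d| - d0 <= `|u| ].
Proof.
move=> [_ _ _ de se] ij; set z := theta j + d - _.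
have [k zk] := angle_reduce z; exists (z + k%:~R * (2 * pi)).
rewrite kernel_h_2pi kernel_g_2pi; split => //.
  have [l] := angle_reduce (theta j - theta (cl i)).
  by apply: lt_le_trans; apply: se; rewrite eq_sym.
have := se _ _ ij (- k); rewrite -normrN opprD mulrNz => sk.
have de' := de i.
have -> : z + k%:~R * (2 * pi) =
  (- (theta (cl i) - theta j) - (- k%:~R) * (2 * pi)) + (d - delta i) by rewrite /z; ring.
have H1 := lerB_normD (- (theta (cl i) - theta j) - (- k%:~R) * (2 * pi)) (d - delta i).
rewrite -mulNr opprK in sk H1 *.
have H2 := ler_normB d (delta i).
lra.
Qed.

Lemma near_source cl theta delta j d i : cl i = j ->
  theta j + d - (theta (cl i) + delta i) = d - delta i :> R.
Proof. by move=> ->; ring. Qed.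

(** All sources of cluster [j] lie on the same side of the point, because [|delta i| < d0 <= d]. The
    drift has the sign opposite to the force, so a positive force pushes back to the center. *)
Lemma force_gt0_center w cl theta delta j d : gap -> cfg w cl theta delta ->
  d0 <= d -> d <= tau -> 0 < F w cl theta delta (theta j + d).
Proof.
move=> Ga C dd dt; have [es0 cs ts t0 tpi] := gap_arith _ _ _ _ _ _ Ga.
have [r0 r1 r2] := cluster_radius_bounds _ _ _ _ _ _ Ga.
have [H [H0 NH far]] := pull_by_center _ _ _ _ _ _ _ Ga dd dt.
have [i0 [ci0 di0 wi0]] := cfg_center _ _ _ _ _ _ _ _ _ C j.
apply: (weighted_sum_gt _ _ N H (h d) i0 _ _ H0 wi0 NH).
- exact: cfg_w C.
- exact: cfg_N C.
- by rewrite /= (near_source _ _ _ _ d _ ci0) di0 subr0.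
- move=> i wi; have [ij|ij] := eqVneq (cl i) j.
    rewrite /= (near_source _ _ _ _ d _ ij); have := cfg_delta _ _ _ _ _ _ _ _ _ C i.
    rewrite ltr_norml => /andP[d1 d2].
    by rewrite (le_trans (_ : _ <= 0)) ?oppr_le0//; apply: kernel_h_ge0; lra.
  rewrite /=; have [u [-> _ cpi upi ul]] := far_source _ _ _ _ _ d _ C ij.
  have := far u cpi; rewrite ger0_norm in ul; last lra.
  by move=> /(_ ul upi); rewrite ler_norml => /andP[].
Qed.

Lemma force_gt0_token w cl theta delta j d i : gap -> cfg w cl theta delta ->
  cl i = j -> w i != 0 -> tau < d -> d - delta i <= tau ->
  0 < F w cl theta delta (theta j + d).
Proof.
move=> Ga C cij wi td dt; have [es0 cs ts t0 tpi] := gap_arith _ _ _ _ _ _ Ga.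
have [r0 r1 r2] := cluster_radius_bounds _ _ _ _ _ _ Ga.
have di := cfg_delta _ _ _ _ _ _ _ _ _ C i.
have [H [H0 NH far]] := pull_by_center_and_token _ _ _ _ _ _ _ _ Ga td dt di.
have [i0 [ci0 di0 wi0]] := cfg_center _ _ _ _ _ _ _ _ _ C j.
have ii0 : i0 != i by apply: contraTneq dt => <-; rewrite di0 subr0 -ltNge.
have wi1 : 1 <= w i.
  by case: (cfg_w _ _ _ _ _ _ _ _ _ C i) wi => // ->; rewrite eqxx.
apply: (weighted_sum_gt2 _ _ N H _ i0 i _ _ H0 wi0 wi1 ii0 NH).
- exact: cfg_w C.
- exact: cfg_N C.
- by rewrite /= (near_source _ _ _ _ d _ ci0) (near_source _ _ _ _ d _ cij) di0 subr0.
- move=> k wk; move: di; rewrite ltr_norml => /andP[d3 d4].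
  have [ij|ij] := eqVneq (cl k) j.
    rewrite /= (near_source _ _ _ _ d _ ij); have := cfg_delta _ _ _ _ _ _ _ _ _ C k.
    rewrite ltr_norml => /andP[d1 d2].
    by rewrite (le_trans (_ : _ <= 0)) ?oppr_le0//; apply: kernel_h_ge0; lra.
  rewrite /=; have [u [-> _ cpi upi ul]] := far_source _ _ _ _ _ d _ C ij.
  have := far u cpi; rewrite ger0_norm in ul; last lra.
  by move=> /(_ ul upi); rewrite ler_norml => /andP[].
Qed.

Lemma slope_gt0_center w cl theta delta j d : gap -> cfg w cl theta delta ->
  `|d| < d0 -> 0 < G w cl theta delta (theta j + d).
Proof.
move=> Ga C dd; have [es0 cs ts t0 tpi] := gap_arith _ _ _ _ _ _ Ga.
have [r0 r1 r2] := cluster_radius_bounds _ _ _ _ _ _ Ga.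
have [H [H0 NH far]] := slope_by_center _ _ _ _ _ _ _ Ga dd.
have [i0 [ci0 di0 wi0]] := cfg_center _ _ _ _ _ _ _ _ _ C j.
apply: (weighted_sum_gt _ _ N H (g d) i0 _ _ H0 wi0 NH).
- exact: cfg_w C.
- exact: cfg_N C.
- by rewrite /= (near_source _ _ _ _ d _ ci0) di0 subr0.
- move=> i wi; have [ij|ij] := eqVneq (cl i) j.
    rewrite /= (near_source _ _ _ _ d _ ij); have := cfg_delta _ _ _ _ _ _ _ _ _ C i => di.
    rewrite (le_trans (_ : _ <= 0)) ?oppr_le0//.
    apply: (kernel_g_ge0 _ _ _ (gap_beta _ _ _ _ _ _ Ga) (gap_tau _ _ _ _ _ _ Ga)).
    have := ler_normB d (delta i); lra.
  rewrite /=; have [u [_ -> cpi upi ul]] := far_source _ _ _ _ _ d _ C ij.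
  exact: far.
Qed.

Lemma force_opp w cl theta delta x :
  F w cl (fun j => - theta j) (fun i => - delta i) (- x) = - F w cl theta delta x.
Proof.
rewrite /source_sum -sumrN; apply: eq_bigr => i _.
by rewrite -mulrN -kernel_h_odd; congr (_ * h _); ring.
Qed.

Lemma force_lt0_center w cl theta delta j d : gap -> cfg w cl theta delta ->
  d0 <= d -> d <= tau -> F w cl theta delta (theta j - d) < 0.
Proof.
move=> Ga C dd dt; rewrite -oppr_gt0 -force_opp opprB addrC.
exact: (force_gt0_center _ _ _ _ j d Ga (config_opp _ _ _ _ C)).
Qed.

Lemma force_lt0_token w cl theta delta j d i : gap -> cfg w cl theta delta ->
  cl i = j -> w i != 0 -> tau < d -> d + delta i <= tau ->
  F w cl theta delta (theta j - d) < 0.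
Proof.
move=> Ga C cij wi td dt; rewrite -oppr_gt0 -force_opp opprB addrC.
by apply: (force_gt0_token _ _ _ _ j d i Ga (config_opp _ _ _ _ C)) => //; rewrite opprK.
Qed.

(** Outside the [d0]-neighbourhoods, an acting source at reduced distance at most [tau] would
    exclude a zero: through its center alone if that is within [tau], through the center and the
    source together otherwise. *)
Lemma zero_force_dichotomy w cl theta delta x :
  gap -> cfg w cl theta delta -> (0 < m)%N -> F w cl theta delta x = 0 ->
  ((exists j (k : int), `|x - theta j + k%:~R * (2 * pi)| < d0) /\
    0 < G w cl theta delta x) \/ G w cl theta delta x < 0.
Proof.
move=> Ga C m0 Fx; have [es0 cs ts t0 tpi] := gap_arith _ _ _ _ _ _ Ga.
have [r0 r1 r2] := cluster_radius_bounds _ _ _ _ _ _ Ga.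
have [[j [k dk]]|far] := pselect (exists j (k : int), `|x - theta j + k%:~R * (2 * pi)| < d0).
  left; split; first by exists j, k.
  have := slope_gt0_center _ _ _ _ j _ Ga C dk.
  have -> : theta j + (x - theta j + k%:~R * (2 * pi)) = x + k%:~R * (2 * pi) by ring.
  by rewrite (source_sum_2pi _ _ _ (kernel_g_2pi beta)).
right.
have neg i : w i != 0 -> g (x - (theta (cl i) + delta i)) < 0.
  move=> wi; set z := x - _; have [k zk] := angle_reduce z.
  rewrite -(kernel_g_2pi beta z k).
  apply: (kernel_g_lt0 _ _ _ (gap_beta _ _ _ _ _ _ Ga) (gap_tau _ _ _ _ _ _ Ga)) => //.
  rewrite ltNge; apply/negP => zt.
  set u := z + _ in zt; pose d := u + delta i.
  have xd : theta (cl i) + d = x + k%:~R * (2 * pi) by rewrite /d /u /z; ring.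
  have Fd : F w cl theta delta (theta (cl i) + d) = 0.
    by rewrite xd (source_sum_2pi _ _ _ (kernel_h_2pi beta)).
  have dd : d0 <= `|d|.
    rewrite leNgt; apply/negP => dd; apply: far; exists (cl i), k.
    by have <- : d = x - theta (cl i) + k%:~R * (2 * pi) by rewrite /d /u /z; ring.
  move: zt; rewrite ler_norml => /andP[u1 u2].
  have [dpos|dneg] := leP 0 d.
    rewrite ger0_norm// in dd; have [dt|dt] := leP d tau.
      by have := force_gt0_center _ _ _ _ (cl i) _ Ga C dd dt; rewrite Fd ltxx.
    have dit : d - delta i <= tau by rewrite /d addrK.
    by have := force_gt0_token _ _ _ _ (cl i) _ i Ga C erefl wi dt dit; rewrite Fd ltxx.
  rewrite ltr0_norm// in dd; have [dt|dt] := leP (- d) tau.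
    by have := force_lt0_center _ _ _ _ (cl i) _ Ga C dd dt; rewrite opprK Fd ltxx.
  have dit : - d + delta i <= tau by rewrite /d; lra.
  by have := force_lt0_token _ _ _ _ (cl i) _ i Ga C erefl wi dt dit; rewrite opprK Fd ltxx.
have [i0 [_ _ wi0]] := cfg_center _ _ _ _ _ _ _ _ _ C (Ordinal m0).
rewrite /source_sum (bigD1 i0)//=.
have H1 : w i0 * g (x - (theta (cl i0) + delta i0)) < 0.
  by rewrite pmulr_rlt0 ?neg//; [rewrite gt_eqF|]; lra.
apply: ltr_wnDr => //; apply: sumr_le0 => i _.
have [->|wi] := eqVneq (w i) 0; first by rewrite mul0r.
rewrite mulr_ge0_le0 ?(ltW (neg i wi))//.
by case: (cfg_w _ _ _ _ _ _ _ _ _ C i) => [->|] //; lra.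
Qed.

End static.

(** * Differentiation on a half-line *)

Section calculus2.
Context {R : realType}.
Implicit Types (u du : R -> R).

Lemma is_derive_littleo u (s d : R) : is_derive s (1 : R) u d ->
  forall eta, 0 < eta -> exists2 r, 0 < r &
    forall h, `|h| < r -> `|u (s + h) - u s - h * d| <= eta * `|h|.
Proof.
move=> [du dE] eta eta0; have := du; rewrite /derivable => /cvg_ex [l /= ul].
have ld : l = d by rewrite -dE; apply/esym/cvg_lim.
move/cvgrPdist_le : ul => /(_ eta eta0) /nbhs_ballP[r /= r0 rH].
exists r => // h hr; have [->|h0] := eqVneq h 0.
  by rewrite addr0 subrr mul0r subr0 normr0 mulr0.
have /rH/(_ h0) /= : ball 0 r h by rewrite /ball /= sub0r normrN.
rewrite ld /GRing.scale /= mulr1 (addrC h) => H.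
have -> : u (s + h) - u s - h * d = - h * (d - h^-1 * (u (s + h) - u s)) by field.
by rewrite normrM normrN mulrC ler_wpM2r.
Qed.

(** A quadratic remainder bound survives pointwise limits; this is how a limit of solutions is shown
    to be differentiable. *)
Lemma is_derive_of_quadratic u (s d K r : R) : 0 < r ->
  (forall h, `|h| < r -> `|u (s + h) - u s - h * d| <= K * h ^+ 2) ->
  is_derive s (1 : R) u d.
Proof.
move=> r0 H; have ul : h^-1 *: (u (h *: (1 : R) + s) - u s) @[h --> 0^'] --> d.
  apply/cvgrPdist_le => eta eta0.
  have K0 : 0 < `|K| + 1 by rewrite ltr_wpDl.
  apply/nbhs_ballP; exists (Num.min r (eta / (`|K| + 1))) => /=.
    by rewrite lt_min r0 divr_gt0.
  move=> h; rewrite /ball /= sub0r normrN lt_min => /andP[hr he] h0.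
  rewrite /GRing.scale /= mulr1 (addrC h).
  have hn : 0 < `|h| by rewrite normr_gt0.
  rewrite -(ler_pM2r hn) -normrM.
  have -> : (d - h^-1 * (u (s + h) - u s)) * h = - (u (s + h) - u s - h * d) by field.
  rewrite normrN (le_trans (H h hr))//.
  have -> : h ^+ 2 = `|h| * `|h| by rewrite -normrM -expr2 ger0_norm ?sqr_ge0.
  rewrite mulrA ler_wpM2r//.
  move: he; rewrite ltr_pdivlMr// => he.
  have := ler_norm K; have := ltW hn; nra.
apply: DeriveDef.
  by apply/cvg_ex; exists d.
exact: cvg_lim ul.
Qed.
End calculus2.

Definition deriv_on_halfline {R : realType} (u du : R -> R) : Prop :=
  {within `[0, +oo[, continuous u} /\ forall t : R, 0 < t -> is_derive t (1 : R) u (du t).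

Section halfline.
Context {R : realType}.
Implicit Types (u v du dv : R -> R) (a b t z M : R).
Local Notation dhl := deriv_on_halfline.

Lemma dhl_mvt u du a b : dhl u du -> 0 <= a -> a < b ->
  exists2 c, a < c < b & u b - u a = du c * (b - a).
Proof.
move=> [uc ud] a0 ab; have fc : {within `[a, b], continuous u}.
  apply: continuous_subspaceW uc => x /=; rewrite !in_itv /= andbT => /andP[ax _].
  exact: le_trans ax.
have fd x : x \in `]a, b[%R -> is_derive x (1 : R) u (du x).
  by rewrite in_itv /= => /andP[ax _]; apply: ud; exact: le_lt_trans ax.
have [c cab fab] := @MVT _ u du a b ab fd fc.
by exists c => //; move: cab; rewrite in_itv.
Qed.

Lemma dhl_nondecreasing u du a b : dhl u du -> 0 <= a -> a <= b ->
  (forall t, a < t -> t < b -> 0 <= du t) -> u a <= u b.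
Proof.
move=> ud a0; rewrite le_eqVlt => /predU1P[->//|ab] H.
have [c /andP[ac cb] uab] := dhl_mvt _ _ _ _ ud a0 ab.
by rewrite -subr_ge0 uab mulr_ge0 ?H// subr_ge0 ltW.
Qed.

Lemma dhl_lipschitz u du M a b : dhl u du -> (forall t, 0 < t -> `|du t| <= M) ->
  0 <= a -> 0 <= b -> `|u a - u b| <= M * `|a - b|.
Proof.
move=> ud dM a0 b0; wlog ab : a b a0 b0 / b < a => [H|].
  have [/H|ab|->] := ltgtP b a; first exact.
    by rewrite distrC (distrC a); exact: H.
  by rewrite !subrr normr0 mulr0.
have [c /andP[ac cb] ->] := dhl_mvt _ _ _ _ ud b0 ab.
by rewrite normrM ler_wpM2r// dM//; lra.
Qed.

Lemma dhl_add u v du dv : dhl u du -> dhl v dv ->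
  dhl (fun t => u t + v t) (fun t => du t + dv t).
Proof.
move=> [uc ud] [vc vd]; split; first by move=> t; apply: cvgD; [exact: uc|exact: vc].
by move=> t t0; have := ud t t0; have := vd t t0 => ? ?; exact: is_deriveD.
Qed.

Lemma dhl_mul u v du dv : dhl u du -> dhl v dv ->
  dhl (fun t => u t * v t) (fun t => u t * dv t + v t * du t).
Proof.
move=> [uc ud] [vc vd]; split; first by move=> t; apply: cvgM; [exact: uc|exact: vc].
by move=> t t0; have := ud t t0; have := vd t t0 => ? ?; exact: is_deriveM.
Qed.

Lemma dhl_of_deriv u du : (forall t : R, is_derive t (1 : R) u (du t)) -> dhl u du.
Proof.
move=> ud; split => //; apply: derivable_within_continuous => x _; exact: ex_derive.
Qed.

Lemma dhl_cst a : dhl (fun=> a) (fun=> 0).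
Proof. by apply: dhl_of_deriv => t; exact: is_derive_cst. Qed.

Lemma dhl_opp u du : dhl u du -> dhl (fun t => - u t) (fun t => - du t).
Proof.
move=> [uc ud]; split; first by move=> t; apply: cvgN; exact: uc.
by move=> t t0; have := ud t t0 => ?; exact: is_deriveN.
Qed.

Lemma dhl_sum (I : Type) (r : seq I) (P : pred I) (u du : I -> R -> R) :
  (forall i, dhl (u i) (du i)) ->
  dhl (fun t => \sum_(i <- r | P i) u i t) (fun t => \sum_(i <- r | P i) du i t).
Proof.
move=> ud; elim: r => [|i r IH].
  under [X in dhl X _]eq_fun do rewrite big_nil.
  under [X in dhl _ X]eq_fun do rewrite big_nil.
  exact: dhl_cst.
under [X in dhl X _]eq_fun do rewrite big_cons.
under [X in dhl _ X]eq_fun do rewrite big_cons.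
by case: (P i) => //; exact: dhl_add.
Qed.

Lemma dhl_ext u v du dv : dhl u du -> (forall t, u t = v t) ->
  (forall t, 0 < t -> du t = dv t) -> dhl v dv.
Proof.
move=> [uc ud] /funext <- H; split => // t t0; rewrite -H//; exact: ud.
Qed.

Lemma dhl_expR a : dhl (fun t => expR (a * t)) (fun t => a * expR (a * t)).
Proof.
apply: dhl_of_deriv => t.
have H : is_derive t (1 : R) ( *%R a) a by apply: is_derive_eq; rewrite /GRing.scale/=; ring.
apply: is_derive_eq (@is_derive1_comp R expR _ t _ _ (is_derive_expR _) H) _.
by rewrite mulrC.
Qed.

Lemma within_halfline_of_lipschitz u M :
  (forall a b, 0 <= a -> 0 <= b -> `|u a - u b| <= M * `|a - b|) ->
  {within `[0, +oo[, continuous u}.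
Proof.
move=> H; apply/subspace_continuousP => t /=; rewrite in_itv /= andbT => t0.
apply/cvgrPdist_le => e e0; rewrite near_withinE.
apply/nbhs_ballP; exists (e / (`|M| + 1)) => /=.
  by rewrite divr_gt0// ltr_wpDl.
move=> b; rewrite /ball /= ltr_pdivlMr ?ltr_wpDl// => be; rewrite in_itv /= andbT => b0.
rewrite (le_trans (H _ _ t0 b0))//; have := ler_norm M; have := normr_ge0 (t - b); nra.
Qed.

(** Let [s] be the supremum of the times up to [t2] at which [z <= u]. The inequality holds at [s]
    by continuity, and if [s < t2] it extends past [s]: by the positive derivative if [u s = z], by
    continuity if not. *)
Lemma barrier u du z t1 t2 : dhl u du -> 0 < t1 -> t1 <= t2 ->
  (forall t, t1 <= t -> t <= t2 -> u t = z -> 0 < du t) -> z <= u t1 -> z <= u t2.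
Proof.
move=> [uc ud] t10 t12 dpos zt1; rewrite leNgt; apply/negP => uz.
pose A : set R := [set t | t1 <= t <= t2 /\ z <= u t].
have At1 : A t1 by rewrite /A /= lexx t12.
have Aub : ubound A t2 by move=> t [/andP[]].
have Ahs : has_sup A by split; [exists t1|exists t2].
have t1s : t1 <= sup A by apply: ub_le_sup => //; exists t2.
have st2 : sup A <= t2 by apply: ge_sup => //; exists t1.
set s := sup A in t1s st2.
have s0 : 0 < s by exact: lt_le_trans t1s.
have near_s eta : 0 < eta -> exists2 r, 0 < r &
    forall t, `|t - s| < r -> `|u t - u s - (t - s) * du s| <= eta * `|t - s|.
  move=> eta0; have [r r0 H] := is_derive_littleo _ _ _ (ud s s0) eta eta0.
  by exists r => // t tr; have := H _ tr; rewrite subrKC.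
have cont_s eta : 0 < eta -> exists2 r, 0 < r & forall t, `|t - s| < r -> `|u t - u s| < eta.
  move=> eta0; have [r r0 H] := near_s 1 ltr01.
  have D0 : 0 < 1 + `|du s| by rewrite ltr_pwDl.
  exists (Num.min r (eta / (1 + `|du s|))); first by rewrite lt_min r0 divr_gt0.
  move=> t; rewrite lt_min => /andP[tr te].
  have := H t tr; rewrite mul1r => H1.
  have -> : u t - u s = (u t - u s - (t - s) * du s) + (t - s) * du s by ring.
  rewrite (le_lt_trans (ler_normD _ _))// normrM.
  by move: te; rewrite ltr_pdivlMr//; lra.
have us : z <= u s.
  rewrite leNgt; apply/negP => usz.
  have [r r0 H] := cont_s (z - u s) ltac:(lra).
  have [t [/andP[t1t tt2] zt] st] := sup_adherent r0 Ahs.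
  have ts : t <= s by apply: ub_le_sup; [exists t2|split => //; rewrite t1t].
  have {}st : s - r < t by [].
  have ts' : `|t - s| < r by rewrite distrC ger0_norm; lra.
  by have := H t ts'; rewrite ltr_norml => /andP[]; lra.
have st : s < t2.
  by rewrite lt_neqAle st2 andbT; apply: contraTneq us => ->; rewrite -ltNge.
have [r r0 H] : exists2 r, 0 < r & forall t, s < t -> t < s + r -> z <= u t.
  move: us; rewrite le_eqVlt => /predU1P[us|us].
    have ds : 0 < du s by apply: dpos.
    have [r r0 H] := near_s (du s) ds.
    exists r => // t st' tr; have := H t; rewrite gtr0_norm; last lra.
    move=> /(_ ltac:(lra)); rewrite ler_norml => /andP[H1 _]; lra.
  have [r r0 H] := cont_s (u s - z) ltac:(lra).
  exists r => // t st' tr; have := H t; rewrite gtr0_norm; last lra.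
  move=> /(_ ltac:(lra)); rewrite ltr_norml => /andP[H1 _]; lra.
pose t := Num.min t2 (s + r / 2).
have tt2 : t <= t2 by rewrite ge_min lexx.
have ts : s < t by rewrite lt_min st; lra.
have tr : t < s + r by rewrite gt_min; apply/orP; right; lra.
have : t <= s.
  by apply: ub_le_sup; [exists t2|split; [apply/andP; split => //; lra|exact: H]].
by rewrite leNgt ts.
Qed.

End halfline.

(** * Asymptotically autonomous scalar equations *)

Definition tends_to {R : realType} (u : R -> R) (l : R) : Prop :=
  forall e, 0 < e -> exists2 T, 0 < T & forall t, T <= t -> `|u t - l| < e.

Section asymptotically_autonomous.
Context {R : realType}.
Implicit Types (u du f : R -> R) (z l L T : R).
Local Notation dhl := deriv_on_halfline.

Lemma tends_to_opp u l : tends_to u l -> tends_to (fun t => - u t) (- l).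
Proof.
move=> H e e0; have [T T0 HT] := H e e0; exists T => // t Tt.
by rewrite -opprD normrN HT.
Qed.

Lemma not_tends_to_of_drift u du l T eta : dhl u du -> 0 < T -> 0 < eta ->
  (forall t, T <= t -> eta <= du t) -> ~ tends_to u l.
Proof.
move=> ud T0 eta0 H /(_ 1 ltr01)[T' T'0 H'].
pose a := Num.max T T'; have Ta : T <= a by rewrite le_max lexx.
have T'a : T' <= a by rewrite le_max lexx orbT.
have a0 : 0 <= a by lra.
have d0 : 0 < 3 / eta by rewrite divr_gt0.
have [c /andP[ac cb] uc] := dhl_mvt _ _ a (a + 3 / eta) ud a0 ltac:(lra).
have := H' a T'a; have := H' (a + 3 / eta) ltac:(lra).
rewrite !ltr_norml => /andP[_ h1] /andP[h2 _].
have h3 : eta * (3 / eta) <= du c * (a + 3 / eta - a).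
  rewrite (_ : a + 3 / eta - a = 3 / eta); last by ring.
  by rewrite ler_pM2r// H//; lra.
have h4 : eta * (3 / eta) = 3 by field; rewrite gt_eqF.
lra.
Qed.

Lemma shift_below z l : exists k : int, z + k%:~R * (2 * pi) <= l.
Proof.
have pi0 := @pi_gt0 R.
have [k] := angle_reduce (z - l); rewrite ler_norml => /andP[_ H].
by exists (k - 1); rewrite intrB; lra.
Qed.

Lemma shift_above z l : exists k : int, l <= z + k%:~R * (2 * pi).
Proof.
have [k H] := shift_below (- z) (- l); exists (- k).
by rewrite mulrNz; lra.
Qed.

Context (u du f : R -> R) (L : R).

Lemma crossing_up z T t1 t2 : dhl u du -> 0 < T ->
  (forall t, T <= t -> `|du t - f (u t)| < f z) ->
  T <= t1 -> t1 <= t2 -> z <= u t1 -> z <= u t2.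
Proof.
move=> ud T0 H Tt1 t12; apply: (barrier _ du) => //; first lra.
move=> t t1t _ utz; have := H t (le_trans Tt1 t1t).
by rewrite utz ltr_norml => /andP[]; lra.
Qed.

Lemma crossing_down z T t1 t2 : dhl u du -> 0 < T ->
  (forall t, T <= t -> `|du t - f (u t)| < - f z) ->
  T <= t1 -> t1 <= t2 -> u t1 <= z -> u t2 <= z.
Proof.
move=> ud T0 H Tt1 t12; rewrite -(lerN2 z) -(lerN2 z).
apply: (barrier _ _ _ _ _ (dhl_opp _ _ ud)) => //; first lra.
move=> t t1t _ /oppr_inj utz; have := H t (le_trans Tt1 t1t).
by rewrite utz ltr_norml => /andP[]; lra.
Qed.

Lemma asymptotic_zero l : dhl u du -> 0 <= L ->
  (forall x y, `|f x - f y| <= L * `|x - y|) ->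
  (forall e, 0 < e -> exists2 T, 0 < T & forall t, T <= t -> `|du t - f (u t)| < e) ->
  tends_to u l -> f l = 0.
Proof.
move=> ud L0 fL asym ul; have LL : 0 < L + 1 by lra.
have key : f l != 0 -> exists2 T, 0 < T & forall t, T <= t -> `|du t - f l| < `|f l| / 2.
  move=> fl0; have e0 : 0 < `|f l| / 4 by rewrite divr_gt0 ?normr_gt0.
  have [T1 T10 H1] := asym _ e0.
  have [T2 T20 H2] := ul (`|f l| / 4 / (L + 1)) (divr_gt0 e0 LL).
  exists (Num.max T1 T2); first by rewrite lt_max T10.
  move=> t; rewrite ge_max => /andP[t1 t2].
  have := H1 t t1; have := H2 t t2; rewrite ltr_pdivlMr// => h2 h1.
  have h3 := fL (u t) l.
  have -> : du t - f l = (du t - f (u t)) + (f (u t) - f l) by ring.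
  rewrite (le_lt_trans (ler_normD _ _))//.
  have := normr_ge0 (u t - l); lra.
have [/eqP//|fl0] := boolP (f l == 0); have [T T0 H] := key fl0; exfalso.
have [fl|fl|fl] := ltgtP 0 (f l); last by rewrite -fl eqxx in fl0.
  apply: (not_tends_to_of_drift u du l T (f l / 2) ud T0) => //; first lra.
  by move=> t Tt; have := H t Tt; rewrite (gtr0_norm fl) ltr_norml => /andP[]; lra.
apply: (not_tends_to_of_drift _ _ (- l) T (- f l / 2) (dhl_opp _ _ ud) T0).
- lra.
- by move=> t Tt; have := H t Tt; rewrite (ltr0_norm fl) ltr_norml => /andP[]; lra.
- exact: tends_to_opp.
Qed.

Lemma asymptotic_limit : dhl u du -> 0 <= L ->
  (forall x y, `|f x - f y| <= L * `|x - y|) -> period2pi f ->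
  (forall e, 0 < e -> exists2 T, 0 < T & forall t, T <= t -> `|du t - f (u t)| < e) ->
  (exists z, 0 < f z) -> (exists z, f z < 0) ->
  (forall a b, a < b -> exists2 z, a < z < b & f z != 0) ->
  exists2 l, f l = 0 & tends_to u l.
Proof.
move=> ud L0 fL fp asym [zp fzp] [zm fzm] dense.
have [T1 T10 H1] := asym _ fzp.
have fzm' : 0 < - f zm by lra.
have [T2 T20 H2] := asym _ fzm'.
have [k1 B1] := shift_below zp (u T1); have [k2 B2] := shift_above zm (u T2).
have low t : T1 <= t -> zp + k1%:~R * (2 * pi) <= u t.
  by move=> Tt; apply: (crossing_up _ T1 T1 t ud T10) => //; rewrite fp.
have upp t : T2 <= t -> u t <= zm + k2%:~R * (2 * pi).
  by move=> Tt; apply: (crossing_down _ T2 T2 t ud T20) => //; rewrite fp.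
(* The levels above which [u] eventually stays; their supremum is the lower limit of [u] at
   infinity. *)
pose S : set R := [set z | exists2 T, 0 < T & forall t, T <= t -> z <= u t].
have S1 : S (zp + k1%:~R * (2 * pi)) by exists T1.
have Sub : ubound S (zm + k2%:~R * (2 * pi)).
  move=> z [T T0 HT]; apply: le_trans (HT (Num.max T T2) _) (upp _ _).
    by rewrite le_max lexx.
  by rewrite le_max lexx orbT.
have Ssup : has_sup S by split; [exists (zp + k1%:~R * (2 * pi))|exists (zm + k2%:~R * (2 * pi))].
have ul : tends_to u (sup S).
  move=> e e0; have [z [T3 T30 H3] ze] := sup_adherent e0 Ssup.
  have [y /andP[y1 y2] fy] := dense (sup S) (sup S + e) ltac:(lra).
  have notS : ~ S y by move=> Sy; have := ub_le_sup Ssup.2 Sy; lra.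
  have [T4 T40 H4] : exists2 T, 0 < T & forall t, T <= t -> u t <= y.
    have fy0 : 0 < `|f y| by rewrite normr_gt0.
    have [T4 T40 H4] := asym _ fy0.
    have [fyp|fyn] := ltP 0 (f y).
      rewrite (gtr0_norm fyp) in H4; exists T4 => // t T4t.
      rewrite leNgt; apply/negP => yt; apply: notS; exists t; first lra.
      by move=> t' tt'; apply: (crossing_up _ T4 t t' ud T40) => //; exact: ltW.
    have fyn' : f y < 0 by rewrite lt_neqAle fy.
    rewrite (ltr0_norm fyn') in H4.
    have [[t1 [Tt1 ut1]]|no] := pselect (exists t1, T4 <= t1 /\ u t1 <= y).
      exists t1; first lra.
      by move=> t' tt'; apply: (crossing_down _ T4 t1 t' ud T40).
    exfalso; apply: notS; exists T4 => // t T4t.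
    by rewrite leNgt; apply/negP => ty; apply: no; exists t; split => //; exact: ltW.
  exists (Num.max T3 T4); first by rewrite lt_max T30.
  move=> t; rewrite ge_max => /andP[t3 t4].
  have := H3 t t3; have := H4 t t4 => h4 h3.
  by rewrite ltr_norml; apply/andP; split; lra.
exists (sup S) => //; exact: (asymptotic_zero _ ud L0 fL asym ul).
Qed.

End asymptotically_autonomous.

(** * Causal systems of equations *)

Definition rate (R : realType) (i : nat) : R := i.+1%:R^-1.

Section limits.
Context {R : realType}.
Implicit Types z b K : R.

Lemma le_of_le_add_inv z b K : (forall i : nat, z <= b + K * rate R i) -> z <= b.
Proof.
move=> H; rewrite leNgt; apply/negP => bz.
have K0 : 0 < K by have := H 0%N; rewrite /rate invr1; lra.
have d0 : 0 < z - b by lra.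
have := archi_boundP (ltW (divr_gt0 K0 d0)); set i := Num.bound _ => Hi.
have := H i; rewrite -lerBlDl /rate ler_pdivlMr//.
move: Hi; rewrite ltr_pdivrMr// -(natr1 i); nra.
Qed.

Lemma cauchy_rate_limit (a : nat -> R) B :
  (forall i j, `|a i - a j| <= B * rate R i + B * rate R j) ->
  exists l, forall i, `|a i - l| <= B * rate R i.
Proof.
move=> H; pose S : set R := [set a i - B * rate R i | i in [set: nat]].
have Sub i : ubound S (a i + B * rate R i).
  by move=> _ [j _ <-]; have := H j i; rewrite ler_norml => /andP[]; lra.
have Ssup : has_sup S.
  by split; [exists (a 0%N - B * rate R 0), 0%N|exists (a 0%N + B * rate R 0); exact: Sub].
exists (sup S) => i; rewrite ler_norml.
have H1 : a i - B * rate R i <= sup S by apply: (ub_le_sup Ssup.2); exists i.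
have H2 : sup S <= a i + B * rate R i by apply: ge_sup; [exact: Ssup.1|exact: Sub].
by apply/andP; split; lra.
Qed.

End limits.

(* The dependence of the [k]-th component on the coordinates [j <= k] only
   encodes causality. *)
Definition causal_lipschitz {R : realType} {n : nat}
  (W : ('I_n -> R) -> 'I_n -> R) (L : R) : Prop :=
  0 <= L /\ forall x y k,
    `|W x k - W y k| <= L * \sum_(j < n | (j <= k)%N) `|x j - y j|.

Definition lifted_solution {R : realType} {n : nat}
  (W : ('I_n -> R) -> 'I_n -> R) (x : 'I_n -> R -> R) : Prop :=
  forall k, deriv_on_halfline (x k) (fun t => W (x ^~ t) k).

Section causal_ode.
Context {R : realType} {n : nat} (W : ('I_n -> R) -> 'I_n -> R) (L M : R).
Implicit Types (x y : 'I_n -> R -> R) (K : nat) (t : R).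
Local Notation sol := (lifted_solution W).

(** Truncated at [K] because causality closes the differential inequality on every initial block of
    coordinates. *)
Definition sqr_gap K x y t : R := \sum_(j < n) (j < K)%N%:R * (x j t - y j t) ^+ 2.

Lemma sqr_gap_ge0 K x y t : 0 <= sqr_gap K x y t.
Proof. by apply: sumr_ge0 => j _; rewrite mulr_ge0 ?sqr_ge0. Qed.

Lemma sqr_le_sqr_gap K x y t (j : 'I_n) : (j < K)%N ->
  (x j t - y j t) ^+ 2 <= sqr_gap K x y t.
Proof.
move=> jK; rewrite /sqr_gap (bigD1 j)//= jK mul1r lerDl.
by apply: sumr_ge0 => i _; rewrite mulr_ge0 ?sqr_ge0.
Qed.

Definition dsqr_gap K x y t : R := \sum_(j < n) (j < K)%N%:R *
  (2 * (x j t - y j t) * (W (x ^~ t) j - W (y ^~ t) j)).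

Lemma dhl_sqr_gap K x y : sol x -> sol y ->
  deriv_on_halfline (sqr_gap K x y) (dsqr_gap K x y).
Proof.
move=> xs ys; apply: dhl_sum => j.
have H := dhl_add _ _ _ _ (xs j) (dhl_opp _ _ (ys j)).
apply: (dhl_ext _ _ _ _ (dhl_mul _ _ _ _ (dhl_cst (j < K)%N%:R) (dhl_mul _ _ _ _ H H))).
  by move=> t; rewrite expr2.
by move=> t _; ring.
Qed.

Lemma dsqr_gap_bound K x y t : causal_lipschitz W L ->
  `|dsqr_gap K x y t| <= 2 * L * n%:R * n%:R * sqr_gap K x y t.
Proof.
move=> [L0 WL]; have E0 := sqr_gap_ge0 K x y t.
have bound (j : 'I_n) : `|(j < K)%N%:R * (2 * (x j t - y j t) * (W (x ^~ t) j - W (y ^~ t) j))|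
    <= 2 * L * n%:R * sqr_gap K x y t.
  case: (ltnP j K) => jK; last by rewrite mul0r normr0 !mulr_ge0.
  rewrite mul1r normrM normrM ger0_norm//.
  apply: (@le_trans _ _ (2 * `|x j t - y j t| * (L * \sum_(i < n | (i <= j)%N) `|x i t - y i t|))).
    by rewrite ler_wpM2l ?mulr_ge0.
  have -> : 2 * `|x j t - y j t| * (L * \sum_(i < n | (i <= j)%N) `|x i t - y i t|) =
      2 * L * \sum_(i < n | (i <= j)%N) `|x j t - y j t| * `|x i t - y i t|.
    by rewrite -mulr_sumr; ring.
  rewrite -[leRHS]mulrA ler_wpM2l ?mulr_ge0//.
  apply: (@le_trans _ _ (\sum_(i < n | (i <= j)%N) sqr_gap K x y t)).
    apply: ler_sum => i ij; have iK : (i < K)%N by exact: leq_ltn_trans jK.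
    have h1 := sqr_le_sqr_gap K x y t j jK; have h2 := sqr_le_sqr_gap K x y t i iK.
    have h3 := sqr_ge0 (`|x j t - y j t| - `|x i t - y i t|).
    have h4 : `|x j t - y j t| ^+ 2 = (x j t - y j t) ^+ 2 by rewrite real_normK ?num_real.
    have h5 : `|x i t - y i t| ^+ 2 = (x i t - y i t) ^+ 2 by rewrite real_normK ?num_real.
    rewrite sqrrB h4 h5 in h3; lra.
  rewrite sumr_const [leRHS]mulr_natl ler_wpMn2l// (leq_trans (max_card _))//.
  by rewrite card_ord.
apply: le_trans (ler_norm_sum _ _ _) _.
apply: le_trans (ler_sum _ (fun j _ => bound j)) _.
by rewrite sumr_const card_ord -[leLHS]mulr_natr; lra.
Qed.

(** The derivative of the gap is at most [D] times the gap in absolute value, so its products with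
    [expR (- D * t)] and [expR (D * t)] are monotone. The second bound replaces a reversal of
    time. *)
Lemma gronwall K x y t : causal_lipschitz W L -> sol x -> sol y -> 0 <= t ->
  sqr_gap K x y t <= expR (2 * L * n%:R * n%:R * t) * sqr_gap K x y 0 /\
  sqr_gap K x y 0 <= expR (2 * L * n%:R * n%:R * t) * sqr_gap K x y t.
Proof.
move=> WL xs ys t0; have dE := dhl_sqr_gap K x y xs ys.
have bd s := dsqr_gap_bound K x y s WL.
set D := 2 * L * n%:R * n%:R in bd *; split.
  have H := dhl_opp _ _ (dhl_mul _ _ _ _ (dhl_expR (- D)) dE).
  have /(_ _ t (lexx 0) t0) := dhl_nondecreasing _ _ _ _ H.
  rewrite !mulr0 expR0 mul1r lerN2 mulNr expRN => HH.
  rewrite -ler_pdivrMl ?expR_gt0//; apply: HH => s _ _.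
  have := bd s; rewrite ler_norml => /andP[_ b2].
  have : 0 <= expR (- D * s) * (D * sqr_gap K x y s - dsqr_gap K x y s).
    by rewrite mulr_ge0 ?expR_ge0// subr_ge0.
  by lra.
have H := dhl_mul _ _ _ _ (dhl_expR D) dE.
have /(_ _ t (lexx 0) t0) := dhl_nondecreasing _ _ _ _ H.
rewrite !mulr0 expR0 mul1r => HH; apply: HH => s _ _.
have := bd s; rewrite ler_norml => /andP[b1 _].
have : 0 <= expR (D * s) * (D * sqr_gap K x y s + dsqr_gap K x y s).
  by rewrite mulr_ge0 ?expR_ge0//; lra.
by lra.
Qed.

Lemma solution_unique K x y t : causal_lipschitz W L -> sol x -> sol y -> 0 <= t ->
  (forall j : 'I_n, (j < K)%N -> x j 0 = y j 0) ->
  forall j : 'I_n, (j < K)%N -> x j t = y j t.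
Proof.
move=> WL xs ys t0 xy0 j jK; have [H _] := gronwall K x y t WL xs ys t0.
have E0 : sqr_gap K x y 0 = 0.
  apply: big1 => i _; case: (ltnP i K) => iK; last by rewrite mul0r.
  by rewrite xy0// subrr expr0n mulr0.
have := le_trans (sqr_le_sqr_gap K x y t j jK) H.
by rewrite E0 mulr0 le_eqVlt ltNge sqr_ge0 orbF sqrf_eq0 subr_eq0 => /eqP.
Qed.

Lemma solution_unique_backward K x y t : causal_lipschitz W L -> sol x -> sol y -> 0 <= t ->
  (forall j : 'I_n, (j < K)%N -> x j t = y j t) ->
  forall j : 'I_n, (j < K)%N -> x j 0 = y j 0.
Proof.
move=> WL xs ys t0 xy0 j jK; have [_ H] := gronwall K x y t WL xs ys t0.
have E0 : sqr_gap K x y t = 0.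
  apply: big1 => i _; case: (ltnP i K) => iK; last by rewrite mul0r.
  by rewrite xy0// subrr expr0n mulr0.
have := le_trans (sqr_le_sqr_gap K x y 0 j jK) H.
by rewrite E0 mulr0 le_eqVlt ltNge sqr_ge0 orbF sqrf_eq0 subr_eq0 => /eqP.
Qed.

Lemma solution_continuity x y t e : causal_lipschitz W L -> sol x -> sol y ->
  0 <= t -> 0 <= e -> (forall j, `|x j 0 - y j 0| <= e) ->
  forall j, `|x j t - y j t| <= expR (2 * L * n%:R * n%:R * t) * (1 + n%:R) * e.
Proof.
move=> WL xs ys t0 e0 xy0 j; have [H _] := gronwall n x y t WL xs ys t0.
have := le_trans (sqr_le_sqr_gap n x y t j (ltn_ord j)) H.
set A := expR _; have A1 : 1 <= A.
  by rewrite -(@expR0 R) ler_expR !mulr_ge0//; case: WL.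
have E0 : sqr_gap n x y 0 <= n%:R * e ^+ 2.
  apply: le_trans (ler_sum _ (_ : forall i _, _ <= e ^+ 2)) _ => [i _|].
    rewrite ltn_ord mul1r -(real_normK (num_real _)) lerXn2r ?nnegrE//.
  by rewrite sumr_const card_ord -[leLHS]mulr_natl.
move=> H2.
have H3 : `|x j t - y j t| ^+ 2 <= (A * (1 + n%:R) * e) ^+ 2.
  rewrite real_normK ?num_real// (le_trans H2)//.
  apply: le_trans (ler_wpM2l (_ : 0 <= A) E0) _; first lra.
  rewrite !exprMn mulrA ler_wpM2r ?sqr_ge0//.
  have n0 : 0 <= n%:R :> R by [].
  apply: ler_pM => //; first lra.
    by rewrite expr2 ler_peMr//; lra.
  by rewrite expr2; nra.
have R0 : 0 <= A * (1 + n%:R) * e by rewrite !mulr_ge0//; lra.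
by move: H3; rewrite ler_pXn2r// nnegrE.
Qed.

Lemma solution_lipschitz x (j : 'I_n) a b : (forall z k, `|W z k| <= M) -> sol x ->
  0 <= a -> 0 <= b -> `|x j a - x j b| <= M * `|a - b|.
Proof. by move=> WM xs; apply: (dhl_lipschitz _ _ _ _ _ (xs j)) => t _; exact: WM. Qed.

Lemma causal_lipschitz_unif (z z' : 'I_n -> R) e k : causal_lipschitz W L -> 0 <= e ->
  (forall j, `|z j - z' j| <= e) -> `|W z k - W z' k| <= L * (n%:R * e).
Proof.
move=> [L0 WL] e0 H; apply: le_trans (WL z z' k) _; rewrite ler_wpM2l//.
apply: le_trans (ler_sum _ (fun j _ => H j)) _.
rewrite sumr_const [leRHS]mulr_natl ler_wpMn2l// (leq_trans (max_card _))//.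
by rewrite card_ord.
Qed.

Lemma solution_taylor x (k : 'I_n) t h : causal_lipschitz W L -> (forall z k, `|W z k| <= M) ->
  sol x -> 0 < t -> 0 <= t + h ->
  `|x k (t + h) - x k t - h * W (x ^~ t) k| <= L * (n%:R * M) * h ^+ 2.
Proof.
move=> WL WM xs t0 th; have L0 := WL.1.
have M0 : 0 <= M by exact: le_trans (WM (fun=> 0) k).
have [c [c0 ct ->]] : exists c, [/\ 0 <= c, `|c - t| <= `|h| &
    x k (t + h) - x k t = W (x ^~ c) k * h].
  have [h0|h0|->] := ltgtP h 0.
  - have [c /andP[c1 c2] E] := dhl_mvt _ _ (t + h) t (xs k) th ltac:(lra).
    exists c; split; [lra|by rewrite ltr0_norm ?(ltr0_norm h0); lra|].
    by rewrite -opprB E; ring.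
  - have [c /andP[c1 c2] E] := dhl_mvt _ _ t (t + h) (xs k) (ltW t0) ltac:(lra).
    exists c; split; [lra|by rewrite gtr0_norm ?(gtr0_norm h0); lra|].
    by rewrite E; ring.
  - by exists t; rewrite addr0 !subrr mulr0 normr0; split => //; exact: ltW.
have -> : W (x ^~ c) k * h - h * W (x ^~ t) k = h * (W (x ^~ c) k - W (x ^~ t) k) by ring.
rewrite normrM.
have H : `|W (x ^~ c) k - W (x ^~ t) k| <= L * (n%:R * (M * `|h|)).
  apply: causal_lipschitz_unif => //; first by rewrite mulr_ge0.
  move=> j; apply: le_trans (solution_lipschitz _ j c t WM xs c0 (ltW t0)) _.
  by rewrite ler_wpM2l.
apply: le_trans (ler_wpM2l (normr_ge0 h) H) _.
by rewrite -(real_normK (num_real h)); lra.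
Qed.

(** By Gronwall the sequence is Cauchy at each time, with a constant depending on [t] but the same
    rate. The limit inherits the Lipschitz bound and the quadratic Taylor bound, both uniform in
    [i], and is therefore a solution. *)
Lemma solution_limit (xs : nat -> 'I_n -> R -> R) (X : 'I_n -> R) :
  causal_lipschitz W L -> (forall z k, `|W z k| <= M) ->
  (forall i, sol (xs i)) -> (forall i j, `|xs i j 0 - X j| <= 1 * rate R i) ->
  exists x, [/\ sol x, forall j, x j 0 = X j &
    forall t, 0 <= t -> exists A, forall i j, `|xs i j t - x j t| <= A * rate R i].
Proof.
move=> WL WM xss xs0.
pose A t : R := expR (2 * L * n%:R * n%:R * t) * (1 + n%:R).
have A0 t : 0 <= A t by rewrite mulr_ge0 ?expR_ge0// addr_ge0.
have : forall jt : 'I_n * R, exists l, 0 <= jt.2 ->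
    forall i, `|xs i jt.1 jt.2 - l| <= A jt.2 * rate R i.
  (* Negative times receive the dummy value 0. *)
  move=> [j t] /=; have [t0|t0] := leP 0 t; last by exists 0.
  have r0 i : 0 <= rate R i by rewrite /rate invr_ge0.
  have H i i' : `|xs i j t - xs i' j t| <= A t * rate R i + A t * rate R i'.
    rewrite -mulrDr; apply: solution_continuity => //; first by rewrite addr_ge0.
    move=> j'; have h1 := xs0 i j'; have h2 := xs0 i' j'.
    rewrite !mul1r in h1 h2.
    have -> : xs i j' 0 - xs i' j' 0 = (xs i j' 0 - X j') - (xs i' j' 0 - X j') by ring.
    by rewrite (le_trans (ler_normB _ _))// lerD.
  by have [l Hl] := cauchy_rate_limit (fun i => xs i j t) (A t) H; exists l.
move=> /choice[x0 Hx]; pose x j t := x0 (j, t).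
have xlim j t i : 0 <= t -> `|xs i j t - x j t| <= A t * rate R i.
  by move=> t0; exact: (Hx (j, t)).
have x00 j : x j 0 = X j.
  apply/eqP; rewrite -subr_eq0 -normr_le0.
  apply: (le_of_le_add_inv _ _ (A 0 + 1)) => i.
  have := xlim j 0 i (lexx 0); have := xs0 i j; rewrite mulrDl => h1 h2.
  have -> : x j 0 - X j = - (xs i j 0 - x j 0) + (xs i j 0 - X j) by ring.
  by rewrite (le_trans (ler_normD _ _))// normrN; lra.
have xL j a b : 0 <= a -> 0 <= b -> `|x j a - x j b| <= M * `|a - b|.
  move=> a0 b0; apply: (le_of_le_add_inv _ _ (A a + A b)) => i.
  have := xlim j a i a0; have := xlim j b i b0; rewrite mulrDl => h1 h2.
  have h3 := solution_lipschitz _ j a b WM (xss i) a0 b0.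
  have -> : x j a - x j b = - (xs i j a - x j a) + (xs i j a - xs i j b) + (xs i j b - x j b) by ring.
  by rewrite (le_trans (ler_normD _ _))// (le_trans (lerD (ler_normD _ _) (lexx _)))// normrN; lra.
exists x; split => //; last by move=> t t0; exists (A t) => i j; exact: xlim.
move=> k; split; first exact: (within_halfline_of_lipschitz _ M (xL k)).
move=> t t0; have L0 := WL.1; have Mk : 0 <= M by exact: le_trans (WM (fun=> 0) k).
apply: (is_derive_of_quadratic _ _ _ (L * (n%:R * M)) t t0) => h ht.
have th : 0 <= t + h by move: ht; rewrite ltr_norml => /andP[]; lra.
apply: (le_of_le_add_inv _ _ (A (t + h) + A t + `|h| * (L * (n%:R * A t)))) => i.
have q : `|xs i k (t + h) - xs i k t - h * W (xs i ^~ t) k| <= L * (n%:R * M) * h ^+ 2.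
  exact: solution_taylor.
have w : `|h * (W (xs i ^~ t) k - W (x ^~ t) k)| <= `|h| * (L * (n%:R * A t)) * rate R i.
  rewrite normrM -mulrA ler_wpM2l//.
  have := causal_lipschitz_unif (xs i ^~ t) (x ^~ t) (A t * rate R i) k WL.
  rewrite !mulrA => H; apply: H; first by rewrite mulr_ge0// /rate invr_ge0.
  by move=> j; exact: (xlim j t i (ltW t0)).
have := xlim k (t + h) i th; have := xlim k t i (ltW t0).
have -> : x k (t + h) - x k t - h * W (x ^~ t) k =
  (xs i k (t + h) - xs i k t - h * W (xs i ^~ t) k) - (xs i k (t + h) - x k (t + h)) +
  (xs i k t - x k t) + h * (W (xs i ^~ t) k - W (x ^~ t) k) by ring.
move=> h1 h2; rewrite (le_trans (ler_normD _ _))//.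
rewrite (le_trans (lerD (ler_normD _ _) (lexx _)))//.
rewrite (le_trans (lerD (lerD (ler_normB _ _) (lexx _)) (lexx _)))//.
by rewrite !mulrDl; lra.
Qed.

End causal_ode.

(** * Trapped trajectories *)

Section trapped.
Context {R : realType} {n : nat} (W : ('I_n -> R) -> 'I_n -> R) (L M : R).
Implicit Types (x y : 'I_n -> R -> R) (z c : 'I_n -> R) (k j : 'I_n) (T t r lam : R).
Local Notation sol := (lifted_solution W).

Definition field_2pi : Prop := forall z (l : 'I_n -> int) k,
  W (fun j => z j + (l j)%:~R * (2 * pi)) k = W z k.

Lemma solution_shift x (l : 'I_n -> int) : field_2pi -> sol x ->
  sol (fun j t => x j t + (l j)%:~R * (2 * pi)).
Proof.
move=> Wp xs k; apply: dhl_ext (dhl_add _ _ _ _ (xs k) (dhl_cst ((l k)%:~R * (2 * pi)))) _ _ => //.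
by move=> t t0; rewrite addr0 Wp.
Qed.

Lemma to_circle_shift (a : R) (l : int) : to_circle (a + l%:~R * (2 * pi)) = to_circle a.
Proof. by apply/to_circleP; exists l; ring. Qed.

Lemma small_multiple_2pi (l : int) : `|l%:~R * (2 * pi) : R| < 2 * pi -> l = 0.
Proof.
have pi0 : 0 < 2 * pi :> R by rewrite mulr_gt0// pi_gt0.
rewrite normrM (gtr0_norm pi0) -[ltRHS]mul1r ltr_pM2r// -intr_norm -[ltRHS]/(1%:~R) ltr_int.
by case: l => [[|?]|?].
Qed.

Definition in_box k c r z : Prop := forall j, (j <= k)%N -> `|z j - c j| <= r.

(** With [r <= 1] the box is narrower than [2 * pi], so it determines the lift in the coordinates up
    to [k]. The inequality is strong monotonicity in the [k]-th coordinate, stated without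
    derivatives. *)
Definition expanding_box k c r lam : Prop :=
  [/\ 0 < lam, r <= 1 & forall z z', in_box k c r z -> in_box k c r z' ->
    (forall j, (j < k)%N -> z j = z' j) ->
    lam * (z k - z' k) ^+ 2 <= (W z k - W z' k) * (z k - z' k)].

Definition trapped k c r T : set (n.-tuple (circle R)) :=
  [set p | exists x, [/\ sol x, forall j, to_circle (x j 0) = tnth p j &
    forall t, T <= t -> in_box k c r (x ^~ t)]].

(* In an expanding box the difference of two trajectories with the same driving
   coordinates grows exponentially, so that two trapped ones coincide. *)
Lemma trapped_fiber k c r lam T p q : causal_lipschitz W L -> field_2pi ->
  expanding_box k c r lam -> 0 <= T -> trapped k c r T p -> trapped k c r T q ->
  (forall j, (j < k)%N -> tnth p j = tnth q j) -> tnth p k = tnth q k.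
Proof.
move=> WL Wp [lam0 r1 ex] T0 [x [xs xp xb]] [y [ys yq yb]] pq.
have pi4 : 4 <= 2 * pi :> R by have := @pi_ge2 R; lra.
have : forall j, exists l : int, (j < k)%N -> x j 0 = y j 0 + l%:~R * (2 * pi).
  move=> j; case: (ltnP j k) => jk; last by exists 0.
  have /to_circleP[l E] : to_circle (x j 0) = to_circle (y j 0) by rewrite xp yq pq.
  by exists l => _; rewrite -E; ring.
move=> /choice[l Hl].
have ys' := solution_shift y l Wp ys.
have same t j : 0 <= t -> (j < k)%N -> x j t = y j t + (l j)%:~R * (2 * pi).
  by move=> t0; apply: (solution_unique W L k x _ t WL xs ys' t0).
have eqjk t j : 0 <= t -> (j < k)%N -> x j t = y j t.
  (* Both lifts are in the box at time [T], so the integer shift between them is zero. *)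
  move=> t0 jk; rewrite same//; suff -> : l j = 0 by rewrite mul0r addr0.
  apply: small_multiple_2pi.
  have -> : (l j)%:~R * (2 * pi) = (x j T - c j) - (y j T - c j) by rewrite (same T j T0 jk); ring.
  have := xb T (lexx T) j (ltnW jk); have := yb T (lexx T) j (ltnW jk).
  by move=> h1 h2; rewrite (le_lt_trans (ler_normB _ _))//; lra.
pose v t := x k t - y k t.
pose dv t := W (x ^~ t) k - W (y ^~ t) k.
have vd : deriv_on_halfline v dv by apply: dhl_add (xs k) (dhl_opp _ _ (ys k)).
have H := dhl_mul _ _ _ _ (dhl_expR (- (2 * lam))) (dhl_mul _ _ _ _ vd vd).
have grow t : T <= t -> expR (- (2 * lam) * T) * (v T * v T) <= expR (- (2 * lam) * t) * (v t * v t).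
  move=> Tt; apply: (dhl_nondecreasing _ _ T t H T0 Tt) => s Ts _.
  have s0 : 0 <= s by lra.
  have := ex _ _ (xb s (ltW Ts)) (yb s (ltW Ts)) (fun j jk => eqjk s j s0 jk).
  rewrite -/(v s) -/(dv s) => e.
  have : 0 <= expR (- (2 * lam) * s) * (dv s * v s - lam * v s ^+ 2).
    by rewrite mulr_ge0 ?expR_ge0// subr_ge0.
  by lra.
have vb t : T <= t -> v t * v t <= 4.
  move=> Tt; have := xb t Tt k (leqnn k); have := yb t Tt k (leqnn k).
  rewrite !ler_norml => /andP[h1 h2] /andP[h3 h4].
  have : -2 <= v t <= 2 by rewrite /v; lra.
  by move=> /andP[h5 h6]; nra.
have vT : v T = 0.
  apply/eqP; apply/negPn/negP => vT0.
  have v2 : 0 < v T * v T by rewrite -expr2 exprn_even_gt0.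
  (* After this delay [v ^+ 2] is at least [v T ^+ 2 + 4], beyond the bound 4 imposed by the box. *)
  pose s := 2 / (lam * (v T * v T)).
  have s0 : 0 < s by rewrite divr_gt0// mulr_gt0.
  have := grow (T + s) ltac:(lra).
  rewrite (mulrDr _ T s) expRD -[leRHS]mulrA ler_pM2l ?expR_gt0// mulNr expRN.
  rewrite ler_pdivlMl ?expR_gt0// => g1.
  have g2 := expR_ge1Dx (2 * lam * s); have g3 := vb (T + s) ltac:(lra).
  have g4 : (1 + 2 * lam * s) * (v T * v T) <= expR (2 * lam * s) * (v T * v T).
    by rewrite ler_wpM2r// ltW.
  have g5 : lam * s * (v T * v T) = 2.
    rewrite mulrAC mulrC /s divfK// gt_eqF// mulr_gt0//.
  lra.
have : x k 0 = y k 0.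
  apply: (solution_unique_backward W L k.+1 x y T WL xs ys T0) => // j.
  rewrite ltnS leq_eqVlt => /predU1P[/val_inj ->|jk]; last exact: eqjk.
  by apply/eqP; rewrite -subr_eq0; apply/eqP.
by move=> E; rewrite -xp -yq E.
Qed.

(** Sequential closedness with a prescribed rate, in terms of representatives: the form that
    [solution_limit] consumes and that rational boxes can test. *)
Definition torus_closed (A : set (n.-tuple (circle R))) : Prop :=
  forall p, (forall i : nat, exists2 q, A q & forall j, exists a b : R,
    [/\ to_circle a = tnth q j, to_circle b = tnth p j & `|a - b| <= rate R i]) -> A p.

Lemma rate_small (A : R) : exists i0, forall i, (i0 <= i)%N -> A * rate R i <= 1 / 2.
Proof.
have A0 : 0 <= 2 * `|A| by rewrite mulr_ge0.
have := archi_boundP A0; set i0 := Num.bound _ => Hi.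
exists i0 => i ii0; rewrite /rate ler_pdivrMr//.
have h1 : i0%:R <= i.+1%:R :> R by rewrite ler_nat leqW.
have := ler_norm A; lra.
Qed.

Lemma rate_addn (i i0 : nat) : rate R (i + i0) <= rate R i.
Proof. by rewrite /rate lef_pV2 ?posrE// ler_nat ltnS leq_addr. Qed.

(** The approximating solutions are shifted so that their initial values converge to [X]. The shifts
    may depend on [i], but the box at time [T] makes them eventually constant up to coordinate [k],
    and the limit is shifted back. *)
Lemma trapped_closed k c r T : causal_lipschitz W L -> (forall z k, `|W z k| <= M) ->
  field_2pi -> r <= 1 -> 0 <= T -> torus_closed (trapped k c r T).
Proof.
move=> WL WM Wp r1 T0 p Hp.
have pi4 : 4 <= 2 * pi :> R by have := @pi_ge2 R; lra.
pose X j : R := repr (tnth p j).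
have XE j : to_circle (X j) = tnth p j by exact: reprK.
have : forall i : nat, exists xl : ('I_n -> R -> R) * ('I_n -> int),
    [/\ sol xl.1, forall t, T <= t -> in_box k c r (xl.1 ^~ t) &
      forall j, `|xl.1 j 0 + (xl.2 j)%:~R * (2 * pi) - X j| <= 1 * rate R i].
  move=> i; have [q [x [xs xq xb]] qp] := Hp i.
  have : forall j, exists l : int, `|x j 0 + l%:~R * (2 * pi) - X j| <= 1 * rate R i.
    move=> j; have [a [b [aq bp ab]]] := qp j.
    have /to_circleP[l1 E1] : to_circle a = to_circle (x j 0) by rewrite aq xq.
    have /to_circleP[l2 E2] : to_circle b = to_circle (X j) by rewrite bp XE.
    exists (l1 - l2); rewrite mul1r intrB mulrBl -E1 -E2.
    by have -> : x j 0 + (a - x j 0 - (b - X j)) - X j = a - b by ring.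
  by move=> /choice[l Hl]; exists (x, l).
move=> /choice[xl Hxl].
pose xs i j t := (xl i).1 j t + ((xl i).2 j)%:~R * (2 * pi).
have xss i : sol (xs i) by apply: solution_shift => //; case: (Hxl i).
have xs0 i j : `|xs i j 0 - X j| <= 1 * rate R i by case: (Hxl i) => _ _ H; exact: H.
have [x [xsol x0 xlim]] := solution_limit W L M xs X WL WM xss xs0.
have [A HA] := xlim T T0.
have [i0 Hi0] := rate_small A.
pose l := (xl i0).2.
(* The difference of the shifts is at most [1 / 2 + 1 / 2 + 1 + 1], less than [2 * pi]. *)
have const i j : (i0 <= i)%N -> (j <= k)%N -> (xl i).2 j = l j.
  move=> ii0 jk; apply/eqP; rewrite -subr_eq0; apply/eqP; apply: small_multiple_2pi.
  have [_ b1 _] := Hxl i; have [_ b2 _] := Hxl i0.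
  have h1 := b1 T (lexx T) j jk; have h2 := b2 T (lexx T) j jk.
  have h3 := le_trans (HA i j) (Hi0 i ii0).
  have h4 := le_trans (HA i0 j) (Hi0 i0 (leqnn _)).
  have -> : ((xl i).2 j - l j)%:~R * (2 * pi) =
    (xs i j T - x j T) - (xs i0 j T - x j T) - ((xl i).1 j T - c j) + ((xl i0).1 j T - c j).
    by rewrite intrB /xs -/l; ring.
  rewrite (le_lt_trans (ler_normD _ _))//.
  rewrite (le_lt_trans (lerD (ler_normB _ _) (lexx _)))//.
  rewrite (le_lt_trans (lerD (lerD (ler_normB _ _) (lexx _)) (lexx _)))//.
  lra.
exists (fun j t => x j t + (- l j)%:~R * (2 * pi)); split.
- exact: solution_shift.
- by move=> j; rewrite to_circle_shift x0 XE.
- move=> t Tt j jk; have [B HB] := xlim t (le_trans T0 Tt).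
  apply: (le_of_le_add_inv _ _ B) => i.
  have [_ b1 _] := Hxl (i + i0)%N; have h1 := b1 t Tt j jk.
  have h2 := HB (i + i0)%N j.
  have B0 : 0 <= B.
    have := le_trans (normr_ge0 _) h2; rewrite pmulr_lge0//.
    by rewrite /rate invr_gt0.
  have h3 : B * rate R (i + i0) <= B * rate R i by rewrite ler_wpM2l// rate_addn.
  have lE := const (i + i0)%N j (leq_addl _ _) jk.
  have -> : x j t + (- l j)%:~R * (2 * pi) - c j =
    ((xl (i + i0)%N).1 j t - c j) - (xs (i + i0)%N j t - x j t).
    by rewrite /xs lE mulrNz; ring.
  by rewrite (le_trans (ler_normB _ _))//; lra.
Qed.

End trapped.

(** * Null and measurable sets of the torus *)

Section torus_measure.
Context {R : realType}.
Local Notation circle := (circle R).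

Lemma to_circle_inj_itv (x y : R) : 0 <= x < 2 * pi -> 0 <= y < 2 * pi ->
  to_circle x = to_circle y -> x = y.
Proof.
move=> /andP[x0 x1] /andP[y0 y1] /to_circleP[k E].
suff k0 : k = 0 by move: E; rewrite k0 mul0r => /eqP; rewrite subr_eq0 => /eqP.
by apply: (@small_multiple_2pi R); rewrite -E ltr_norml; apply/andP; split; lra.
Qed.

Lemma integral_single_point (D : set R) (f : R -> \bar R) r : measurable D ->
  (forall x, D x -> x != r -> f x = 0%E) ->
  (\int[lebesgue_measure]_(x in D) f x = 0)%E.
Proof.
move=> mD f0; have mDr : measurable (D `\ r) by exact: measurableD.
have fE x : x \in D `\ r -> f x = 0%E.
  by rewrite inE => -[Dx xr]; apply: f0 => //; apply/eqP.
rewrite -(@integral_setD1 _ f r D)//.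
  by rewrite (eq_integral (cst 0%E)) ?integral0.
have f0' : {in D `\ r, cst 0%E =1 f} by move=> x xD; rewrite fE.
exact: (eq_measurable_fun _ f0' (measurable_cst _)).
Qed.

(** Fixing a coordinate before [k] leaves again a graph. At coordinate [k] itself all slices are
    empty but the one over a single angle, which does not affect the integral. *)
Lemma torus_lebesgue_graph n (k : 'I_n) (A : set (n.-tuple circle)) :
  (forall p q, A p -> A q -> (forall j : 'I_n, (j < k)%N -> tnth p j = tnth q j) ->
    tnth p k = tnth q k) -> torus_lebesgue A = 0%E.
Proof.
elim: n k A => [[]//|n IH] k A H /=.
have mD : measurable (`[0%R, (2 * pi)%R[%classic : set R) by exact: measurable_itv.
case: (unliftP ord0 k) H => [k' ->|->] H.
  under eq_integral => x _.
    rewrite (IH k'); first over.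
    move=> p q /= Ap Aq pq; have := H _ _ Ap Aq.
    rewrite !tnthS; apply => j; case: (unliftP ord0 j) => [j' ->|->]; last by rewrite !tnth0.
    by rewrite !tnthS !lift0 ltnS; exact: pq.
  by rewrite integral0.
have [[p0 Ap0]|A0] := pselect (exists p, A p); last first.
  under eq_integral => x _.
    rewrite (_ : [set p | _] = set0) ?torus_lebesgue0; first over.
    by apply/seteqP; split => p //= Ap; apply: A0; eexists; exact: Ap.
  by rewrite integral0.
(* If the class had no representative in the fundamental domain, every slice would be empty; the
   exceptional point 0 is then arbitrary. *)
have [[r [r0 rp]]|nor] := pselect (exists r : R, 0 <= r < 2 * pi /\ to_circle r = tnth p0 ord0).
  apply: (integral_single_point _ _ r) => //= x; rewrite in_itv /= => x0 xr.
  rewrite (_ : [set p | _] = set0) ?torus_lebesgue0//.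
  apply/seteqP; split => p //= Ap; case/eqP: xr; apply: to_circle_inj_itv => //.
  by have := H _ _ Ap Ap0 (fun j => _); rewrite tnth0 rp; apply.
apply: (integral_single_point _ _ 0) => //= x; rewrite in_itv /= => x0 _.
rewrite (_ : [set p | _] = set0) ?torus_lebesgue0//.
apply/seteqP; split => p //= Ap; apply: nor; exists x; split => //.
by have := H _ _ Ap Ap0 (fun j => _); rewrite tnth0; apply.
Qed.

Definition circle_box (e r : R) : set circle :=
  [set u | exists2 x, to_circle x = u & `|x - r| <= e].

Lemma measurable_circle_box e r : measurable (circle_box e r).
Proof.
suff : measurable (@to_circle R @^-1` circle_box e r) by [].
rewrite (_ : _ @^-1` _ = \bigcup_(i : nat) (if unpickle i is Some k then
    `[r - e + (k : int)%:~R * (2 * pi), r + e + k%:~R * (2 * pi)]%classic else set0)).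
  by apply: bigcupT_measurable => i; case: (unpickle i).
apply/seteqP; split => z /=.
  move=> [x /esym/to_circleP[k zx] xr]; exists (pickle k) => //.
  rewrite pickleK /= in_itv /=; move: xr; rewrite ler_norml => /andP[h1 h2].
  by apply/andP; split; lra.
move=> [i _]; case: (unpickle i) => // k; rewrite /= in_itv /= => /andP[h1 h2].
exists (z - k%:~R * (2 * pi)); last by rewrite ler_norml; apply/andP; split; lra.
by apply/to_circleP; exists (- k); rewrite mulrNz; ring.
Qed.

(** At scale [i] take the rational boxes of radius [rate R i / 2] that meet the set. There are
    countably many, and a point lying in one of them at every scale is a limit of points of the
    set. *)
Lemma measurable_torus_closed n (A : set (n.-tuple circle)) :
  torus_closed A -> measurable A.
Proof.
move=> clA.
pose box (i : nat) (r : {ffun 'I_n -> rat}) : set (n.-tuple circle) :=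
  \bigcap_(j in [set: 'I_n]) ((fun p => tnth p j) @^-1` circle_box (rate R i / 2) (ratr (r j))).
have mbox i r : measurable (box i r).
  apply: fin_bigcap_measurable; first exact: finite_finset.
  move=> j _.
  rewrite -[X in measurable X]setTI; apply: measurable_tnth => //.
  exact: measurable_circle_box.
rewrite (_ : A = \bigcap_i \bigcup_(l : nat)
    (if unpickle l is Some r then
       if `[< exists2 q, A q & box i r q >] then box i r else set0
     else set0)).
  apply: bigcapT_measurable => i; apply: bigcupT_measurable => l.
  by case: (unpickle l) => // r; case: ifP.
apply/seteqP; split => p /=.
  move=> Ap i _.
  have ri : 0 < rate R i / 2 by rewrite divr_gt0// /rate invr_gt0.
  have : forall j : 'I_n, exists q : rat, `|repr (tnth p j) - ratr q| <= rate R i / 2.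
    move=> j; have [q] := @rat_in_itvoo R (repr (tnth p j) - rate R i / 2) (repr (tnth p j)) ltac:(lra).
    rewrite in_itv /= => /andP[q1 q2]; exists q; rewrite ger0_norm; lra.
  move=> /choice[r Hr].
  have pbox : box i [ffun j => r j] p.
    by move=> j _ /=; exists (repr (tnth p j)); [exact: reprK|rewrite ffunE].
  exists (pickle [ffun j => r j]) => //; rewrite pickleK.
  by case: asboolP => // -[]; exists p.
move=> H; apply: clA => i; have [l _] := H i I.
case: (unpickle l) => // r; case: asboolP => // -[q Aq qb] pb.
exists q => // j; have [a aq ar] := qb j I; have [b bp br] := pb j I.
exists a, b; split => //.
have -> : a - b = (a - ratr (r j)) - (b - ratr (r j)) by ring.
by rewrite (le_trans (ler_normB _ _))//; lra.
Qed.

End torus_measure.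

(** * The attention field lifted to the line *)

Section kernel_bounds.
Context {R : realType} (beta : R).
Implicit Types x y : R.

Lemma kernel_e_le1 x : 0 < beta -> kernel_e beta x <= 1.
Proof. by move=> b0; rewrite expR_le1 pmulr_rle0// subr_le0 cos_le1. Qed.

Lemma kernel_e_norm x : 0 < beta -> `|kernel_e beta x| <= 1.
Proof. by move=> b0; rewrite ger0_norm ?kernel_e_le1// ltW// kernel_e_gt0. Qed.

Lemma kernel_h_norm_le1 x : 0 < beta -> `|kernel_h beta x| <= 1.
Proof. by move=> b0; rewrite normrM -[leRHS]mulr1 ler_pM// ?kernel_e_norm// sin_max. Qed.

Lemma kernel_lipschitz : 0 < beta -> exists2 K, 0 <= K &
  [/\ forall x y, `|kernel_e beta x - kernel_e beta y| <= K * `|x - y|,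
      forall x y, `|kernel_h beta x - kernel_h beta y| <= K * `|x - y| &
      forall x y, `|kernel_g beta x - kernel_g beta y| <= K * `|x - y|].
Proof.
(* One constant for three derivatives, bounded by [beta], [1 + beta] and
   [beta ^+ 2 + 3 * beta + 1]. *)
move=> b0; pose K := beta ^+ 2 + 3 * beta + 1.
have b2 := sqr_ge0 beta.
have s1 x : `|sin x| <= 1 := sin_max x.
have c1 x : `|cos x| <= 1 := cos_max x.
have s2 x : 0 <= sin x ^+ 2 <= 1.
  by rewrite sqr_ge0/= sin2cos2 gerBl sqr_ge0.
exists K; first by rewrite /K; lra.
have mul1 (u v B : R) : `|u| <= 1 -> `|v| <= B -> `|u * v| <= B.
  by move=> u1 vB; rewrite normrM -[leRHS]mul1r ler_pM.
split.
- apply: (lipschitz_of_deriv _ _ _ (is_derive_kernel_e beta)) => x.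
  rewrite -mulrA mulrC -mulrA; apply: (mul1) => //; apply: (mul1); first exact: kernel_e_norm.
  by rewrite normrN gtr0_norm// /K; lra.
- apply: (lipschitz_of_deriv _ _ _ (is_derive_kernel_h beta)) => x.
  apply: (mul1); first exact: kernel_e_norm.
  rewrite (le_trans (ler_normB _ _))// (le_trans (lerD (c1 x) (lexx _)))//.
  have /andP[h1 h2] := s2 x.
  by rewrite (ger0_norm (mulr_ge0 (ltW b0) h1)); have := ler_wpM2l (ltW b0) h2; rewrite /K; lra.
- apply: (lipschitz_of_deriv _ _ _ (is_derive_kernel_g beta)) => x.
  rewrite -mulrA; apply: (mul1); first exact: kernel_e_norm.
  apply: (mul1) => //; have /andP[h1 h2] := s2 x; have := c1 x.
  rewrite !ler_norml => /andP[h3 h4]; have h5 := ler_wpM2l b2 h2.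
  have h6 := ler_wpM2l (ltW b0) h4; have h7 := ler_wpM2l (ltW b0) h3.
  have h8 : 0 <= beta ^+ 2 * sin x ^+ 2 by rewrite mulr_ge0.
  by rewrite /K; apply/andP; split; lra.
Qed.

End kernel_bounds.

Section lifted_field.
Context {R : realType} {n m : nat} (beta : R) (a th : 'I_m -> R).
Implicit Types (x y z : 'I_n -> R) (k : 'I_n) (q : R -> R).

(** Tokens outside the strict past of [k] stay in the sum with weight 0, so that the index type does
    not depend on [k]. *)
Definition wts k (i : 'I_n + 'I_m) : R :=
  match i with inl j => (j < k)%N%:R | inr j => a j end.

Definition src x (i : 'I_n + 'I_m) : R :=
  match i with inl j => x j | inr j => th j end.

Definition pull q x k : R := source_sum q (wts k) (src x) (x k).

(* The self-interaction of a token contributes nothing to the force and [1] to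
   the normalisation. *)
Definition lifted_field x k : R :=
  - pull (kernel_h beta) x k / (1 + pull (kernel_e beta) x k).

Definition total_weight : R := n%:R + \sum_(j < m) a j.
Local Notation N := total_weight.

Lemma pullE q x k : pull q x k =
  \sum_(j < n | (j < k)%N) q (x k - x j) + \sum_(j < m) a j * q (x k - th j).
Proof.
rewrite /pull /source_sum big_sumType /=; congr (_ + _).
rewrite [RHS]big_mkcond; apply: eq_bigr => j _ /=.
by case: ifP => _; rewrite ?mul1r ?mul0r.
Qed.

Lemma attention_field_lift (p : n.-tuple (circle R)) x k :
  (forall j, tnth p j = to_circle (x j)) ->
  attention_field (n := n) beta a (fun j => to_circle (th j)) p k = lifted_field x k.
Proof.
move=> px.
have cE (u v : R) : cos (circle_sub (to_circle u) (to_circle v)) = cos (u - v).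
  by have [l ->] := circle_sub_to_circle u v; rewrite cos_2pi.
have sE (u v : R) : sin (circle_sub (to_circle u) (to_circle v)) = - sin (v - u).
  by have [l ->] := circle_sub_to_circle u v; rewrite sin_2pi -sinN opprB.
rewrite /attention_field /lifted_field mulrC; congr (_ / _).
  rewrite pullE opprD -!sumrN (bigD1 k)//= px sE subrr sin0 oppr0 mulr0 add0r.
  congr (_ + _).
    apply: eq_big => [j|j _]; first by rewrite ltn_neqAle andbC.
    by rewrite !px cE sE /kernel_h; ring.
  by apply: eq_bigr => j _; rewrite ?px cE sE /kernel_h; ring.
rewrite pullE addrA /attention_Z (bigD1 k)//= px cE subrr cos0 subrr mulr0 expR0.
congr (_ + _ + _).
  apply: eq_big => [j|j _]; first by rewrite ltn_neqAle andbC.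
  by rewrite !px cE.
by apply: eq_bigr => j _; rewrite ?px cE.
Qed.

Lemma wts_ge0 k i : (forall j, 1 <= a j) -> 0 <= wts k i.
Proof. by move=> a1; case: i => j //=; apply: le_trans (a1 j). Qed.

Lemma wts_sum k : \sum_i wts k i <= N.
Proof.
rewrite big_sumType /= lerD2r; apply: (@le_trans _ _ (\sum_(j < n) 1)).
  by apply: ler_sum => j _; case: ltnP.
by rewrite sumr_const card_ord.
Qed.

Lemma total_weight_ge0 : (forall j, 1 <= a j) -> 0 <= N.
Proof. by move=> a1; rewrite addr_ge0// sumr_ge0// => j _; apply: le_trans (a1 j). Qed.

Lemma pull_lipschitz q (K : R) x y k : (forall j, 1 <= a j) -> 0 <= K ->
  (forall s t, `|q s - q t| <= K * `|s - t|) ->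
  `|pull q x k - pull q y k| <= 2 * K * N * \sum_(j < n | (j <= k)%N) `|x j - y j|.
Proof.
move=> a1 K0 qK; set D := \sum_(j < n | _) _.
have Dj (j : 'I_n) : (j <= k)%N -> `|x j - y j| <= D.
  by move=> jk; rewrite /D (bigD1 j)//= lerDl sumr_ge0.
have D0 : 0 <= D by rewrite sumr_ge0.
rewrite /pull /source_sum -sumrB.
apply: le_trans (ler_norm_sum _ _ _) _.
apply: (@le_trans _ _ (\sum_i wts k i * (2 * K * D))); last first.
  rewrite -mulr_suml; apply: le_trans (ler_wpM2r _ (wts_sum k)) _.
    by rewrite !mulr_ge0.
  lra.
apply: ler_sum => i _; rewrite -mulrBr normrM (ger0_norm (wts_ge0 k i a1)).
case: i => [j|j] /=; last first.
  apply: ler_wpM2l; first exact: le_trans (a1 j).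
  apply: le_trans (qK _ _) _; rewrite -mulrA mulrCA ler_wpM2l//.
  have -> : x k - th j - (y k - th j) = x k - y k by ring.
  by have := Dj k (leqnn k); lra.
case: ltnP => jk; last by rewrite !mul0r.
rewrite !mul1r; apply: le_trans (qK _ _) _; rewrite -mulrA mulrCA ler_wpM2l//.
have -> : x k - x j - (y k - y j) = (x k - y k) - (x j - y j) by ring.
rewrite (le_trans (ler_normB _ _))//.
have := Dj k (leqnn k); have := Dj j (ltnW jk); lra.
Qed.

Lemma pull_bound q (B : R) x k : (forall j, 1 <= a j) -> 0 <= B ->
  (forall s, `|q s| <= B) -> `|pull q x k| <= N * B.
Proof.
move=> a1 B0 qB; apply: le_trans (ler_norm_sum _ _ _) _.
apply: le_trans (ler_wpM2r B0 (wts_sum k)); rewrite mulr_suml.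
by apply: ler_sum => i _; rewrite normrM (ger0_norm (wts_ge0 k i a1)) ler_wpM2l ?wts_ge0.
Qed.

Lemma pull_e_ge0 x k : (forall j, 1 <= a j) -> 0 <= pull (kernel_e beta) x k.
Proof.
by move=> a1; apply: sumr_ge0 => i _; rewrite mulr_ge0 ?wts_ge0// ltW// kernel_e_gt0.
Qed.

Lemma pull_2pi q x k (l : 'I_n -> int) : period2pi q ->
  pull q (fun j => x j + (l j)%:~R * (2 * pi)) k = pull q x k.
Proof.
move=> qp; apply: eq_bigr => -[j|j] _ /=; congr (_ * _).
  rewrite -[RHS](qp _ (l k - l j)) intrB; congr q; ring.
rewrite -[RHS](qp _ (l k)); congr q; ring.
Qed.

Lemma lifted_field_2pi : field_2pi lifted_field.
Proof.
move=> z l k; rewrite /lifted_field !pull_2pi//; [exact: kernel_e_2pi|exact: kernel_h_2pi].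
Qed.

Lemma lifted_field_bound x k : 0 < beta -> (forall j, 1 <= a j) -> `|lifted_field x k| <= N.
Proof.
move=> b0 a1; have Z0 := pull_e_ge0 x k a1.
rewrite normrM normrN normfV (ger0_norm (addr_ge0 ler01 Z0)) ler_pdivrMr; last lra.
have := pull_bound (kernel_h beta) 1 x k a1 ler01 (fun s => kernel_h_norm_le1 beta s b0).
rewrite mulr1 => H; apply: le_trans H _.
by rewrite ler_peMr ?total_weight_ge0//; lra.
Qed.

(** The variation of the normalisation comes with the factor [F'], which is small near a zero of the
    force. *)
Lemma ratio_diff (F F' Z Z' : R) : 1 <= Z -> 1 <= Z' ->
  - F / Z - (- F' / Z') = - (F - F') / Z + F' * (Z - Z') / (Z * Z').
Proof. by move=> Z1 Z1'; field; apply/andP; split; rewrite gt_eqF//; lra. Qed.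

Lemma lifted_field_lipschitz : 0 < beta -> (forall j, 1 <= a j) ->
  exists L, causal_lipschitz lifted_field L.
Proof.
move=> b0 a1; have [K K0 [Ke Kh _]] := kernel_lipschitz beta b0.
have N0 := total_weight_ge0 a1.
exists (2 * K * N + N * (2 * K * N)); split; first by rewrite addr_ge0// !mulr_ge0.
move=> x y k; have Zx := pull_e_ge0 x k a1; have Zy := pull_e_ge0 y k a1.
have He := pull_lipschitz _ K x y k a1 K0 Ke.
have Hh := pull_lipschitz _ K x y k a1 K0 Kh.
have Bh := pull_bound (kernel_h beta) 1 y k a1 ler01 (fun s => kernel_h_norm_le1 beta s b0).
rewrite mulr1 in Bh; rewrite /lifted_field ratio_diff; [|lra|lra].
set D := \sum_(j < n | _) _ in He Hh *.
have D0 : 0 <= D by rewrite sumr_ge0.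
rewrite [leRHS]mulrDl; apply: le_trans (ler_normD _ _) _; apply: lerD.
  rewrite normrM normrN normfV (ger0_norm (addr_ge0 ler01 Zx)) ler_pdivrMr; last lra.
  by apply: le_trans Hh _; rewrite ler_peMr ?mulr_ge0//; lra.
have ZZ : 1 <= (1 + pull (kernel_e beta) x k) * (1 + pull (kernel_e beta) y k).
  by rewrite -[leLHS]mulr1 ler_pM//; lra.
rewrite normrM normfV (ger0_norm (le_trans ler01 ZZ)) ler_pdivrMr; last lra.
have -> : 1 + pull (kernel_e beta) x k - (1 + pull (kernel_e beta) y k) =
  pull (kernel_e beta) x k - pull (kernel_e beta) y k by ring.
rewrite normrM; apply: le_trans (ler_pM _ _ Bh He) _ => //.
by rewrite mulrA ler_peMr ?mulr_ge0//.
Qed.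

(** Freezing the past at its limit [y] turns the [k]-th equation into a scalar autonomous one in
    [s]. *)
Definition upd y k (s : R) : 'I_n -> R := fun j => if j == k then s else y j.

Lemma eq_pull q x y k : (forall j : 'I_n, (j <= k)%N -> x j = y j) -> pull q x k = pull q y k.
Proof.
move=> xy; rewrite !pullE xy//; congr (_ + _).
by apply: eq_bigr => j jk; rewrite xy// ltnW.
Qed.

Lemma pull_upd q y k s : pull q (upd y k s) k = source_sum q (wts k) (src y) s.
Proof.
rewrite /pull /upd eqxx; apply: eq_bigr => -[j|j] _ //=.
by case: eqVneq => [->|//]; rewrite ltnn !mul0r.
Qed.

End lifted_field.

Lemma is_derive_source_sum {R : realType} (q dq : R -> R) (I : finType) (w y : I -> R) :
  (forall x, is_derive x (1 : R) q (dq x)) ->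
  forall x, is_derive x (1 : R) (source_sum q w y) (source_sum dq w y x).
Proof.
move=> qd x; rewrite /source_sum.
elim: (index_enum I) => [|i r IH].
  under eq_fun do rewrite big_nil.
  by rewrite big_nil; exact: is_derive_cst.
under eq_fun do rewrite big_cons.
rewrite big_cons; apply: is_deriveD.
have H := qd (x - y i).
have H1 : is_derive x (1 : R) (fun z => z - y i) 1.
  by apply: is_derive_eq; rewrite subr0.
have H2 := @is_derive1_comp R q (fun z => z - y i) x _ _ H H1.
rewrite mulr1 in H2.
have -> : (fun z => w i * q (z - y i)) = w i *: (q \o (fun z => z - y i)) by [].
exact: is_deriveZ.
Qed.

(** * Stable equilibria *)

Lemma simple_zero_sign {R : realType} (F : R -> R) (p d : R) :
  is_derive p (1 : R) F d -> F p = 0 -> d != 0 ->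
  exists2 r, 0 < r & forall v, v != 0 -> `|v| < r -> 0 < F (p + v) * (v * d).
Proof.
move=> Fd Fp d0; have e0 : 0 < `|d| / 2 by rewrite divr_gt0 ?normr_gt0.
have [r r0 H] := is_derive_littleo _ _ _ Fd _ e0.
exists r => // v v0 vr; have := H v vr; rewrite Fp subr0 => h1.
have vd : 0 < (v * d) * (v * d) by rewrite -expr2 exprn_even_gt0//= mulf_neq0.
have h2 : `|(F (p + v) - v * d) * (v * d)| <= (v * d) * (v * d) / 2.
  rewrite normrM normrM; apply: le_trans (ler_wpM2r _ h1) _; first by rewrite mulr_ge0.
  have -> : `|d| / 2 * `|v| * (`|v| * `|d|) = `|v * d| ^+ 2 / 2 by rewrite normrM; ring.
  by rewrite real_normK ?num_real// expr2.
by move: h2; rewrite ler_norml => /andP[h3 _]; lra.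
Qed.

Lemma eventually_forall {R : realType} (I : finType) (P : I -> R -> Prop) :
  (forall i, exists2 T, 0 < T & forall t, T <= t -> P i t) ->
  exists2 T, 0 < T & forall t, T <= t -> forall i, P i t.
Proof.
move=> H; have : forall i, exists T, 0 < T /\ forall t, T <= t -> P i t.
  by move=> i; have [T T0 HT] := H i; exists T.
move=> /choice[T HT]; exists (1 + \sum_i T i).
  by rewrite ltr_pwDl// sumr_ge0// => i _; case: (HT i) => /ltW.
move=> t Tt i; have [_ Hi] := HT i; apply: Hi; apply: le_trans Tt.
rewrite (bigD1 i)//= addrCA lerDl addr_ge0// sumr_ge0// => j _.
by case: (HT j) => /ltW.
Qed.

Section dynamics.
Context {R : realType} {n m : nat} (beta s eps c tau : R) (a th : 'I_m -> R).
Implicit Types (x : 'I_n -> R -> R) (y z : 'I_n -> R) (k : 'I_n) (e r v t : R).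
Local Notation h := (kernel_h beta).
Local Notation g := (kernel_g beta).
Local Notation N := (@total_weight R n m a).
Local Notation W := (@lifted_field R n m beta a th).
Local Notation d0 := (cluster_radius s eps tau).
Local Notation force y k := (source_sum h (wts a k) (src th y)).
Local Notation slope y k := (source_sum g (wts a k) (src th y)).

Record attention_conditions : Prop := AttentionConditions {
  att_gap : gap_conditions beta s eps c N tau;
  att_m : (0 < m)%N;
  att_a : forall j, 1 <= a j;
  att_sep : forall i j, i != j -> forall l : int,
    c * s < `|th i - th j + l%:~R * (2 * pi)| }.
Local Notation att := attention_conditions.

Definition near_center (v : R) : Prop :=
  exists i (l : int), `|v - th i + l%:~R * (2 * pi)| < d0.

Definition stable_at y k : Prop :=
  [/\ near_center (y k), pull a th h y k = 0 & 0 < pull a th g y k].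

Definition past_near y k : Prop := forall j : 'I_n, (j < k)%N -> near_center (y j).

Lemma att_beta : att -> 0 < beta.
Proof. by case=> G _ _ _; exact: gap_beta G. Qed.

(** Each past token is replaced by its copy modulo [2 * pi] next to a frozen token, hence the
    restriction to periodic [q]. *)
Lemma config_of_past y k : att -> past_near y k -> exists cl delta,
  source_config _ m N d0 (c * s) (wts a k) cl th delta /\
  forall q, period2pi q -> forall v, source_sum q (wts a k) (src th y) v =
    source_sum q (wts a k) (fun i => th (cl i) + delta i) v.
Proof.
case=> G m0 a1 sep past; have [r0 _ _] := cluster_radius_bounds _ _ _ _ _ _ G.
have : forall j : 'I_n, exists il : 'I_m * int, (j < k)%N ->
    `|y j - th il.1 + il.2%:~R * (2 * pi)| < d0.
  (* Tokens outside the past have weight 0; an arbitrary frozen token serves as their center. *)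
  move=> j; case: (ltnP j k) => jk; last by exists (Ordinal m0, 0).
  by have [i [l H]] := past j jk; exists (i, l).
move=> /choice[f Hf].
pose cl (i : 'I_n + 'I_m) := match i with inl j => (f j).1 | inr j => j end.
pose delta (i : 'I_n + 'I_m) : R := match i with
  | inl j => if (j < k)%N then y j - th (f j).1 + (f j).2%:~R * (2 * pi) else 0
  | inr j => 0 end.
exists cl, delta; split; first split.
- by move=> [j|j] /=; [case: ltnP => _; [right|left]|right; exact: a1].
- exact: wts_sum.
- by move=> j; exists (inr j); split => //; exact: a1.
- by move=> [j|j] /=; rewrite ?normr0//; case: ltnP => jk; rewrite ?normr0//; exact: Hf.
- exact: sep.
move=> q qp v; apply: eq_bigr => -[j|j] _ /=; last by rewrite addr0.
case: ltnP => jk; last by rewrite !mul0r.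
rewrite !mul1r -(qp _ (- (f j).2)); congr q; rewrite mulrNz; ring.
Qed.

Lemma force_dichotomy y k v : att -> past_near y k -> force y k v = 0 ->
  (near_center v /\ 0 < slope y k v) \/ slope y k v < 0.
Proof.
move=> A past; have [cl [delta [C E]]] := config_of_past y k A past.
rewrite !E; [|exact: kernel_g_2pi|exact: kernel_h_2pi] => Fv.
exact: (zero_force_dichotomy _ _ _ _ _ _ _ _ _ _ _ _ _ (att_gap A) C (att_m A) Fv).
Qed.

Lemma force_signs y k : att -> past_near y k ->
  (exists v, 0 < force y k v) /\ (exists v, force y k v < 0).
Proof.
move=> A past; have [cl [delta [C E]]] := config_of_past y k A past.
have G := att_gap A; have [r0 r1 r2] := cluster_radius_bounds _ _ _ _ _ _ G.
have [_ _ _ t0 _] := gap_arith _ _ _ _ _ _ G.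
have dt : d0 <= tau by lra.
have EE := E _ (kernel_h_2pi beta).
split; [exists (th (Ordinal (att_m A)) + d0)|exists (th (Ordinal (att_m A)) - d0)]; rewrite EE.
  exact: (force_gt0_center _ _ _ _ _ _ _ _ _ _ _ _ _ _ G C (lexx _) dt).
exact: (force_lt0_center _ _ _ _ _ _ _ _ _ _ _ _ _ _ G C (lexx _) dt).
Qed.

Lemma force_deriv y k v : is_derive v (1 : R) (force y k) (slope y k v).
Proof. exact: (is_derive_source_sum _ _ _ _ _ (kernel_g_deriv beta)). Qed.

Lemma force_nonzero_dense y k (u v : R) : att -> past_near y k -> u < v ->
  exists2 w, u < w < v & force y k w != 0.
Proof.
move=> A past uv; pose p := (u + v) / 2.
have [Fp|Fp] := eqVneq (force y k p) 0; last first.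
  by exists p => //; rewrite /p; apply/andP; split; lra.
have d0' : slope y k p != 0.
  by case: (force_dichotomy y k p A past Fp) => [[_ /gt_eqF->]|/lt_eqF->].
have [r r0 H] := simple_zero_sign _ _ _ (force_deriv y k p) Fp d0'.
pose w := Num.min (r / 2) ((v - u) / 4).
have w0 : 0 < w by rewrite lt_min !divr_gt0// subr_gt0.
have w1 : w <= r / 2 by rewrite ge_min lexx.
have w2 : w <= (v - u) / 4 by rewrite ge_min lexx orbT.
exists (p + w); first by rewrite /p; apply/andP; split; lra.
have /H : w != 0 by rewrite gt_eqF.
rewrite gtr0_norm// => /(_ ltac:(lra)); apply: contraTneq => ->.
by rewrite mul0r ltxx.
Qed.

Lemma lifted_field_upd y k v : W (upd y k v) k =
  - force y k v / (1 + source_sum (kernel_e beta) (wts a k) (src th y) v).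
Proof. by rewrite /lifted_field !pull_upd. Qed.

Lemma normalisation_gt0 y k v : att ->
  0 < 1 + source_sum (kernel_e beta) (wts a k) (src th y) v.
Proof.
by move=> A; rewrite -pull_upd ltr_pwDl// (pull_e_ge0 beta a th _ _ (att_a A)).
Qed.

Lemma lifted_field_upd_eq0 y k v : att -> (W (upd y k v) k == 0) = (force y k v == 0).
Proof.
move=> A; have Z := normalisation_gt0 y k v A.
by rewrite lifted_field_upd mulf_eq0 oppr_eq0 invr_eq0 (gt_eqF Z) orbF.
Qed.

Lemma lifted_field_upd_gt0 y k v : att -> (0 < W (upd y k v) k) = (force y k v < 0).
Proof.
move=> A; have Z := normalisation_gt0 y k v A.
by rewrite lifted_field_upd pmulr_lgt0 ?invr_gt0// oppr_gt0.
Qed.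

Lemma lifted_field_upd_lt0 y k v : att -> (W (upd y k v) k < 0) = (0 < force y k v).
Proof.
move=> A; have Z := normalisation_gt0 y k v A.
by rewrite lifted_field_upd pmulr_llt0 ?invr_gt0// oppr_lt0.
Qed.

Lemma field_freeze L x y k t : causal_lipschitz W L ->
  `|W (x ^~ t) k - W (upd y k (x k t)) k| <= L * \sum_(j < n | (j < k)%N) `|x j t - y j|.
Proof.
move=> [L0 WL]; apply: le_trans (WL _ _ k) _; rewrite ler_wpM2l//.
rewrite (bigD1 k)//= /upd eqxx subrr normr0 add0r le_eqVlt; apply/orP; left; apply/eqP.
apply: eq_big => [j|j /andP[_ jk]]; first by rewrite ltn_neqAle andbC.
by rewrite (negbTE jk).
Qed.

Lemma field_upd_lipschitz L y k u v : causal_lipschitz W L ->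
  `|W (upd y k u) k - W (upd y k v) k| <= L * `|u - v|.
Proof.
move=> [L0 WL]; apply: le_trans (WL _ _ k) _; rewrite ler_wpM2l//.
rewrite (bigD1 k)//= /upd eqxx big1 ?addr0// => j /andP[_ jk].
by rewrite (negbTE jk) subrr normr0.
Qed.

Lemma past_gap_small x y k e : (forall j : 'I_n, (j < k)%N -> tends_to (x j) (y j)) -> 0 < e ->
  exists2 T, 0 < T & forall t, T <= t -> \sum_(j < n | (j < k)%N) `|x j t - y j| < e.
Proof.
move=> xy e0; have n0 : 0 < n%:R + 1 :> R by rewrite ltr_wpDl.
have e1 : 0 < e / (n%:R + 1) by rewrite divr_gt0.
have H (j : 'I_n) : exists2 T, 0 < T & forall t, T <= t -> (j < k)%N -> `|x j t - y j| < e / (n%:R + 1).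
  case: (ltnP j k) => jk; last by exists 1.
  by have [T T0 HT] := xy j jk _ e1; exists T => // t Tt _; exact: HT.
have [T T0 HT] := eventually_forall _ _ H; exists T => // t Tt.
apply: (@le_lt_trans _ _ (\sum_(j < n) e / (n%:R + 1))).
  rewrite big_mkcond; apply: ler_sum => j _; case: ifP => [jk|_]; last exact: ltW.
  by apply: ltW; exact: HT.
rewrite sumr_const card_ord -[ltLHS]mulr_natl mulrCA gtr_pMr// ltr_pdivrMr// mul1r; lra.
Qed.

Lemma step_limit x y k : att -> lifted_solution W x -> past_near y k ->
  (forall j : 'I_n, (j < k)%N -> tends_to (x j) (y j)) ->
  exists2 l, force y k l = 0 & tends_to (x k) l.
Proof.
move=> A xs past xy.
have [L WL] := lifted_field_lipschitz beta a th (att_beta A) (att_a A) (n := n).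
have [[zp fzp] [zm fzm]] := force_signs y k A past.
pose f v := W (upd y k v) k.
have fp : period2pi f.
  move=> v l; rewrite /f !lifted_field_upd.
  by rewrite !(source_sum_2pi _ _ _ _ _ l)//; [exact: kernel_e_2pi|exact: kernel_h_2pi].
have asym (e : R) : 0 < e -> exists2 T, 0 < T &
    forall t, T <= t -> `|W (x ^~ t) k - f (x k t)| < e.
  move=> e0; have L1 : 0 < L + 1 by have := WL.1; lra.
  have [T T0 HT] := past_gap_small x y k (e / (L + 1)) xy (divr_gt0 e0 L1).
  exists T => // t Tt; apply: le_lt_trans (field_freeze L x y k t WL) _.
  have := HT t Tt; rewrite ltr_pdivlMr//.
  have : 0 <= \sum_(j < n | (j < k)%N) `|x j t - y j| by rewrite sumr_ge0.
  lra.
have fpos : exists w : R, 0 < f w by exists zm; rewrite /f lifted_field_upd_gt0.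
have fneg : exists w : R, f w < 0 by exists zp; rewrite /f lifted_field_upd_lt0.
have fdense u v : u < v -> exists2 w, u < w < v & f w != 0.
  move=> uv; have [w uw fw] := force_nonzero_dense y k u v A past uv.
  by exists w => //; rewrite /f lifted_field_upd_eq0.
have [l fl xl] := asymptotic_limit _ _ f L (xs k) WL.1
  (fun u v => field_upd_lipschitz L y k u v WL) fp asym fpos fneg fdense.
by exists l => //; apply/eqP; rewrite -lifted_field_upd_eq0//; apply/eqP.
Qed.

(** At time 0 only continuity is available. The strict initial inequality and the bound [B] give a
    short time [r] before which the level is not reached, and [barrier] takes over at [r]. *)
Lemma barrier0 (u du : R -> R) v (B : R) t : deriv_on_halfline u du ->
  (forall r, 0 < r -> `|du r| <= B) -> 0 <= t -> v < u 0 ->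
  (forall r, 0 < r -> r <= t -> u r = v -> 0 < du r) -> v <= u t.
Proof.
move=> ud duB t0 vu H; move: t0; rewrite le_eqVlt => /predU1P[<-|t0]; first exact: ltW.
have B0 : 0 <= B by exact: le_trans (duB 1 ltr01).
have B1 : 0 < B + 1 by lra.
pose r := Num.min t ((u 0 - v) / (B + 1)).
have r0 : 0 < r by rewrite lt_min t0 divr_gt0// subr_gt0.
have rt : r <= t by rewrite ge_min lexx.
have rB : r * (B + 1) <= u 0 - v by rewrite -ler_pdivlMr// ge_min lexx orbT.
apply: (barrier u du v r t ud r0 rt) => [q rq qt|]; first by apply: H => //; lra.
have := dhl_lipschitz u du B r 0 ud duB (ltW r0) (lexx 0).
by rewrite subr0 (gtr0_norm r0) ler_norml => /andP[h1 _]; lra.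
Qed.

Lemma stable_push y k r : att -> stable_at y k -> 0 < r ->
  exists2 e, 0 < e < r & W (upd y k (y k + e)) k < 0 /\ 0 < W (upd y k (y k - e)) k.
Proof.
move=> A [_ F0 G0] r0.
have [r1 r10 H] := simple_zero_sign _ _ _ (force_deriv y k (y k)) F0 (lt0r_neq0 G0).
pose e := Num.min r r1 / 2.
have m0 : 0 < Num.min r r1 by rewrite lt_min r0.
have e0 : 0 < e by rewrite /e divr_gt0.
have m1 : Num.min r r1 <= r by rewrite ge_min lexx.
have m2 : Num.min r r1 <= r1 by rewrite ge_min lexx orbT.
have er : e < r by rewrite /e; lra.
have er1 : e < r1 by rewrite /e; lra.
exists e; first by rewrite e0.
rewrite lifted_field_upd_lt0// lifted_field_upd_gt0//; split.
  have := H e (lt0r_neq0 e0); rewrite (gtr0_norm e0) => /(_ er1).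
  by rewrite pmulr_lgt0// mulr_gt0.
have := H (- e); rewrite oppr_eq0 normrN (gtr0_norm e0) => /(_ (lt0r_neq0 e0) er1).
by rewrite nmulr_lgt0// mulNr oppr_lt0 mulr_gt0.
Qed.

Lemma stable_confined y (K : nat) : att -> (forall k, stable_at y k) -> (K <= n)%N ->
  forall e, 0 < e -> exists2 d, 0 < d & forall x, lifted_solution W x ->
    (forall k, (k < K)%N -> `|x k 0 - y k| < d) ->
    forall t, 0 <= t -> forall k, (k < K)%N -> `|x k t - y k| < e.
Proof.
move=> A st; have [L WL] := lifted_field_lipschitz beta a th (att_beta A) (att_a A) (n := n).
elim: K => [_ e e0|K IH Kn e e0]; first by exists 1.
pose k := Ordinal Kn.
have [e1 /andP[e10 e1e] [f1 f2]] := stable_push y k e A (st k) e0.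
pose eta := Num.min (- W (upd y k (y k + e1)) k) (W (upd y k (y k - e1)) k).
have eta0 : 0 < eta by rewrite lt_min oppr_gt0 f1.
have [eta1 eta2] : eta <= - W (upd y k (y k + e1)) k /\ eta <= W (upd y k (y k - e1)) k.
  by rewrite !ge_min !lexx orbT.
have D0 : 0 < (L + 1) * (n%:R + 1).
  by rewrite mulr_gt0// ltr_wpDl//; case: WL.
pose e2 := Num.min e (eta / ((L + 1) * (n%:R + 1))).
have e20 : 0 < e2 by rewrite lt_min e0 divr_gt0.
have e2e : e2 <= e by rewrite ge_min lexx.
have e2eta : (L + 1) * (n%:R + 1) * e2 <= eta.
  by rewrite mulrC -ler_pdivlMr// ge_min lexx orbT.
have [d d_gt0 Hd] := IH (ltnW Kn) e2 e20.
exists (Num.min d e1); first by rewrite lt_min d_gt0.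
move=> x xs x0.
have small t (j : 'I_n) : 0 <= t -> (j < K)%N -> `|x j t - y j| < e2.
  move=> t0 jK; apply: (Hd x xs _ t t0 j jK) => i iK.
  by have := x0 i (ltnW iK); rewrite lt_min => /andP[].
have frozen t : 0 <= t -> `|W (x ^~ t) k - W (upd y k (x k t)) k| < eta.
  move=> t0; apply: le_lt_trans (field_freeze L x y k t WL) _.
  have L0 := WL.1; have n0 : 0 <= n%:R :> R by [].
  apply: (@le_lt_trans _ _ (L * (n%:R * e2))); last by nra.
  rewrite ler_wpM2l//; apply: (@le_trans _ _ (\sum_(j < n) e2)).
    rewrite big_mkcond; apply: ler_sum => j _; case: ifP => [jk|_]; last exact: ltW.
    by apply: ltW; exact: small.
  by rewrite sumr_const card_ord -[leLHS]mulr_natl.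
have bd := fun r (_ : 0 < r) => lifted_field_bound beta a th (x ^~ r) k (att_beta A) (att_a A).
have x0k : `|x k 0 - y k| < e1.
  by have := x0 k (ltnSn K); rewrite lt_min => /andP[].
move: x0k; rewrite ltr_norml => /andP[x01 x02].
move=> t t0 j; rewrite ltnS leq_eqVlt => /predU1P[jK|jK]; last first.
  exact: lt_le_trans (small t j t0 jK) e2e.
have -> : j = k by exact: val_inj.
have lo : y k - e1 <= x k t.
  apply: (barrier0 _ _ _ _ _ (xs k) bd t0); first lra.
  move=> r r0 _ xr; have := frozen r (ltW r0).
  by rewrite xr ltr_norml => /andP[]; lra.
have hi : - (y k + e1) <= - x k t.
  apply: (barrier0 _ _ _ N _ (dhl_opp _ _ (xs k)) _ t0); [by move=> r r0; rewrite normrN bd|lra|].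
  move=> r r0 _ /oppr_inj xr; have := frozen r (ltW r0).
  by rewrite xr ltr_norml => /andP[]; lra.
by rewrite ltr_norml; apply/andP; split; lra.
Qed.

Lemma stable_attractive y : att -> (forall k, stable_at y k) ->
  exists2 d, 0 < d & forall x, lifted_solution W x ->
    (forall k, `|x k 0 - y k| < d) -> forall k, tends_to (x k) (y k).
Proof.
move=> A st.
have : forall k, exists r, 0 < r /\ forall v, `|v - y k| < r -> force y k v = 0 -> v = y k.
  move=> k; have [_ F0 G0] := st k.
  have [r r0 H] := simple_zero_sign _ _ _ (force_deriv y k (y k)) F0 (lt0r_neq0 G0).
  exists r; split => // v vr Fv; apply/eqP; rewrite -subr_eq0; apply/negPn/negP => vy.
  by have := H _ vy vr; rewrite subrKC Fv mul0r ltxx.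
move=> /choice[r Hr].
(* A positive number below every [r k], in place of a minimum over a finite family. *)
pose e := (1 + \sum_k (r k)^-1)^-1.
have S0 : 0 < 1 + \sum_k (r k)^-1.
  by rewrite ltr_pwDl// sumr_ge0// => k _; rewrite invr_ge0; case: (Hr k) => /ltW.
have e0 : 0 < e by rewrite invr_gt0.
have er k : e < r k.
  have [rk _] := Hr k; rewrite -[r k]invrK ltf_pV2 ?posrE ?invr_gt0//.
  rewrite (bigD1 k)//= addrCA ltrDl ltr_pwDl// sumr_ge0// => j _.
  by rewrite invr_ge0; case: (Hr j) => /ltW.
have [d d0 Hd] := stable_confined y n A st (leqnn n) e e0.
exists d => // x xs x0.
have conf t k : 0 <= t -> `|x k t - y k| < e.
  by move=> t0; apply: (Hd x xs _ t t0 k (ltn_ord k)) => j _.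
have ind (K : nat) : forall k, (k < K)%N -> tends_to (x k) (y k).
  elim: K => // K IH k kK.
  have past : past_near y k by move=> j _; case: (st j).
  have [l Fl xl] := step_limit x y k A xs past (fun j jk => IH j (leq_trans jk kK)).
  suff -> : y k = l by [].
  have [_ uniq] := Hr k; apply/esym/uniq => //.
  apply: le_lt_trans (er k); rewrite leNgt; apply/negP => el.
  have [T T0 HT] := xl (`|l - y k| - e) ltac:(lra).
  have := HT T (lexx T); have := conf T k (ltW T0) => h1 h2.
  have : `|l - y k| <= `|x k T - y k| + `|x k T - l|.
    have -> : l - y k = (x k T - y k) - (x k T - l) by ring.
    exact: ler_normB.
  lra.
by move=> k; exact: (ind n k (ltn_ord k)).
Qed.

End dynamics.

(** * Unstable equilibria *)

Lemma mvt_between {R : realType} (f df : R -> R) (u v p r : R) :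
  (forall x, is_derive x (1 : R) f (df x)) -> `|u - p| <= r -> `|v - p| <= r ->
  exists2 w, `|w - p| <= r & f u - f v = df w * (u - v).
Proof.
move=> fd; rewrite !ler_norml => /andP[u1 u2] /andP[v1 v2].
have [uv|uv|->] := ltgtP u v.
- have [w /andP[w1 w2] E] := mvt f df u v fd uv.
  exists w; first by rewrite ler_norml; apply/andP; split; lra.
  by rewrite -opprB E; ring.
- have [w /andP[w1 w2] E] := mvt f df v u fd uv.
  by exists w => //; rewrite ler_norml; apply/andP; split; lra.
- by exists v; [rewrite ler_norml v1|rewrite !subrr mulr0].
Qed.

Section instability.
Context {R : realType} {n m : nat} (beta s eps c tau : R) (a th : 'I_m -> R).
Implicit Types (x : 'I_n -> R -> R) (y z : 'I_n -> R) (k : 'I_n) (e r v t : R).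
Local Notation h := (kernel_h beta).
Local Notation g := (kernel_g beta).
Local Notation N := (@total_weight R n m a).
Local Notation W := (@lifted_field R n m beta a th).
Local Notation att := (@attention_conditions R n m beta s eps c tau a th).
Local Notation stable_at := (@stable_at R n m beta s eps tau a th).
Local Notation force y k := (source_sum h (wts a k) (src th y)).
Local Notation slope y k := (source_sum g (wts a k) (src th y)).

Lemma sum_box_le y z k r : 0 <= r -> in_box k y r z ->
  \sum_(j < n | (j <= k)%N) `|z j - y j| <= n%:R * r.
Proof.
move=> r0 zb; apply: (@le_trans _ _ (\sum_(j < n) r)).
  by rewrite big_mkcond; apply: ler_sum => j _; case: ifP => // jk; exact: zb.
by rewrite sumr_const card_ord -[leLHS]mulr_natl.
Qed.

Lemma in_box_upd y z k r v : in_box k y r z -> `|v - y k| <= r -> in_box k y r (upd z k v).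
Proof. by move=> zb vb j jk; rewrite /upd; case: eqVneq => [->|_] //; exact: zb. Qed.

(** In the difference quotient of [- F / Z] the negative slope contributes at least
    [mu / (2 * (1 + N))]. The variation of [Z] costs at most half of that, because the force is
    small near its zero [y]. *)
Lemma expanding_near y k : att -> pull a th h y k = 0 -> pull a th g y k < 0 ->
  exists2 r, 0 < r & exists2 lam, 0 < lam & forall z z', in_box k y r z -> in_box k y r z' ->
    (forall j : 'I_n, (j < k)%N -> z j = z' j) ->
    lam * (z k - z' k) ^+ 2 <= (W z k - W z' k) * (z k - z' k).
Proof.
move=> A Fy Gy; have b0 := att_beta _ _ _ _ _ _ _ A; have a1 := att_a _ _ _ _ _ _ _ A.
have [K K0 [Ke Kh Kg]] := kernel_lipschitz beta b0.
have N0 : 0 <= N := total_weight_ge0 a a1.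
pose P := 2 * K * N; have P0 : 0 <= P by rewrite !mulr_ge0.
pose B := P * n%:R + 1; have B0 : 0 < B by rewrite ltr_wpDl// mulr_ge0.
pose mu := - pull a th g y k; have mu0 : 0 < mu by rewrite oppr_gt0.
have muE : pull a th g y k = - mu by rewrite opprK.
have D1 : 0 < 2 * B by rewrite mulr_gt0.
have D2 : 0 < 4 * (1 + N) * B * (P + 1) by rewrite !mulr_gt0//; lra.
(* The first bound keeps the slope below [- mu / 2] in the box, the second controls the product of
   the force with the Lipschitz constant [P] of the normalisation. *)
pose r := Num.min (mu / (2 * B)) (mu / (4 * (1 + N) * B * (P + 1))).
have r0 : 0 < r by rewrite lt_min !divr_gt0.
have r1 : r * (2 * B) <= mu by rewrite -ler_pdivlMr// ge_min lexx.
have r2 : r * (4 * (1 + N) * B * (P + 1)) <= mu by rewrite -ler_pdivlMr// ge_min lexx orbT.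
have lip q z : (forall u v, `|q u - q v| <= K * `|u - v|) -> in_box k y r z ->
    `|pull a th q z k - pull a th q y k| <= B * r.
  move=> qK zb; apply: le_trans (pull_lipschitz a th q K z y k a1 K0 qK) _.
  apply: le_trans (ler_wpM2l P0 (sum_box_le _ _ _ _ (ltW r0) zb)) _.
  by rewrite mulrA ler_pM2r// /B; lra.
exists r => //; exists (mu / (4 * (1 + N))); first by rewrite divr_gt0//; lra.
move=> z z' zb z'b zz'.
have updz' (j : 'I_n) : (j <= k)%N -> upd z k (z' k) j = z' j.
  by rewrite /upd; case: eqVneq => [->//|jk] jk'; apply: zz'; rewrite ltn_neqAle jk.
have Fz' : pull a th h z' k = force z k (z' k).
  by rewrite -pull_upd; apply/esym/eq_pull.
have [w wb FE] := mvt_between _ _ _ _ _ _ (force_deriv beta a th z k) (zb k (leqnn k)) (z'b k (leqnn k)).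
have slopew : slope z k w <= - mu / 2.
  have := lip g _ Kg (in_box_upd _ _ _ _ _ zb wb).
  by rewrite pull_upd muE ler_norml => /andP[_]; lra.
have Fsmall : `|pull a th h z' k| <= B * r by have := lip h _ Kh z'b; rewrite Fy subr0.
have Zz := pull_e_ge0 beta a th z k a1; have Zz' := pull_e_ge0 beta a th z' k a1.
have ZN : 1 + pull a th (kernel_e beta) z k <= 1 + N.
  have := pull_bound a th (kernel_e beta) 1 z k a1 ler01 (fun v => kernel_e_norm beta v b0).
  by rewrite mulr1 ger0_norm//; lra.
have Zdiff : `|pull a th (kernel_e beta) z k - pull a th (kernel_e beta) z' k| <= P * `|z k - z' k|.
  apply: le_trans (pull_lipschitz a th _ K z z' k a1 K0 Ke) _.
  rewrite -/P ler_wpM2l// (bigD1 k)//= big1 ?addr0// => j /andP[jk jk'].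
  by rewrite zz' ?subrr ?normr0// ltn_neqAle jk'.
rewrite /lifted_field ratio_diff; [|lra|lra].
set v := z k - z' k in FE Zdiff *.
set Z := 1 + pull a th (kernel_e beta) z k in ZN *.
set Z' := 1 + pull a th (kernel_e beta) z' k.
have Z1 : 1 <= Z by rewrite /Z; lra.
have Z1' : 1 <= Z' by rewrite /Z'; lra.
have FE' : pull a th h z k - pull a th h z' k = slope z k w * v by rewrite Fz'.
rewrite FE' [leRHS]mulrDl.
have T1 : mu / (2 * (1 + N)) * v ^+ 2 <= - (slope z k w * v) / Z * v.
  have -> : - (slope z k w * v) / Z * v = - slope z k w / Z * v ^+ 2 by ring.
  rewrite ler_wpM2r ?sqr_ge0// ler_pdivlMr; last lra.
  rewrite mulrAC ler_pdivrMr; last lra.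
  have h1 : mu * Z <= mu * (1 + N) by rewrite ler_wpM2l// ltW.
  have h2 := ler_wpM2r (_ : 0 <= 2 * (1 + N)) slopew.
  have {}h2 := h2 ltac:(lra); lra.
have T2 : - (mu / (4 * (1 + N)) * v ^+ 2) <= pull a th h z' k * (Z - Z') / (Z * Z') * v.
  have ZZ : 1 <= Z * Z' by rewrite -[leLHS]mulr1 ler_pM.
  have ZZ0 : 0 < Z * Z' by lra.
  have nb : `|pull a th h z' k * (Z - Z') / (Z * Z') * v| <= B * r * P * v ^+ 2.
    rewrite !normrM normfV (gtr0_norm ZZ0).
    have -> : B * r * P * v ^+ 2 = B * r * (P * `|v|) * `|v|.
      by rewrite -(real_normK (num_real v)); ring.
    rewrite ler_wpM2r// ler_pdivrMr//.
    have h1 : `|pull a th h z' k| * `|Z - Z'| <= B * r * (P * `|v|).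
      apply: ler_pM => //; rewrite /Z /Z'.
      by rewrite (_ : _ - _ = pull a th (kernel_e beta) z k - pull a th (kernel_e beta) z' k)//; ring.
    apply: le_trans h1 _; rewrite ler_peMr//.
    by rewrite !mulr_ge0// ltW.
  have h2 : B * r * P <= mu / (4 * (1 + N)).
    rewrite ler_pdivlMr; last lra.
    have : 0 <= B * r * (4 * (1 + N)) by rewrite !mulr_ge0 ?(ltW B0) ?(ltW r0)//; lra.
    lra.
  have h3 := ler_wpM2r (sqr_ge0 v) h2.
  move: nb; rewrite ler_norml => /andP[h4 _]; lra.
have h5 : mu / (2 * (1 + N)) = 2 * (mu / (4 * (1 + N))) by field; rewrite gt_eqF//; lra.
apply: le_trans (lerD T1 T2); rewrite h5; set lam := mu / _; lra.
Qed.

(** Rational centers, radii [rate R i] and integer times make the index countable. The real constant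
    [lam] is hidden in a test, and the set is empty if the box is not expanding. *)
Definition bad_set (i : 'I_n * {ffun 'I_n -> rat} * nat * nat) : set (n.-tuple (circle R)) :=
  let: (k, b, i, T) := i in
  let b' := fun j => ratr (b j) : R in
  if `[< exists lam, expanding_box W k b' (rate R i) lam >]
  then trapped W k b' (rate R i) T%:R else set0.

Lemma rate_le1 i : rate R i <= 1.
Proof. by rewrite /rate invf_le1// ler1n. Qed.

Lemma bad_set_measurable i : att -> measurable (bad_set i).
Proof.
move=> A; have b0 := att_beta _ _ _ _ _ _ _ A; have a1 := att_a _ _ _ _ _ _ _ A.
have [L WL] := lifted_field_lipschitz beta a th b0 a1 (n := n).
case: i => [[[k b] i] T] /=; case: asboolP => // _.
apply: measurable_torus_closed; apply: (trapped_closed _ L N) => //.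
- by move=> z j; exact: lifted_field_bound.
- exact: lifted_field_2pi.
- exact: rate_le1.
Qed.

(** Subsets of a graph are graphs; they are included because a null set is one all of whose
    measurable subsets have measure zero. *)
Lemma bad_set_null i (B : set (n.-tuple (circle R))) : att -> B `<=` bad_set i ->
  torus_lebesgue B = 0%E.
Proof.
move=> A; have b0 := att_beta _ _ _ _ _ _ _ A; have a1 := att_a _ _ _ _ _ _ _ A.
have [L WL] := lifted_field_lipschitz beta a th b0 a1 (n := n).
case: i => [[[k b] i] T] /=; case: asboolP => [[lam ex]|_] BB; last first.
  by have -> : B = set0; [rewrite -subset0|exact: torus_lebesgue0].
apply: (torus_lebesgue_graph _ k) => p q Bp Bq.
exact: (trapped_fiber _ _ _ _ _ _ _ _ _ WL (lifted_field_2pi beta a th) ex (ler0n _ _) (BB _ Bp) (BB _ Bq)).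
Qed.

Lemma unstable_trapped x y k (p : n.-tuple (circle R)) : att -> lifted_solution W x ->
  (forall j, to_circle (x j 0) = tnth p j) ->
  (forall j : 'I_n, (j <= k)%N -> tends_to (x j) (y j)) ->
  pull a th h y k = 0 -> pull a th g y k < 0 -> exists i, bad_set i p.
Proof.
move=> A xs xp xy Fy Gy; have [r r0 [lam lam0 ex]] := expanding_near y k A Fy Gy.
(* This gives [4 * rate R i <= r], so the box of radius [rate R i] around a nearby rational center
   fits into the expanding one. *)
have [i Hi] := rate_small (2 / r) (R := R).
have {}Hi := Hi i (leqnn i).
have ri0 : 0 < rate R i by rewrite /rate invr_gt0.
have ri : 4 * rate R i <= r by move: Hi; rewrite mulrAC ler_pdivrMr//; lra.
have : forall j : 'I_n, exists q : rat, `|y j - ratr q| <= rate R i / 2.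
  move=> j; have [q] := @rat_in_itvoo R (y j - rate R i / 2) (y j) ltac:(lra).
  by rewrite in_itv /= => /andP[q1 q2]; exists q; rewrite ger0_norm; lra.
move=> /choice[q Hq]; pose b := [ffun j => q j].
have Hb j : `|y j - ratr (b j)| <= rate R i / 2 by rewrite ffunE.
have ev (j : 'I_n) : exists2 T, 0 < T & forall t, T <= t -> (j <= k)%N ->
    `|x j t - ratr (b j)| <= rate R i.
  case: (leqP j k) => jk; last by exists 1.
  have [T T0 HT] := xy j jk (rate R i / 2) ltac:(lra).
  exists T => // t Tt _; have h1 := HT t Tt; have h2 := Hb j.
  have -> : x j t - ratr (b j) = (x j t - y j) + (y j - ratr (b j)) by ring.
  by rewrite (le_trans (ler_normD _ _))//; lra.
have [T T0 HT] := eventually_forall _ _ ev.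
exists (k, b, i, Num.bound T) => /=; case: asboolP => [_|[]]; last first.
  exists lam; split => //; first exact: rate_le1.
  have inb z : in_box k (fun j => ratr (b j)) (rate R i) z -> in_box k y r z.
    move=> zb j jk; have h1 := zb j jk; have h2 := Hb j.
    have -> : z j - y j = (z j - ratr (b j)) - (y j - ratr (b j)) by ring.
    by rewrite (le_trans (ler_normB _ _))//; lra.
  by move=> z z' /inb zb /inb z'b; exact: ex.
exists x; split => // t Tt j jk; apply: HT => //.
exact: le_trans (ltW (archi_boundP (ltW T0))) Tt.
Qed.

Lemma stable_at_ext y z k : (forall j : 'I_n, (j <= k)%N -> y j = z j) ->
  stable_at y k -> stable_at z k.
Proof.
move=> yz [yn F0 G0]; split; first by rewrite -yz.
  by rewrite -(eq_pull a th h y z k yz).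
by rewrite -(eq_pull a th g y z k yz).
Qed.

Lemma converges_off_bad_sets x (p : n.-tuple (circle R)) : att -> lifted_solution W x ->
  (forall j, to_circle (x j 0) = tnth p j) -> (forall i, ~ bad_set i p) ->
  exists y, forall k, stable_at y k /\ tends_to (x k) (y k).
Proof.
move=> A xs xp nb.
have ind (K : nat) : (K <= n)%N -> exists y, forall k, (k < K)%N ->
    stable_at y k /\ tends_to (x k) (y k).
  elim: K => [_|K IH Kn]; first by exists (fun=> 0).
  have [y Hy] := IH (ltnW Kn); pose k := Ordinal Kn.
  have past : past_near s eps tau th y k by move=> j jk; case: (Hy j jk) => -[].
  have [l Fl xl] := step_limit _ _ _ _ _ _ _ x y k A xs past (fun j jk => (Hy j jk).2).
  have yE (j : 'I_n) : (j < K)%N -> upd y k l j = y j.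
    by rewrite /upd; case: eqVneq => // ->; rewrite ltnn.
  have kE : upd y k l k = l by rewrite /upd eqxx.
  have lim (j : 'I_n) : (j <= k)%N -> tends_to (x j) (upd y k l j).
    rewrite leq_eqVlt => /predU1P[/val_inj ->|jk]; first by rewrite kE.
    by rewrite yE//; case: (Hy j jk).
  exists (upd y k l) => j; rewrite ltnS => jK; split; last exact: lim.
  move: jK; rewrite leq_eqVlt => /predU1P[jk|jK]; last first.
    apply: (stable_at_ext y) (Hy j jK).1 => i ij; apply/esym/yE.
    exact: leq_ltn_trans jK.
  have -> : j = k by exact: val_inj.
  have Fk : pull a th h (upd y k l) k = 0 by rewrite pull_upd.
  case: (force_dichotomy _ _ _ _ _ _ _ y k l A past Fl) => [[near Gl]|Gl].
    by split => //; rewrite ?kE// pull_upd.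
  have Gk : pull a th g (upd y k l) k < 0 by rewrite pull_upd.
  by have [i bi] := unstable_trapped x _ k p A xs xp lim Fk Gk; case: (nb i).
by have [y Hy] := ind n (leqnn n); exists y => k; exact: Hy.
Qed.

End instability.

(** * The theorem on the circle *)

Section circle_distance.
Context {R : realType}.
Implicit Types (a b d : R) (p q : circle R).

Lemma circle_dist_set_lbound p q : lbound [set r | exists x y : R,
  [/\ to_circle x = p, to_circle y = q & r = `|x - y|]] 0.
Proof. by move=> _ [x [y [_ _ ->]]]. Qed.

Lemma circle_dist_le a b : circle_dist (to_circle a) (to_circle b) <= `|a - b|.
Proof.
apply: ge_inf; first by exists 0; exact: circle_dist_set_lbound.
by exists a, b.
Qed.

Lemma circle_dist_ge0 a b : 0 <= circle_dist (to_circle a) (to_circle b).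
Proof.
apply: lb_le_inf; first by exists `|a - b|, a, b.
exact: circle_dist_set_lbound.
Qed.

Lemma circle_dist_lt a b d : circle_dist (to_circle a) (to_circle b) < d ->
  exists l : int, `|a - b + l%:~R * (2 * pi)| < d.
Proof.
move=> /(inf_lt (ex_intro _ `|a - b| _))[].
  by exists a, b.
move=> _ [x [y [/to_circleP[k xa] /to_circleP[l yb] ->]]] xy.
exists (k - l); rewrite intrB mulrBl -xa -yb.
by have -> : a - b + (x - a - (y - b)) = x - y by ring.
Qed.

End circle_distance.

Section lifting.
Context {R : realType} {n m : nat} (beta : R) (a th : 'I_m -> R).
Local Notation V := (attention_field (n := n) beta a (fun j => to_circle (th j))).
Local Notation W := (@lifted_field R n m beta a th).

Lemma solves_lift (phi : R -> n.-tuple (circle R)) : solves V phi ->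
  exists x, lifted_solution W x /\
    forall t k, 0 <= t -> to_circle (x k t) = tnth (phi t) k.
Proof.
move=> [x Hx]; exists x; split; last by move=> t k; case: (Hx k) => H _ _; exact: H.
move=> k; have [_ xc xd] := Hx k; split => // t t0.
rewrite -(attention_field_lift beta a th (phi t)); first exact: xd.
by move=> j; have [-> //] := Hx j; exact: ltW.
Qed.

(** The distance on the circle sees [y] modulo [2 * pi] only; integer shifts, a symmetry of the
    lifted field, bring the lift next to [y] itself. *)
Lemma solves_lift_near (phi : R -> n.-tuple (circle R)) (y : 'I_n -> R) d : solves V phi ->
  (forall k, circle_dist (tnth (phi 0) k) (to_circle (y k)) < d) ->
  exists x, [/\ lifted_solution W x,
    forall t k, 0 <= t -> to_circle (x k t) = tnth (phi t) k &
    forall k, `|x k 0 - y k| < d].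
Proof.
move=> /solves_lift[x [xs xp]] H.
have : forall k, exists l : int, `|x k 0 - y k + l%:~R * (2 * pi)| < d.
  by move=> k; apply: circle_dist_lt; rewrite xp.
move=> /choice[l Hl]; exists (fun k t => x k t + (l k)%:~R * (2 * pi)); split.
- exact: (solution_shift _ _ _ (lifted_field_2pi beta a th) xs).
- by move=> t k t0; rewrite to_circle_shift xp.
- by move=> k; rewrite addrAC.
Qed.

Lemma converges_of_tends_to (phi : R -> n.-tuple (circle R)) x (y : 'I_n -> R) :
  (forall t k, 0 <= t -> to_circle (x k t) = tnth (phi t) k) ->
  (forall k, tends_to (x k) (y k)) -> converges_to phi [tuple to_circle (y k) | k < n].
Proof.
move=> xp xy k; apply/cvgrPdist_lt => e e0; have [T T0 HT] := xy k e e0.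
exists T; split; first exact: num_real.
move=> t Tt; have t0 : 0 <= t by lra.
rewrite /= sub0r normrN -(xp t k t0) tnth_mktuple ger0_norm ?circle_dist_ge0//.
exact: le_lt_trans (circle_dist_le _ _) (HT t (ltW Tt)).
Qed.

End lifting.

Theorem theorem5p1 (R : realType) (n m : nat) (beta eps c : R)
  (theta : 'I_m -> circle R) (a : 'I_m -> R)
  (mu0 : probability (n.-tuple (circle R)) R)
  (hn : (1 <= n)%N) (hm : (1 <= m)%N)
  (hbeta : 0 < beta) (heps : 0 < eps) (hc : 2 + 2 * eps < c)
  (hsep : forall i j : 'I_m, i != j ->
    c * beta `^ (- (1 / 2)) < circle_dist (theta i) (theta j))
  (ha : forall j, 1 <= a j)
  (hmu0 : mu0 `<< @torus_lebesgue R n) :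
  let N := n%:R + \sum_(j < m) a j in
  let h := kernel_h beta in
  let g := kernel_g beta in
  let s := beta `^ (- (1 / 2)) in
  let V := attention_field (n := n) beta a theta in
  N * h ((c - 1 - 2 * eps) * s) < h (eps * s) ->
  - N * g ((c - 2 * eps) * s) < g (eps * s) ->
  {ae mu0, forall p0 : n.-tuple (circle R),
    forall phi : R -> n.-tuple (circle R),
      solves V phi -> phi 0 = p0 ->
      exists pstar : n.-tuple (circle R),
        [/\ converges_to phi pstar,
            critical V pstar,
            asymptotically_stable V pstar &
            forall k : 'I_n, exists j : 'I_m,
              circle_dist (tnth pstar k) (theta j) < eps * s]}.
Proof.
move=> N h g s V Hh Hg.
have [tau T] := turning_point_exists R beta hbeta.
have s0 : 0 < s by exact: powR_gt0.
have bs : beta * s ^+ 2 = 1.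
  rewrite /s -powR_mulrn ?powR_ge0// -powRrM (_ : _ * 2 = -1); last by lra.
  by rewrite powR_inv1 ?ltW// mulfV// gt_eqF.
pose th j : R := repr (theta j).
have thE : theta = (fun j => to_circle (th j)).
  by apply/funext => j; apply/esym; exact: reprK.
have N0 : 0 <= N := @total_weight_ge0 R n m a ha.
have A : @attention_conditions R n m beta s eps c tau a th.
  split => //.
  move=> i j /hsep; rewrite thE => H l.
  apply: lt_le_trans H _; rewrite -(to_circle_shift (th i) l).
  apply: le_trans (circle_dist_le _ _) _.
  by rewrite addrAC.
have [r0 r1 _] := cluster_radius_bounds _ _ _ _ _ _ (att_gap _ _ _ _ _ _ _ A).
pose bad := @bad_set R n m beta a th.
(* The exceptional initial conditions lie in the countable union of the bad sets, enumerated through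
   [pickle]. *)
apply: (@negligibleS _ _ _ _ (\bigcup_i (if unpickle i is Some b then bad b else set0))); last first.
  apply: negligible_bigcup => i; case: (unpickle i) => [b|]; last exact: negligible_set0.
  have mb : measurable (bad b) by exact: bad_set_measurable A.
  have nb : (@torus_lebesgue R n).-null_set (bad b).
    by move=> B _ Bb; exact: (bad_set_null _ _ _ _ _ _ _ _ _ A Bb).
  by exists (bad b); split => //; exact: (hmu0 (bad b) nb (bad b) mb (@subset_refl _ _)).
move=> p /= bp; apply: contrapT => nbp; apply: bp => phi; rewrite /V thE => sphi phi0.
have [x [xs xp]] := solves_lift beta a th phi sphi.
have x0 j : to_circle (x j 0) = tnth p j by rewrite xp// phi0.
have nb b : ~ bad b p by move=> bb; apply: nbp; exists (pickle b) => //; rewrite pickleK.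
have [y Hy] := converges_off_bad_sets _ _ _ _ _ _ _ x p A xs x0 nb.
have st k := (Hy k).1.
exists [tuple to_circle (y k) | k < n]; split.
- exact: converges_of_tends_to xp (fun k => (Hy k).2).
- move=> k; rewrite (attention_field_lift beta a th _ y); last by move=> j; rewrite tnth_mktuple.
  by rewrite /lifted_field; have [_ -> _] := st k; rewrite oppr0 mul0r.
- split.
    move=> e e0; have [d d0 Hd] := stable_confined _ _ _ _ _ _ _ y n A st (leqnn n) e e0.
    exists d => // psi spsi near t t0 k.
    have near' j : circle_dist (tnth (psi 0) j) (to_circle (y j)) < d.
      by have := near j; rewrite tnth_mktuple.
    have [z [zs zp z0]] := solves_lift_near beta a th psi y d spsi near'.
    rewrite -(zp t k t0) tnth_mktuple; apply: le_lt_trans (circle_dist_le _ _) _.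
    exact: (Hd z zs (fun j _ => z0 j) t t0 k (ltn_ord k)).
  have [d d0 Hd] := stable_attractive _ _ _ _ _ _ _ y A st.
  exists d => // psi spsi near.
  have near' j : circle_dist (tnth (psi 0) j) (to_circle (y j)) < d.
    by have := near j; rewrite tnth_mktuple.
  have [z [zs zp z0]] := solves_lift_near beta a th psi y d spsi near'.
  exact: converges_of_tends_to zp (Hd z zs z0).
- move=> k; have [[j [l yl]] _ _] := st k; exists j; rewrite tnth_mktuple.
  rewrite -(to_circle_shift (y k) l); apply: le_lt_trans (circle_dist_le _ _) _.
  by rewrite addrAC; exact: lt_le_trans yl r1.
Qed.
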